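(* Let $f:\mathbb{R}^d\to\mathbb{R}$ be differentiable with minimizer $x^*\in\arg\min_{x\in\mathbb{R}^d}f(x)$, let $x^0\in\mathbb{R}^d$, $R>0$, $R\ge\|x^0-x^*\|$, and $Q=B_{3R}(x^* )$. Suppose that for some $L>0$ and all $x,y\in Q$: $\|\nabla f(x)-\nabla f(y)\|\le L\|x-y\|$, $\|\nabla f(x)\|^2\le2L(f(x)-\inf_Qf)$, and $f(y)\ge f(x)+\langle\nabla f(x),y-x\rangle$. Suppose that for all $x\in\mathbb{R}^d$ the noise $\nu=\nabla f_\xi(x)-\nabla f(x)$ satisfies the structured noise assumption stated in the context with parameters $M_j,B_j,\beta_j$, $j=1,\dots,d$. Let $K>0$ be an integer, $\delta\in(0,1]$, $\theta>0$, and let $n\ge\Omega(\max_jM_j/\theta^2)$. Define \[ C=\frac{1+\theta}{\theta^2}\sqrt{\sum_{j=1}^dM_j^2}+\frac1{\theta^2}\sqrt{\sum_{j=1}^dM_j^2\left(\frac{2^{\beta_j}B_j}{n^{\beta_j-1}}\right)^{2/\beta_j}}, \] \[ D=\sum_{j=1}^d\left(\left(\frac{M_j}{\theta n}\right)^2+\left(\frac{2^{\beta_j}B_j}{\beta_jn^{\beta_j-1}}\right)^{2/\beta_j}\right)+\sum_{j=1}^d\left(\frac{B_jM_j}{\theta n^{\beta_j}}\right)^{2/(\beta_j+1)}, \] and $b=\mathcal{O}(C/n)$, $\sigma^2=\mathcal{O}(d(1+\theta^2)+D)$. Then clipped-SSTM with $\nabla f_{\Xi^k}(x^{k+1})$ being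 the smoothed median of means $\mathrm{SMoM}_{m,n}(\nabla f_\xi(x^{k+1}),\theta)$ of $\mathcal{O}(n)$ samples of $\nabla f_\xi(x^{k+1})$ (i.e. $m=\mathcal{O}(1)$) and with \[ a=\Theta\left(\max\left\{A^2,\frac{\sigma(K+1)^{3/2}\sqrt A}{LR},\frac{b(K+2)^2}{LR}\right\}\right),\quad\lambda_k=\Theta\left(\frac R{\alpha_{k+1}A}\right),\quad A=\ln\frac{4(K+1)}\delta, \] ensures after $K$ iterations, with probability at least $1-\delta$, that \[ f(y^K)-f(x^* )=\widetilde{\mathcal{O}}\left(\max\left\{\frac{LR^2}{K^2},\ \frac{\sqrt{(1+\theta^2)d+D}\,R}{\sqrt K},\ \frac{(1+\theta)CR}{\theta^2 n}\right\}\right). \] The overall number of oracle calls equals $\mathcal{O}(nK)$.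
   Context: $\|\cdot\|$ is the Euclidean norm; $B_r(x^* )$ is the ball of radius $r$ centred at $x^*$. $\mathrm{clip}(x,\lambda)=\min\{1,\lambda/\|x\|\}x$ for $x\ne0$, $\mathrm{clip}(0,\lambda)=0$. $\nabla f_\xi(x)$ is the random vector returned by the stochastic oracle at $x$; each sample is one oracle call. clipped-SSTM with parameter $a>0$: $z^0=y^0=x^0$, $\alpha_0=A_0=0$, $\alpha_{k+1}=\frac{k+2}{2aL}$, $A_{k+1}=A_k+\alpha_{k+1}$ (the sequence $A_k$ is not to be confused with the logarithm $A$), and for $k\ge0$ \[ x^{k+1}=\frac{A_ky^k+\alpha_{k+1}z^k}{A_{k+1}},\quad z^{k+1}=z^k-\alpha_{k+1}\mathrm{clip}(\nabla f_{\Xi^k}(x^{k+1}),\lambda_k),\quad y^{k+1}=\frac{A_ky^k+\alpha_{k+1}z^{k+1}}{A_{k+1}}, \] where $\nabla f_{\Xi^k}(x^{k+1})$ is sampled independently of previous iterations. Structured noise assumption: for any $x$ and each $j$, $\nabla f_\xi(x)$ has an absolutely continuous distribution and the marginal density $p_j$ of the $j$-th component of $\nu$ satisfies: (i) there is $M_j>0$ such that $r_j(u)=(p_j(u)-p_j(-u))/2$ fulfils $\int u\,r_j(u)\,du=0$ and $\int u^2|r_j(u)|\,du\le M_j$; (ii) there are $B_j>0$, $\beta_j\ge1$ such that for any $k\in\mathbb{N}$, $s_j^{*k}(u)\le B_jk/(k^{(\beta_j+1)/\beta_j}+|u|^{1+\beta_j})$, where $s_j(u)=(p_j(u)+p_j(-u))/2$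 and $s^{*k}$ is the $k$-fold convolution. Smoothed median of means: for a random element $\zeta$ in $\mathbb{R}^d$, let $\zeta_1,\dots,\zeta_{(2m+1)n}$ be i.i.d. copies of $\zeta$, $\eta_1,\dots,\eta_{2m+1}\sim\mathcal{N}(0,I_d)$ independent, and $\upsilon_j=\frac1n\sum_{i=1}^n\zeta_{jn+i}+\theta\eta_{j+1}$, $j=0,\dots,2m$; then $\mathrm{SMoM}_{m,n}(\zeta,\theta)$ is the component-wise median of $\upsilon_0,\dots,\upsilon_{2m}$. Here $m$ is a universal constant integer with $m>2+3/\beta_j$ for all $j$ (possible since $\beta_j\ge1$). $\Theta,\Omega,\mathcal{O}$: suitably chosen universal constant factors. $\widetilde{\mathcal{O}}(\cdot)$ hides constant and polylogarithmic factors.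
   Formalization: The constant hidden in the final Õ bound may depend on an upper bound θ0 for θ (it is uniform over 0 < θ ≤ θ0), since the bound with a constant independent of θ fails as θ → ∞; all constants in Ω, Θ, O stay universal. *)

(* Defs.v *)
From HB Require Import structures.
From mathcomp Require Import all_boot all_order all_algebra.
From mathcomp Require Import all_classical all_reals all_analysis.
Import Order.TTheory GRing.Theory Num.Theory.
Import numFieldNormedType.Exports.

Set Implicit Arguments.
Unset Strict Implicit.
Unset Printing Implicit Defensive.

Local Open Scope classical_set_scope.
Local Open Scope ring_scope.

(* The library norm on 'rV[R]_d is the sup norm: it is only used for
   differentiability and continuity (where the choice of norm is immaterial). *)
Definition dotv (R : realType) (d : nat) (u v : 'rV[R]_d) : R :=
  \sum_(j < d) u 0 j * v 0 j.

Definition enorm (R : realType) (d : nat) (u : 'rV[R]_d) : R :=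
  Num.sqrt (dotv u u).

Definition eball (R : realType) (d : nat) (c : 'rV[R]_d) (r : R) :
  set 'rV[R]_d := [set x | enorm (x - c) <= r].

Definition gradient (R : realType) (d : nat) (f : 'rV[R]_d -> R)
  (x : 'rV[R]_d) : 'rV[R]_d := \row_(j < d) 'D_(delta_mx 0 j) f x.

Definition clip (R : realType) (d : nat) (x : 'rV[R]_d) (lam : R) :
  'rV[R]_d := if x == 0 then 0 else Num.min 1 (lam / enorm x) *: x.

Section stochastic_oracle.
Context (R : realType) (d : nat) (disp : measure_display)
  (Xi : measurableType disp).

(* [oracle w x] is the vector nabla f_w(x) returned at x for the random seed w.
   Vectors are passed as tuples to use the product sigma-algebra of R^d. *)
Definition jointly_measurable (oracle : Xi -> 'rV[R]_d -> 'rV[R]_d) : Prop :=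
  forall j : 'I_d, measurable_fun setT
    (fun p : Xi * d.-tuple R => oracle p.1 (\row_i tnth p.2 i) 0 j).

Definition lebesgue_null (N : set 'rV[R]_d) : Prop :=
  forall e : R, 0 < e -> exists a b : nat -> 'rV[R]_d,
    [/\ forall i j, a i 0 j <= b i 0 j,
        N `<=` \bigcup_i [set v | forall j, a i 0 j <= v 0 j <= b i 0 j] &
        (\sum_(0 <= i <oo) (\prod_(j < d) (b i 0 j - a i 0 j))%:E <= e%:E)%E].

Definition absolutely_continuous_law (law : probability Xi R)
  (G : Xi -> 'rV[R]_d) : Prop :=
  forall N : set 'rV[R]_d, lebesgue_null N -> law.-negligible (G @^-1` N).

Definition is_density (law : probability Xi R) (X : Xi -> R) (p : R -> R) :
  Prop :=
  [/\ measurable_fun setT p, forall u, 0 <= p u &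
      forall B : set R, measurable B ->
        law (X @^-1` B) = (\int[lebesgue_measure]_(u in B) (p u)%:E)%E].

Definition convolution (f g : R -> \bar R) : R -> \bar R :=
  fun u => (\int[lebesgue_measure]_v (f (u - v)%R * g v))%E.

(* k-fold convolution of a function with itself, for k >= 1. *)
Definition convolution_pow (f : R -> \bar R) (k : nat) : R -> \bar R :=
  iter k.-1 (convolution f) f.

Definition odd_part (p : R -> R) (u : R) : R := (p u - p (- u)) / 2.
Definition even_part (p : R -> R) (u : R) : R := (p u + p (- u)) / 2.

(* Structured noise assumption for an oracle answer G at a point where the true
   gradient is g.  The function u * r_j(u) is integrable because r_j and
   u^2 r_j(u) are, so the vanishing integral is meaningful. *)
Definition structured_noise (law : probability Xi R) (G : Xi -> 'rV[R]_d)
    (g : 'rV[R]_d) (M B beta : 'I_d -> R) : Prop :=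
  absolutely_continuous_law law G /\
  forall j : 'I_d, exists p : R -> R,
    [/\ is_density law (fun w => (G w - g) 0 j) p,
        [/\ 0 < M j,
            (\int[lebesgue_measure]_u (u * odd_part p u)%:E = 0)%E &
            (\int[lebesgue_measure]_u (u ^+ 2 * `|odd_part p u|)%:E
               <= (M j)%:E)%E] &
        [/\ 0 < B j, 1 <= beta j &
            forall (k : nat) (u : R), (0 < k)%N ->
              (convolution_pow (fun v => (even_part p v)%:E) k u <=
                (B j * k%:R / (k%:R `^ ((beta j + 1) / beta j)
                               + `|u| `^ (1 + beta j)))%:E)%E]].

End stochastic_oracle.

(* Independence of a family of classes of events: product rule over every
   finite subfamily. *)
Definition mutually_independent (R : realType) (disp : measure_display)
  (T : measurableType disp) (P : probability T R) (I : eqType)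
  (F : I -> set (set T)) : Prop :=
  forall (s : seq I) (A : I -> set T), uniq s ->
    (forall i, i \in s -> F i (A i)) ->
    P (\bigcap_(i in [set i | i \in s]) A i) = (\prod_(i <- s) P (A i))%E.

Section randomness.
Context (R : realType) (d q : nat) (disp : measure_display)
  (T : measurableType disp) (disp' : measure_display)
  (Xi : measurableType disp').

(* Sigma-algebras generated by the seeds [xi t] of the oracle calls and by the
   components of the Gaussian vectors [eta k j]. *)
Definition events_of (xi : nat -> T -> Xi)
    (eta : nat -> 'I_q -> T -> 'rV[R]_d) (i : nat + nat * 'I_q * 'I_d) :
  set (set T) :=
  match i with
  | inl t => preimage_set_system setT (xi t) measurable
  | inr (k, j, l) =>
      preimage_set_system setT (fun w => eta k j w 0 l) measurable
  end.

(* The seeds are i.i.d. with distribution [law]; the vectors [eta k j] are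
   N(0, I_d), i.e. have independent N(0, 1) components; everything is
   independent. *)
Definition fresh_randomness (P : probability T R) (law : probability Xi R)
    (xi : nat -> T -> Xi) (eta : nat -> 'I_q -> T -> 'rV[R]_d) : Prop :=
  [/\ (forall t, measurable_fun setT (xi t)),
      (forall t (B : set Xi), measurable B -> P (xi t @^-1` B) = law B),
      (forall k j l, measurable_fun setT (fun w => eta k j w 0 l)),
      (forall k j l (B : set R), measurable B ->
        P ((fun w => eta k j w 0 l) @^-1` B) = normal_prob 0 1 B) &
      mutually_independent P (events_of xi eta)].

End randomness.

Section algorithm.
Context (R : realType) (d : nat).

(* The median of a sequence of odd size. *)
Definition median (s : seq R) : R := nth 0 (sort <=%R s) (size s)./2.

Definition smom_block (n : nat) (theta : R) (zeta : seq 'rV[R]_d) (j : nat)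
    (etaj : 'rV[R]_d) : 'rV[R]_d :=
  n%:R^-1 *: \sum_(i < n) nth 0 zeta (j * n + i)%N + theta *: etaj.

Definition smom (m n : nat) (theta : R) (zeta : seq 'rV[R]_d)
    (eta : 'I_(m.*2.+1) -> 'rV[R]_d) : 'rV[R]_d :=
  \row_(l < d)
    median [seq smom_block n theta zeta j (eta j) 0 l
           | j : 'I_(m.*2.+1) <- enum 'I_(m.*2.+1)].

(* [answer t x] is the answer to the t-th oracle call, made at the point x.
   Computations that use the oracle thread the number of calls made so far. *)
Definition call_oracle (answer : nat -> 'rV[R]_d -> 'rV[R]_d) (x : 'rV[R]_d)
  (t : nat) : 'rV[R]_d * nat := (answer t x, t.+1).

Fixpoint sample_oracle (answer : nat -> 'rV[R]_d -> 'rV[R]_d) (N : nat)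
    (x : 'rV[R]_d) (t : nat) : seq 'rV[R]_d * nat :=
  if N is N'.+1 then
    let (v, t1) := call_oracle answer x t in
    let (s, t2) := sample_oracle answer N' x t1 in
    (v :: s, t2)
  else ([::], t).

Definition smom_estimator (m n : nat) (theta : R)
    (answer : nat -> 'rV[R]_d -> 'rV[R]_d)
    (eta : nat -> 'I_(m.*2.+1) -> 'rV[R]_d)
    (k : nat) (x : 'rV[R]_d) (t : nat) : 'rV[R]_d * nat :=
  let (zeta, t') := sample_oracle answer (m.*2.+1 * n) x t in
  (smom n theta zeta (eta k), t').

Definition alpha (a L : R) (k : nat) : R :=
  if k is k'.+1 then k'.+2%:R / (2 * a * L) else 0.

Fixpoint Asum (a L : R) (k : nat) : R :=
  if k is k'.+1 then Asum a L k' + alpha a L k else 0.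

Record sstm_state := SSTMState {
  sstm_y : 'rV[R]_d;
  sstm_z : 'rV[R]_d;
  sstm_calls : nat
}.

(* [estimator k x t] is the gradient estimator at x used in iteration k when t
   oracle calls have been made, together with the updated number of calls. *)
Definition sstm_step (a L : R) (lam : nat -> R)
    (estimator : nat -> 'rV[R]_d -> nat -> 'rV[R]_d * nat)
    (k : nat) (s : sstm_state) : sstm_state :=
  let Ak := Asum a L k in
  let Ak1 := Asum a L k.+1 in
  let al := alpha a L k.+1 in
  let x' := Ak1^-1 *: (Ak *: sstm_y s + al *: sstm_z s) in
  let (g, t') := estimator k x' (sstm_calls s) in
  let z' := sstm_z s - al *: clip g (lam k) in
  let y' := Ak1^-1 *: (Ak *: sstm_y s + al *: z') in
  SSTMState y' z' t'.

Fixpoint clipped_sstm (a L : R) (lam : nat -> R)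
    (estimator : nat -> 'rV[R]_d -> nat -> 'rV[R]_d * nat)
    (x0 : 'rV[R]_d) (k : nat) : sstm_state :=
  if k is k'.+1 then
    sstm_step a L lam estimator k' (clipped_sstm a L lam estimator x0 k')
  else SSTMState x0 x0 0.

End algorithm.

Section constants.
Context (R : realType) (d : nat).

Definition Cconst (theta : R) (n : nat) (M B beta : 'I_d -> R) : R :=
  (1 + theta) / theta ^+ 2 * Num.sqrt (\sum_(j < d) M j ^+ 2)
  + 1 / theta ^+ 2 *
    Num.sqrt (\sum_(j < d) M j ^+ 2 *
      (2 `^ beta j * B j / n%:R `^ (beta j - 1)) `^ (2 / beta j)).

Definition Dconst (theta : R) (n : nat) (M B beta : 'I_d -> R) : R :=
  \sum_(j < d) ((M j / (theta * n%:R)) ^+ 2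
    + (2 `^ beta j * B j / (beta j * n%:R `^ (beta j - 1))) `^ (2 / beta j))
  + \sum_(j < d) (B j * M j / (theta * n%:R `^ beta j)) `^ (2 / (beta j + 1)).

Definition log_term (K : nat) (delta : R) : R := ln (4 * K.+1%:R / delta).

Definition step_param (L rad b sigma A : R) (K : nat) : R :=
  Num.max (Num.max (A ^+ 2)
                   (sigma * K.+1%:R `^ (3 / 2) * Num.sqrt A / (L * rad)))
          (b * K.+2%:R ^+ 2 / (L * rad)).

Definition final_rate (L rad theta C D : R) (n K : nat) : R :=
  Num.max (Num.max (L * rad ^+ 2 / K%:R ^+ 2)
                   (Num.sqrt ((1 + theta ^+ 2) * d%:R + D) * rad
                      / Num.sqrt K%:R))
          ((1 + theta) * C * rad / (theta ^+ 2 * n%:R)).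

End constants.

(* Main.v *)
(* Let x' be the minimizer and Phi_k = |z^k - x'|^2 / 2 + A_k (f(y^k) - f(x')).
   One iteration satisfies
   Phi_{k+1} <= Phi_k - alpha <e, z^k - x'> + alpha^2 |e|^2, where e is the error of
   the clipped estimator.  As long as Phi_k <= 3 R^2 / 2, all points stay in the ball
   where f is smooth and the gradients are below half the clipping level; then
   s alpha |e| is bounded for s = 2 A / R^2, and E exp(s (Phi_{k+1} - Phi_k)) is at most
   exp(c_k) with c_k determined by the bias and the variance of the estimator.  The
   choice of a gives c_0 + ... + c_{K-1} <= A, while exp(s Phi_0) <= exp(A) and
   exp(s Phi) > exp(3 A) upon exit, so the exit probability is at most K exp(-A) <= delta.
   On the complement f(y^K) - f(x') <= Phi_K / A_K.

   Bias and variance of a smoothed median of means, coordinate by coordinate: replacing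
   the n noise variables of a block by symmetrized ones, one at a time, changes the mean
   of a C^2 test function h by O(|h''| M / n), because the odd part of the density has
   zero mean and second moment at most M.  For a symmetrized sum the bound on the n-fold
   convolution gives P(|mean| > t) = O(tau / t); so a block exceeds t in absolute value
   with probability O((tau + theta) / t), and by the Gaussian smoothing its two tails
   differ by O(M / (n theta^2)).  The median exceeds t only if more than m of the 2m+1
   independent blocks do, which makes its tails decay like t^{-4} and their difference
   like t^{-2}; integrating over t gives the second moment and the mean. *)
Require Import Defs.
From HB Require Import structures.
From mathcomp Require Import all_boot all_order all_algebra.
From mathcomp Require Import all_classical all_reals all_analysis.
From mathcomp Require Import measurable_realfun ring lra.
Import Order.TTheory GRing.Theory Num.Theory.
Import numFieldNormedType.Exports.
Set Implicit Arguments.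
Unset Strict Implicit.
Unset Printing Implicit Defensive.
Local Open Scope classical_set_scope.
Local Open Scope ring_scope.

(** * Euclidean geometry and clipping *)

(** The noise itself may have no mean: for [beta = 1] the even part of its density can be of Cauchy
    type, and only the odd part is assumed to have moments. Hence laws are compared with their
    symmetrizations through bounded test functions only, and moments appear after the median has
    been taken. The tail of a block is used in the weakest form valid for all [beta >= 1], of order
    [1 / t]; the median with [m >= 3] raises it to the fourth power, whatever [beta] is. The
    resulting estimator has two moments but no exponential one, while a dependence on [delta]
    through a logarithm asks for exponentials. Clipping supplies them, at the price of an extra bias
    that is of second order as long as the true gradient stays below half the level. This last
    condition is known only inside the ball, so the exponential carries the indicator that the
    potential has stayed small so far. No conditional expectation is formed: all random inputs are
    indexed, each iteration consumes a predetermined set of indices, and conditioning on the past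
    becomes Tonelli for two disjoint sets of indices. *)

Section euclidean.
Context (R : realType) (d : nat).
Implicit Types (u v w : 'rV[R]_d).

Lemma dotvC u v : dotv u v = dotv v u.
Proof. by apply: eq_bigr => j _; rewrite mulrC. Qed.

Lemma dotvDl u v w : dotv (u + v) w = dotv u w + dotv v w.
Proof. by rewrite /dotv -big_split; apply: eq_bigr => j _; rewrite mxE mulrDl. Qed.

Lemma dotvZl (c : R) u v : dotv (c *: u) v = c * dotv u v.
Proof. by rewrite /dotv mulr_sumr; apply: eq_bigr => j _; rewrite mxE mulrA. Qed.

Lemma dotvNl u v : dotv (- u) v = - dotv u v.
Proof. by rewrite -scaleN1r dotvZl mulN1r. Qed.

Lemma dotvBl u v w : dotv (u - v) w = dotv u w - dotv v w.
Proof. by rewrite dotvDl dotvNl. Qed.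

Lemma dotvDr u v w : dotv u (v + w) = dotv u v + dotv u w.
Proof. by rewrite dotvC dotvDl !(dotvC u). Qed.

Lemma dotvZr (c : R) u v : dotv u (c *: v) = c * dotv u v.
Proof. by rewrite dotvC dotvZl dotvC. Qed.

Lemma dotvNr u v : dotv u (- v) = - dotv u v.
Proof. by rewrite dotvC dotvNl dotvC. Qed.

Definition dotvE := (dotvDl, dotvDr, dotvNl, dotvNr, dotvZl, dotvZr).

Lemma dotvv_ge0 u : 0 <= dotv u u.
Proof. by apply: sumr_ge0 => j _; rewrite -expr2 sqr_ge0. Qed.

Lemma dotvv_eq0 u : dotv u u = 0 -> u = 0.
Proof.
move=> u0; apply/rowP => j; rewrite mxE; apply/eqP; rewrite -sqrf_eq0 expr2.
have := u0 => /eqP; rewrite psumr_eq0; last by move=> i _; rewrite -expr2 sqr_ge0.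
by move=> /allP/(_ j); rewrite mem_index_enum => /(_ isT).
Qed.

Lemma enorm_ge0 u : 0 <= enorm u. Proof. exact: sqrtr_ge0. Qed.

Lemma sqr_enorm u : enorm u ^+ 2 = dotv u u.
Proof. by rewrite sqr_sqrtr// dotvv_ge0. Qed.

Lemma enorm0 : enorm (0 : 'rV[R]_d) = 0.
Proof. by rewrite /enorm -(scale0r 0) dotvZl mul0r sqrtr0. Qed.

Lemma enorm_eq0 u : enorm u = 0 -> u = 0.
Proof. by move=> u0; apply: dotvv_eq0; rewrite -sqr_enorm u0 expr0n. Qed.

Lemma enorm_gt0 u : u != 0 -> 0 < enorm u.
Proof.
move=> u0; rewrite lt_neqAle enorm_ge0 andbT eq_sym.
by apply: contra u0 => /eqP/enorm_eq0 ->.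
Qed.

Lemma enormZ (c : R) u : enorm (c *: u) = `|c| * enorm u.
Proof.
by rewrite /enorm dotvZl dotvZr mulrA -expr2 sqrtrM ?sqr_ge0// sqrtr_sqr.
Qed.

Lemma enormN u : enorm (- u) = enorm u.
Proof. by rewrite -scaleN1r enormZ normrN1 mul1r. Qed.

Lemma dotv_le u v : dotv u v <= enorm u * enorm v.
Proof.
have [->|u0] := eqVneq u 0.
  by rewrite enorm0 mul0r -(scale0r 0) dotvZl mul0r.
have [->|v0] := eqVneq v 0.
  by rewrite enorm0 mulr0 -(scale0r 0) dotvZr mul0r.
have Nu := enorm_gt0 u0; have Nv := enorm_gt0 v0.
have := dotvv_ge0 (enorm v *: u - enorm u *: v).
rewrite !dotvE (dotvC v u) -!sqr_enorm.
set a := enorm u in Nu *; set b := enorm v in Nv *; move=> h.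
have h2 : 0 <= (2 * a * b) * (a * b - dotv u v) by apply: le_trans h _; nra.
by rewrite -subr_ge0 -(pmulr_rge0 _ (_ : 0 < 2 * a * b))// !mulr_gt0.
Qed.

Lemma normr_dotv_le u v : `|dotv u v| <= enorm u * enorm v.
Proof. by rewrite ler_norml dotv_le andbT lerNl -dotvNl -(enormN u) dotv_le. Qed.

Lemma enormD u v : enorm (u + v) <= enorm u + enorm v.
Proof.
rewrite -(@ler_pXn2r _ 2%N)// ?nnegrE ?addr_ge0 ?enorm_ge0//.
rewrite sqr_enorm !dotvE (dotvC v u) sqrrD !sqr_enorm.
have := dotv_le u v; lra.
Qed.

Lemma enorm_conv (p q r : R) u v : 0 <= p -> 0 <= q ->
  enorm u <= r -> enorm v <= r -> enorm (p *: u + q *: v) <= (p + q) * r.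
Proof.
move=> p0 q0 ur vr; apply: le_trans (enormD _ _) _.
by rewrite !enormZ !ger0_norm// mulrDl lerD// ler_wpM2l.
Qed.

Lemma enorm_sqrt_sum u : enorm u = Num.sqrt (\sum_(j < d) u 0 j ^+ 2).
Proof. by congr Num.sqrt; apply: eq_bigr => j _; rewrite expr2. Qed.

End euclidean.

Section clipping.
Context (R : realType) (d : nat).
Implicit Types (g G : 'rV[R]_d) (lam : R).

Lemma clip_small g lam : enorm g <= lam -> clip g lam = g.
Proof.
rewrite /clip; case: eqVneq => [->//|/enorm_gt0 g0 glam].
by rewrite min_l ?scale1r// ler_pdivlMr// mul1r.
Qed.

Lemma clip_large g lam : 0 < lam -> lam < enorm g ->
  clip g lam = (lam / enorm g) *: g.
Proof.
move=> lam0 glam; rewrite /clip; case: eqVneq glam => [->|g0].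
  by rewrite enorm0 => /lt_le_trans/(_ (ltW lam0)); rewrite ltxx.
by move=> glam; rewrite min_r// ler_pdivrMr ?enorm_gt0// mul1r ltW.
Qed.

Lemma enorm_clip g lam : 0 < lam -> enorm (clip g lam) <= lam.
Proof.
move=> lam0; have [/[dup] h /clip_small ->//|h] := leP (enorm g) lam.
have g0 : 0 < enorm g by apply: lt_trans h.
rewrite clip_large// enormZ ger0_norm; last by rewrite divr_ge0 ?(ltW g0) ?ltW.
by rewrite divfK// gt_eqF.
Qed.

(** When clipping acts, it shortens [g] by [|g| - lam], which is at most [|g - G| - lam / 2] because
    [|G| <= lam / 2]. In particular [|g - G| >= lam / 2], so a further factor [2 / lam * |g - G|] is
    at least 1. *)
Lemma clip_bias g G lam : 0 < lam -> enorm G <= lam / 2 ->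
  enorm (clip g lam - g) <= enorm (g - G) /\
  enorm (clip g lam - g) <= 2 / lam * enorm (g - G) ^+ 2.
Proof.
move=> lam0 Glam.
have [/clip_small ->|h] := leP (enorm g) lam.
  by rewrite subrr enorm0 enorm_ge0 mulr_ge0 ?divr_ge0 ?sqr_ge0 ?ltW.
have g0 : 0 < enorm g by apply: lt_trans h.
have -> : enorm (clip g lam - g) = enorm g - lam.
  rewrite clip_large// -[X in _ - X]scale1r -scalerBl enormZ ler0_norm.
    by rewrite mulrC opprB mulrBr mulr1 mulrCA divff ?mulr1// gt_eqF.
  by rewrite subr_le0 ler_pdivrMr// mul1r ltW.
have gG : enorm g <= enorm (g - G) + enorm G by rewrite -{1}(subrK G g) enormD.
have N0 := enorm_ge0 (g - G).
split; first lra.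
apply: (@le_trans _ _ (enorm (g - G))); first lra.
rewrite expr2 mulrA ler_peMl// mulrAC ler_pdivlMr//; lra.
Qed.

End clipping.

(** Squaring and inverting [exp(- x / 2) >= 1 - x / 2] leaves a polynomial inequality, whose margin
    after clearing the denominator is [x^2 (1 - x) (5/4 - x / 2)]. *)
Lemma expR_le_quad (R : realType) (x : R) : x <= 1 -> expR x <= 1 + x + 2 * x ^+ 2.
Proof.
move=> x1; have h : 0 < 1 - x / 2 by lra.
have e : expR x = (expR (- (x / 2)) ^+ 2)^-1.
  by rewrite expr2 -expRD -opprD -splitr expRN invrK.
rewrite e; apply: (@le_trans _ _ ((1 - x / 2) ^+ 2)^-1).
  rewrite lef_pV2 ?posrE ?exprn_gt0 ?expR_gt0// ler_pXn2r ?nnegrE ?expR_ge0 ?(ltW h)//.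
  exact: expR_ge1Dx.
rewrite -div1r ler_pdivrMr ?exprn_gt0//.
have h2 : 0 <= x ^+ 2 * ((1 - x) * (5 / 4 - x / 2)).
  by rewrite mulr_ge0 ?sqr_ge0// mulr_ge0//; lra.
rewrite -subr_ge0; apply: le_trans h2 _; rewrite le_eqVlt; apply/orP; left.
by apply/eqP; field.
Qed.

(** * The potential inequality for one iteration *)

Section one_step.
Context (R : realType) (d : nat).
Implicit Types (x y z g G xs : 'rV[R]_d).

(** Convexity at [x] towards [y] and [xs], weighted by [Ak] and [al], leaves only [al <G, xs - z>],
    since [x] averages [y] and [z]; expanding [|z' - xs|^2] cancels it up to the error [g - G]. The
    condition on [a L al^2] makes the smoothness term at [y'] at most [al^2 |g|^2 / a], which
    [a >= 4] absorbs. *)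
Lemma sstm_potential_step (f : 'rV[R]_d -> R) (Ak al a L : R) xs x y z g G :
    let A' := Ak + al in
    let z' := z - al *: g in
    let y' := A'^-1 *: (Ak *: y + al *: z') in
    x = A'^-1 *: (Ak *: y + al *: z) ->
    0 <= Ak -> 0 < al -> 0 < L -> 4 <= a -> a * L * al ^+ 2 <= A' ->
    f x + dotv G (y - x) <= f y -> f x + dotv G (xs - x) <= f xs ->
    f y' <= f x + dotv G (y' - x) + L * enorm (y' - x) ^+ 2 ->
  2^-1 * enorm (z' - xs) ^+ 2 + A' * (f y' - f xs) <=
  2^-1 * enorm (z - xs) ^+ 2 + Ak * (f y - f xs)
  - al * dotv (g - G) (z - xs) + al ^+ 2 * enorm (g - G) ^+ 2.
Proof.
move=> A' z' y' xE Ak0 al0 L0 a4 aL fy fxs fy'.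
have A'0 : 0 < A' by rewrite /A' ltr_wpDl.
have y'x : y' - x = - (A'^-1 * al ^+ 2) *: g.
  rewrite xE /y' /z' scalerBr addrA scalerBr addrAC subrr add0r.
  by rewrite scaleNr !scalerA expr2 mulrA.
have e1 : Ak * dotv G (y - x) + al * dotv G (xs - x) = al * dotv G (xs - z).
  rewrite -!dotvZr -dotvDr; congr dotv.
  have -> : Ak *: (y - x) + al *: (xs - x) = Ak *: y + al *: xs - A' *: x.
    by rewrite /A' !scalerBr scalerDl opprD addrACA.
  rewrite xE scalerA divff ?gt_eqF// scale1r opprD addrACA subrr add0r.
  by rewrite scalerBr.
have nz : enorm (z' - xs) ^+ 2 =
    enorm (z - xs) ^+ 2 - 2 * al * dotv g (z - xs) + al ^+ 2 * enorm g ^+ 2.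
  rewrite (_ : z' - xs = (z - xs) - al *: g); last by rewrite /z' addrAC.
  move: (z - xs) => v; rewrite !sqr_enorm !dotvE (dotvC v g); ring.
have smooth : A' * (f y' - f x) <= - al ^+ 2 * dotv G g
    + a^-1 * al ^+ 2 * enorm g ^+ 2.
  have : A' * (f y' - f x) <= A' * (dotv G (y' - x) + L * enorm (y' - x) ^+ 2).
    by rewrite ler_wpM2l ?(ltW A'0)//; lra.
  move=> /le_trans; apply.
  rewrite y'x dotvZr enormZ normrN exprMn real_normK ?num_real//.
  set N := enorm g ^+ 2; have N0 : 0 <= N by exact: sqr_ge0.
  rewrite mulrDr; apply: lerD.
    by rewrite mulrA mulrN mulrA divff ?gt_eqF// mul1r.
  have -> : A' * (L * ((A'^-1 * al ^+ 2) ^+ 2 * N)) =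
     (L * al ^+ 2 / A') * al ^+ 2 * N by field; rewrite gt_eqF.
  rewrite ler_wpM2r// ler_wpM2r ?sqr_ge0//.
  rewrite ler_pdivrMr// ler_pdivlMl; last lra.
  by rewrite mulrA.
have gE : g = G + (g - G) by rewrite addrC subrK.
set th := g - G in gE *; clearbody th.
have ia : 0 < a^-1 <= 4^-1.
  by rewrite invr_gt0 lef_pV2 ?posrE ?a4 ?andbT; lra.
(* For [a = 4] the two sides differ by exactly [|G - th|^2 / 4]. *)
have quad : (2^-1 + a^-1) * enorm g ^+ 2 - dotv G g <= enorm th ^+ 2.
  have := dotvv_ge0 (G - th).
  have := dotvv_ge0 G; have := dotvv_ge0 th.
  rewrite gE !sqr_enorm !dotvE (dotvC th G).
  move: (dotv G G) (dotv th th) (dotv G th) (a^-1) ia => p q r t ia.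
  nra.
have gxs : dotv g (z - xs) = dotv G (z - xs) + dotv th (z - xs).
  by rewrite {1}gE dotvDl.
have GzE : dotv G (xs - z) = - dotv G (z - xs) by rewrite -dotvNr opprB.
rewrite nz gxs.
rewrite GzE in e1.
have al2 : 0 < al ^+ 2 by rewrite exprn_gt0.
have quad2 := ler_wpM2l (ltW al2) quad.
have h1 := ler_wpM2l Ak0 fy.
have h2 := ler_wpM2l (ltW al0) fxs.
rewrite /A' in smooth *.
set F := f y' in smooth *.
set Gy := dotv G (y - x) in e1 h1 *; set Gxs := dotv G (xs - x) in e1 h2 *.
lra.
Qed.

(* Clipping moves [g] by at most [2 |g - G|^2 / lam], which is of second order;
   so the exponential moment of a clipped step only involves the mean and the
   variance of [g - G], although [g - G] itself has no exponential moment. *)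
Lemma clipped_exp_le (r A al lam : R) (v g G : 'rV[R]_d) :
    0 < r -> 1 <= A -> 0 < al -> lam = 16^-1 * (r / (al * A)) ->
    enorm v <= 2 * r -> enorm G <= lam / 2 ->
    expR (2 * A / r ^+ 2 * (- al * dotv (clip g lam - G) v
                          + al ^+ 2 * enorm (clip g lam - G) ^+ 2)) <=
  1 - 2 * A / r ^+ 2 * al * dotv (g - G) v
    + 424 * (al * A / r) ^+ 2 * enorm (g - G) ^+ 2.
Proof.
move=> r0 A1 al0 lamE vr Glam; set th := clip g lam - G.
have A0 : 0 < A by lra.
have lam0 : 0 < lam by rewrite lamE mulr_gt0 ?divr_gt0 ?mulr_gt0 ?invr_gt0.
have [cN1 cN2] := clip_bias g lam0 Glam.
have thE : th = (g - G) + (clip g lam - g) by rewrite /th [RHS]addrC addrA subrK.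
set N := g - G in cN1 cN2 thE *; set c := clip g lam - g in cN1 cN2 thE *.
have N0 := enorm_ge0 N; have c0 := enorm_ge0 c; have th0 := enorm_ge0 th.
have v0 := enorm_ge0 v.
have thN : enorm th <= 2 * enorm N.
  by rewrite thE; apply: le_trans (enormD _ _) _; lra.
have thlam : enorm th <= 3 / 2 * lam.
  apply: le_trans (enormD _ _) _; rewrite enormN.
  by have := enorm_clip g lam0; lra.
clearbody N c th.
set u := al * enorm th.
have u0 : 0 <= u by rewrite mulr_ge0// ltW.
have allam : al * lam = r / (16 * A) by rewrite lamE; field; rewrite !gt_eqF.
(* Here [al * lam = r / (16 A)] and the clipped error is at most [3 lam / 2]. The level is tuned so
   that [s * |X|] stays below [9 / 16]. *)
have uA : u * A <= 3 / 32 * r.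
  have : u <= al * (3 / 2 * lam) by rewrite ler_pM2l.
  rewrite mulrCA allam => /(ler_wpM2r (ltW A0)) /le_trans; apply.
  by rewrite le_eqVlt; apply/orP; left; apply/eqP; field; rewrite gt_eqF.
have ur : u <= 3 / 32 * r by apply: le_trans uA; rewrite ler_peMr.
set X := - al * dotv th v + al ^+ 2 * enorm th ^+ 2.
have ip : `|al * dotv th v| <= 2 * r * u.
  rewrite normrM gtr0_norm// mulrCA ler_pM2l//.
  apply: le_trans (normr_dotv_le _ _) _.
  by rewrite mulrC ler_wpM2r.
have Xabs : `|X| <= 3 * r * u.
  rewrite /X mulNr; apply: le_trans (ler_normD _ _) _; rewrite normrN.
  rewrite -exprMn -/u (ger0_norm (sqr_ge0 u)).
  have : u ^+ 2 <= r * u by rewrite expr2 ler_wpM2r//; lra.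
  lra.
set s := 2 * A / r ^+ 2.
have s0 : 0 < s by rewrite divr_gt0 ?exprn_gt0 ?mulr_gt0.
have sX1 : s * X <= 1.
  apply: le_trans (ler_norm _) _; rewrite normrM gtr0_norm//.
  apply: (@le_trans _ _ (s * (3 * r * u))); first by rewrite ler_pM2l.
  rewrite /s mulrAC ler_pdivrMr ?exprn_gt0// mul1r.
  have := ler_wpM2l (ltW r0) uA; nra.
apply: le_trans (expR_le_quad sX1) _.
set B := (al * A / r) ^+ 2 * enorm N ^+ 2.
have B0 : 0 <= B by rewrite mulr_ge0 ?sqr_ge0.
(* [s * 3 r * 2 al |N| = 12 al A |N| / r], whence [144]. *)
have sX2 : (s * X) ^+ 2 <= 144 * B.
  rewrite -(real_normK (num_real (s * X))) normrM gtr0_norm//.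
  apply: (@le_trans _ _ ((s * (3 * r * (2 * (al * enorm N)))) ^+ 2)).
    have aN : 0 <= 3 * r * (2 * (al * enorm N)).
      by rewrite !mulr_ge0 ?(ltW r0) ?(ltW al0).
    rewrite ler_pXn2r ?nnegrE ?(mulr_ge0 (ltW s0) aN)//; last first.
      exact: mulr_ge0 (ltW s0) (normr_ge0 _).
    rewrite ler_pM2l//; apply: le_trans Xabs _; rewrite ler_pM2l ?mulr_gt0//.
    by rewrite mulrCA ler_pM2l.
  by rewrite le_eqVlt; apply/orP; left; apply/eqP; rewrite /B /s; field; rewrite gt_eqF.
(* [128] is the clipping bias against [|v| <= 2 r], and [8] the squared error with [A <= A^2].
   Together with the quadratic term of the exponential, [136 + 2 * 144 = 424]. *)
have sX3 : s * X <= - s * al * dotv N v + 136 * B.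
  have e1 : - dotv c v <= 2 / lam * enorm N ^+ 2 * (2 * r).
    rewrite -dotvNl; apply: le_trans (dotv_le _ _) _; rewrite enormN.
    by apply: ler_pM.
  have e2 : enorm th ^+ 2 <= 4 * enorm N ^+ 2.
    rewrite (_ : 4 * _ = (2 * enorm N) ^+ 2); last by ring.
    by rewrite ler_pXn2r ?nnegrE ?mulr_ge0.
  have e3 : s * (al * (2 / lam * enorm N ^+ 2 * (2 * r))) = 128 * B.
    by rewrite lamE /s /B; field; rewrite !gt_eqF.
  have e4 : s * (al ^+ 2 * (4 * enorm N ^+ 2)) <= 8 * B.
    have -> : s * (al ^+ 2 * (4 * enorm N ^+ 2)) =
       8 * (al / r) ^+ 2 * enorm N ^+ 2 * A by rewrite /s; field; rewrite gt_eqF.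
    have -> : 8 * B = 8 * (al / r) ^+ 2 * enorm N ^+ 2 * (A * A).
      by rewrite /B; field; rewrite gt_eqF.
    apply: ler_wpM2l; last by rewrite ler_peMr// ltW.
    by apply: mulr_ge0 (sqr_ge0 _); apply: mulr_ge0 (sqr_ge0 _).
  have e1' := ler_wpM2l (ltW (mulr_gt0 s0 al0)) e1.
  have e2' := ler_wpM2l (ltW (mulr_gt0 s0 (exprn_gt0 2 al0))) e2.
  rewrite -!(mulrA s) in e1' e2'; rewrite e3 in e1'.
  rewrite /X {1}thE dotvDl; lra.
rewrite -[X in _ <= _ + X]mulrA -/B; lra.
Qed.

End one_step.

(** * The deterministic trajectory *)

Section step_sizes.
Context (R : realType).
Variables (a L : R).
Hypotheses (a0 : 0 < a) (L0 : 0 < L).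

Lemma alphaE k : alpha a L k.+1 = k.+2%:R / (2 * a * L).
Proof. by []. Qed.

Lemma alpha_gt0 k : 0 < alpha a L k.+1.
Proof. by rewrite alphaE divr_gt0 ?mulr_gt0. Qed.

Lemma AsumE k : Asum a L k = k%:R * (k%:R + 3) / (4 * a * L).
Proof.
elim: k => [|k IH]; first by rewrite /= !mul0r.
rewrite /= IH -[k.+2%:R]natr1 -(natr1 k).
by field; rewrite !gt_eqF.
Qed.

Lemma Asum_ge0 k : 0 <= Asum a L k.
Proof. by rewrite AsumE divr_ge0 ?mulr_ge0 ?addr_ge0// ltW. Qed.

Lemma AsumS k : Asum a L k.+1 = Asum a L k + alpha a L k.+1.
Proof. by []. Qed.

Lemma Asum_gt0 k : 0 < Asum a L k.+1.
Proof. by rewrite AsumS ltr_wpDl ?Asum_ge0// alpha_gt0. Qed.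

Lemma alpha_sqr_le k : a * L * alpha a L k.+1 ^+ 2 <= Asum a L k.+1.
Proof.
rewrite AsumE alphaE -[k.+2%:R]natr1 -(natr1 k) -subr_ge0; set n := k%:R : R.
have n0 : 0 <= n by rewrite ler0n.
have -> : (n + 1) * (n + 1 + 3) / (4 * a * L) - a * L * ((n + 1 + 1) / (2 * a * L)) ^+ 2
  = n / (4 * a * L) by field; rewrite !gt_eqF.
by rewrite divr_ge0 ?mulr_ge0// ltW.
Qed.

Lemma sum_alpha_le K : \sum_(k < K) alpha a L k.+1 <= K.+2%:R ^+ 2 / (4 * a * L).
Proof.
have -> : \sum_(k < K) alpha a L k.+1 = Asum a L K.
  elim: K => [|K IH]; first by rewrite big_ord0.
  by rewrite big_ord_recr IH.
rewrite AsumE ler_pM2r ?invr_gt0 ?mulr_gt0// -[K.+2%:R]natr1 -(natr1 K).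
have n0 : 0 <= K%:R :> R by rewrite ler0n.
nra.
Qed.

Lemma sum_alpha_sqr_le K :
  \sum_(k < K) alpha a L k.+1 ^+ 2 <= K.+1%:R ^+ 3 / (4 * (a * L) ^+ 2).
Proof.
apply: (@le_trans _ _ (\sum_(k < K) (K.+1%:R ^+ 2 / (4 * (a * L) ^+ 2)))).
  apply: ler_sum => k _; rewrite alphaE.
  have -> : (k.+2%:R / (2 * a * L)) ^+ 2 = k.+2%:R ^+ 2 / (4 * (a * L) ^+ 2) :> R.
    by field; rewrite !gt_eqF.
  rewrite ler_pM2r ?invr_gt0 ?mulr_gt0 ?exprn_gt0 ?mulr_gt0//.
  by rewrite ler_pXn2r ?nnegrE ?ler0n// ler_nat ltnS.
rewrite sumr_const card_ord -[leLHS]mulr_natl [in leRHS]exprS -[leRHS]mulrA.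
apply: ler_wpM2r; last by rewrite ler_nat.
by apply: divr_ge0 (sqr_ge0 _) _; apply: mulr_ge0 (sqr_ge0 _).
Qed.

End step_sizes.

Section trajectory.
Context (R : realType) (d : nat).
Variables (f : 'rV[R]_d -> R) (G : 'rV[R]_d -> 'rV[R]_d) (xs : 'rV[R]_d).
Variables (r L a A : R).
Hypotheses (r0 : 0 < r) (L0 : 0 < L) (A1 : 1 <= A) (aA : (168 * A) ^+ 2 <= a).
Hypothesis fmin : forall x, f xs <= f x.
Hypothesis Gxs : G xs = 0.
Hypothesis Glip : forall x y, eball xs (3 * r) x -> eball xs (3 * r) y ->
  enorm (G x - G y) <= L * enorm (x - y).
Hypothesis Gsqr : forall x, eball xs (3 * r) x ->
  enorm (G x) ^+ 2 <= 2 * L * (f x - f xs).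
Hypothesis fconv : forall x y, eball xs (3 * r) x -> eball xs (3 * r) y ->
  f x + dotv (G x) (y - x) <= f y.

Let A0 : 0 < A. Proof. exact: lt_le_trans ltr01 A1. Qed.

Let a0 : 0 < a.
Proof. by apply: lt_le_trans aA; rewrite exprn_gt0// mulr_gt0. Qed.

Let lam k := 16^-1 * (r / (alpha a L k.+1 * A)).

Definition sstm_point (k : nat) (y z : 'rV[R]_d) : 'rV[R]_d :=
  (Asum a L k.+1)^-1 *: (Asum a L k *: y + alpha a L k.+1 *: z).

Definition potential (k : nat) (y z : 'rV[R]_d) : R :=
  2^-1 * enorm (z - xs) ^+ 2 + Asum a L k * (f y - f xs).

(** The potential controls the distance of [z] to [xs] but not that of [y], as [f] need not grow
    away from [xs]. The bound on [y] is therefore carried along; it persists because the next [y]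
    averages [y] and the next [z]. *)
Definition confined (k : nat) (y z : 'rV[R]_d) : Prop :=
  potential k y z <= 3 / 2 * r ^+ 2 /\ enorm (y - xs) <= 2 * r.

Lemma confined_z k y z : potential k y z <= 3 / 2 * r ^+ 2 ->
  enorm (z - xs) <= 2 * r.
Proof.
move=> h; rewrite -(@ler_pXn2r _ 2%N)// ?nnegrE ?enorm_ge0 ?mulr_ge0 ?(ltW r0)//.
have : 0 <= Asum a L k * (f y - f xs).
  by rewrite mulr_ge0 ?(Asum_ge0 a0 L0)// subr_ge0.
have := sqr_ge0 r.
by move: h; rewrite /potential; nra.
Qed.

Lemma sstm_point_dist k y z (s : R) : enorm (y - xs) <= s -> enorm (z - xs) <= s ->
  enorm (sstm_point k y z - xs) <= s.
Proof.
move=> ys zs; have Ak0 := Asum_gt0 a0 L0 k.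
have -> : sstm_point k y z - xs = (Asum a L k / Asum a L k.+1) *: (y - xs)
    + (alpha a L k.+1 / Asum a L k.+1) *: (z - xs).
  have e : xs = (Asum a L k / Asum a L k.+1) *: xs
      + (alpha a L k.+1 / Asum a L k.+1) *: xs.
    by rewrite -scalerDl -mulrDl -AsumS divff ?scale1r// gt_eqF.
  rewrite {1}e /sstm_point scalerDr !scalerA !(mulrC _^-1) opprD addrACA.
  by rewrite !scalerBr.
apply: le_trans (@enorm_conv _ _ _ _ s _ _ _ _ ys zs) _.
- by rewrite divr_ge0 ?(Asum_ge0 a0 L0)// ltW.
- by rewrite divr_ge0 ?(ltW Ak0)// ltW// alpha_gt0.
- by rewrite -mulrDl -AsumS divff ?mul1r// gt_eqF.
Qed.

(** The gap [f y - f xs] is at most the potential divided by [A_k], which bounds [G y]; and [x - y]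
    is [alpha / A_k.+1] times [z - y], so the gradient changes little from [y] to [x]. Each
    contribution is at most a quarter of the level. *)
Lemma confined_grad k y z : confined k y z ->
  enorm (G (sstm_point k y z)) <= lam k / 2.
Proof.
have r0' := r0; have A1' := A1; have aA0 := aA; have L0' := L0; have A0' := A0.
move=> [Pk yk]; have zk := confined_z Pk.
set x := sstm_point k y z.
have xk : enorm (x - xs) <= 2 * r by exact: sstm_point_dist.
have Qx : eball xs (3 * r) x by rewrite /eball/=; lra.
have Qy : eball xs (3 * r) y by rewrite /eball/=; lra.
have Qxs : eball xs (3 * r) xs by rewrite /eball/= subrr enorm0; lra.
have lamE : lam k / 2 = a * L * r / (16 * A * k.+2%:R).
  by rewrite /lam alphaE; field; rewrite !gt_eqF.
have aA' : 168 * 168 * (A * A) <= a by apply: le_trans aA; rewrite exprMn !expr2; lra.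
have AA : A <= A * A by rewrite ler_peMl// ltW.
(* As [A_0 = 0], the initial potential says nothing about [f y]; there the Lipschitz bound from
   [xs], where [G] vanishes, is used instead. *)
case: k => [|k] in Pk x xk Qx lamE *.
  apply: (@le_trans _ _ (2 * (L * r))).
    rewrite -(subr0 (G x)) -Gxs; apply: le_trans (Glip Qx Qxs) _.
    by rewrite mulrCA ler_pM2l.
  rewrite lamE ler_pdivlMr ?mulr_gt0//.
  have Aa : 64 * A <= a by nra.
  have := ler_wpM2r (ltW (mulr_gt0 L0 r0)) Aa; lra.
set n := k.+1 in Pk x xk Qx lamE *.
have nE : n.+2%:R = n%:R + 2 :> R by rewrite -addn2 natrD.
have n1 : 1 <= n%:R :> R by rewrite ler1n.
rewrite nE in lamE; set N := n%:R in nE n1 lamE.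
have N0 : 0 < N by lra.
have T0 : 0 <= lam n / 4.
  by rewrite divr_ge0// mulr_ge0 ?invr_ge0// divr_ge0 ?(ltW r0)// mulr_ge0 ?(ltW A0)// ltW// alpha_gt0.
have TE : lam n / 4 = a * L * r / (32 * A * (N + 2)).
  have -> : lam n / 4 = lam n / 2 / 2 by field.
  by rewrite lamE; field; rewrite !gt_eqF//; lra.
have Gy : enorm (G y) <= lam n / 4.
  rewrite -(@ler_pXn2r _ 2%N)// ?nnegrE ?enorm_ge0//.
  apply: le_trans (Gsqr Qy) _.
  have fy : (f y - f xs) <= 6 * (a * L * r ^+ 2) / (N * (N + 3)).
    have e0 : 0 <= 2^-1 * enorm (z - xs) ^+ 2 by rewrite mulr_ge0 ?sqr_ge0// invr_ge0.
    have : Asum a L n * (f y - f xs) <= 3 / 2 * r ^+ 2.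
      by apply: le_trans Pk; rewrite /potential lerDr.
    rewrite AsumE// -/N mulrAC ler_pdivrMr ?mulr_gt0// => h.
    rewrite ler_pdivlMr ?mulr_gt0//; lra.
  apply: (@le_trans _ _ (2 * L * (6 * (a * L * r ^+ 2) / (N * (N + 3))))).
    by rewrite ler_wpM2l// mulr_ge0// ltW.
  set W := 32 * A * (N + 2) in TE.
  have W0 : 0 < W by rewrite mulr_gt0 ?mulr_gt0//; lra.
  have -> : (lam n / 4) ^+ 2 = 2 * L * (a * L * r ^+ 2 / 2 * (a / W ^+ 2)).
    by rewrite TE; field; rewrite gt_eqF.
  apply: ler_wpM2l; first by rewrite mulr_ge0// ltW.
  have -> : 6 * (a * L * r ^+ 2) / (N * (N + 3)) = a * L * r ^+ 2 / 2 * (12 / (N * (N + 3))).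
    by field; rewrite !gt_eqF//; lra.
  apply: ler_wpM2l.
    by rewrite divr_ge0// mulr_ge0 ?sqr_ge0// mulr_ge0 ?(ltW a0) ?(ltW L0).
  have N3 : 0 < N * (N + 3) by rewrite mulr_gt0//; lra.
  rewrite ler_pdivrMr// mulrAC ler_pdivlMr ?exprn_gt0//.
  (* The origin of [168]: the product [12 * 32^2 * 9 / 4 = 27648] has to fit below [168^2]. *)
  have NN : (N + 2) ^+ 2 <= 9 / 4 * (N * (N + 3)) by nra.
  have AA0 : 0 <= A * A by rewrite mulr_ge0 ?(ltW A0).
  have h1 := ler_wpM2l AA0 NN.
  apply: (@le_trans _ _ (168 * 168 * (A * A) * (N * (N + 3)))).
    have -> : W ^+ 2 = 32 * 32 * (A * A * (N + 2) ^+ 2) by rewrite /W; ring.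
    have := mulr_ge0 AA0 (ltW N3); lra.
  by apply: ler_wpM2r => //; exact: ltW.
have GG : enorm (G x - G y) <= lam n / 4.
  apply: le_trans (Glip Qx Qy) _.
  have An0 := Asum_gt0 a0 L0 n; have an0 := alpha_gt0 a0 L0 n.
  have -> : x - y = (alpha a L n.+1 / Asum a L n.+1) *: (z - y).
    have e : y = (Asum a L n / Asum a L n.+1) *: y
      + (alpha a L n.+1 / Asum a L n.+1) *: y.
      by rewrite -scalerDl -mulrDl -AsumS divff ?scale1r// gt_eqF.
    rewrite {1}e /x /sstm_point scalerDr !scalerA !(mulrC _^-1) opprD addrACA.
    by rewrite subrr add0r scalerBr.
  have zy : enorm (z - y) <= 4 * r.
    rewrite (_ : z - y = (z - xs) - (y - xs)); last by rewrite opprB addrA subrK.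
    by apply: le_trans (enormD _ _) _; rewrite enormN; lra.
  have aA1 : alpha a L n.+1 / Asum a L n.+1 <= 2 / (N + 2).
    rewrite ler_pdivrMr// AsumE// alphaE -[n.+1%:R]natr1 nE -/N.
    rewrite -subr_ge0.
    have -> : 2 / (N + 2) * ((N + 1) * (N + 1 + 3) / (4 * a * L)) - (N + 2) / (2 * a * L)
       = N / ((N + 2) * (2 * a * L)) by field; rewrite !gt_eqF//; lra.
    by rewrite divr_ge0 ?mulr_ge0 ?(ltW a0) ?(ltW L0)//; lra.
  rewrite enormZ gtr0_norm; last by rewrite divr_gt0.
  apply: (@le_trans _ _ (L * (2 / (N + 2) * (4 * r)))).
    rewrite ler_pM2l// ler_pM ?enorm_ge0//; by rewrite divr_ge0 ?ltW.
  rewrite TE.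
  have -> : L * (2 / (N + 2) * (4 * r)) = L * r * (256 * A) / (32 * A * (N + 2)).
    by field; rewrite !gt_eqF//; lra.
  rewrite ler_pM2r ?invr_gt0 ?mulr_gt0//; last lra.
  have Aa : 256 * A <= a by nra.
  have := ler_wpM2r (ltW (mulr_gt0 L0 r0)) Aa; lra.
apply: (le_trans (y := enorm (G x - G y) + enorm (G y))); last by lra.
by rewrite -{1}(subrK (G y) (G x)) enormD.
Qed.

Lemma confined_step k y z g : confined k y z ->
  let al := alpha a L k.+1 in
  let x := sstm_point k y z in
  let z' := z - al *: clip g (lam k) in
  let y' := sstm_point k y z' in
  potential k.+1 y' z' <= potential k y z
    + (- al * dotv (clip g (lam k) - G x) (z - xs)
       + al ^+ 2 * enorm (clip g (lam k) - G x) ^+ 2) /\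
  (potential k.+1 y' z' <= 3 / 2 * r ^+ 2 -> confined k.+1 y' z').
Proof.
have r0' := r0; have A1' := A1; have aA0 := aA; have L0' := L0; have A0' := A0.
move=> [Pk yk] al x z' y'.
have zk := confined_z Pk.
have xk : enorm (x - xs) <= 2 * r by exact: sstm_point_dist.
have lam0 : 0 < lam k.
  by rewrite mulr_gt0 ?invr_gt0// divr_gt0// mulr_gt0// alpha_gt0.
have al0 : 0 < al by exact: alpha_gt0.
(* One clipped step moves [z] by at most [r / (16 A)], so [z'] and [y'] lie in the ball of radius
   [3 r] before anything is known about the new potential, and the inequalities valid on that ball
   apply at [y']. *)
have z'k : enorm (z' - xs) <= 3 * r.
  rewrite /z' addrAC; apply: le_trans (enormD _ _) _; rewrite enormN enormZ gtr0_norm//.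
  have : al * enorm (clip g (lam k)) <= al * lam k.
    by rewrite ler_pM2l// enorm_clip.
  have -> : al * lam k = r / (16 * A).
    by rewrite /lam -/al; field; rewrite !gt_eqF.
  have : r / (16 * A) <= r.
    by rewrite ler_pdivrMr ?mulr_gt0// ler_peMr ?(ltW r0)//; lra.
  lra.
have y'k : enorm (y' - xs) <= 3 * r by apply: sstm_point_dist => //; lra.
split.
  have Qx : eball xs (3 * r) x by rewrite /eball/=; lra.
  have Qy : eball xs (3 * r) y by rewrite /eball/=; lra.
  have Qxs : eball xs (3 * r) xs by rewrite /eball/= subrr enorm0; lra.
  have Qy' : eball xs (3 * r) y' by [].
  rewrite addrA mulNr.
  have := @sstm_potential_step _ _ f (Asum a L k) al a L xs x y z (clip g (lam k)) (G x).
  rewrite /=; apply => //.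
  - exact: Asum_ge0.
  - by apply: le_trans aA; rewrite expr2; nra.
  - exact: alpha_sqr_le.
  - exact: fconv.
  - exact: fconv.
  (* The descent inequality comes from convexity at [y'] and the Lipschitz gradient, without
     integration along the segment; the price is [L] in place of [L / 2]. *)
  - have h1 := fconv Qy' Qx.
    have h2 : dotv (G y' - G x) (y' - x) <= L * enorm (y' - x) ^+ 2.
      apply: le_trans (dotv_le _ _) _.
      by rewrite expr2 mulrA ler_wpM2r ?enorm_ge0// Glip.
    move: h2; rewrite dotvBl -[X in _ -> _ <= _ + X + _]/(dotv (G x) (y' - x)).
    have -> : dotv (G y') (y' - x) = - dotv (G y') (x - y') by rewrite -dotvNr opprB.
    move: h1; rewrite -/y'; lra.
move=> Pk'; split => //.
by apply: sstm_point_dist => //; exact: confined_z Pk'.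
Qed.

Lemma confined_init x0 : enorm (x0 - xs) <= r -> confined 0 x0 x0 /\
  potential 0 x0 x0 <= r ^+ 2 / 2.
Proof.
have r0' := r0.
move=> h; have h2 : potential 0 x0 x0 <= r ^+ 2 / 2.
  rewrite /potential/= mul0r addr0 mulrC ler_pM2r ?invr_gt0//.
  by rewrite ler_pXn2r ?nnegrE ?enorm_ge0// ltW.
split => //; split; last by lra.
by have := sqr_ge0 r; lra.
Qed.

Lemma confined_gap k y z : (0 < k)%N -> potential k y z <= 3 / 2 * r ^+ 2 ->
  f y - f xs <= 6 * (a * L * r ^+ 2 / k%:R ^+ 2).
Proof.
move=> k0; rewrite /potential AsumE// => h.
have kr : 0 < k%:R :> R by rewrite ltr0n.
have e0 : 0 <= 2^-1 * enorm (z - xs) ^+ 2 by rewrite mulr_ge0 ?sqr_ge0// invr_ge0.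
have f0 : 0 <= f y - f xs by rewrite subr_ge0.
have h2 : k%:R ^+ 2 / (4 * a * L) * (f y - f xs) <= 3 / 2 * r ^+ 2.
  apply: le_trans h; rewrite ler_wpDl//.
  rewrite ler_wpM2r// ler_pM2r ?invr_gt0 ?mulr_gt0// expr2 ler_pM2l//; lra.
rewrite mulrA ler_pdivlMr ?exprn_gt0//.
move: h2; rewrite mulrAC ler_pdivrMr ?mulr_gt0//; lra.
Qed.

End trajectory.

(** * Independence and decoupling *)

Section independence.
Context (R : realType) (disp : measure_display) (T : measurableType disp)
  (P : probability T R) (I : eqType) (F : I -> set (set T)).
Hypothesis FT : forall i, F i setT.
Hypothesis FI : forall i, setI_closed (F i).
Hypothesis Fm : forall i, F i `<=` measurable.
Hypothesis indF : mutually_independent P F.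

(* A pi-system generating the sigma-algebra of the classes [F i], [i \in D]. *)
Definition finite_meets (D : set I) : set (set T) :=
  [set A | exists (s : seq I) (B : I -> set T),
    [/\ uniq s, forall i, i \in s -> D i, forall i, i \in s -> F i (B i) &
        A = \bigcap_(i in [set i | i \in s]) B i]].

Lemma finite_meets_setT D : finite_meets D setT.
Proof.
exists [::], (fun=> setT); split => //.
by apply/seteqP; split => // x _ i.
Qed.

Lemma finite_meets_gen (D : set I) i A : D i -> F i A -> finite_meets D A.
Proof.
move=> Di FA; exists [:: i], (fun=> A); split => //.
- by move=> j; rewrite inE => /eqP ->.
- by move=> j; rewrite inE => /eqP ->.
- apply/seteqP; split => [x Ax j //|x]; apply => /=; exact: mem_head.
Qed.

Lemma finite_meetsS (D D' : set I) : D `<=` D' -> finite_meets D `<=` finite_meets D'.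
Proof. by move=> DD' A [s [B [? sD ? ?]]]; exists s, B; split => // i /sD/DD'. Qed.

Lemma finite_meetsI D : setI_closed (finite_meets D).
Proof.
move=> _ _ [s1 [B1 [u1 D1 F1 ->]]] [s2 [B2 [u2 D2 F2 ->]]].
exists (undup (s1 ++ s2)), (fun i => (if i \in s1 then B1 i else setT) `&`
   (if i \in s2 then B2 i else setT)); split.
- exact: undup_uniq.
- by move=> i; rewrite mem_undup mem_cat => /orP[/D1|/D2].
- by move=> i _; apply: FI; case: ifPn => // h; [exact: F1|exact: F2].
- apply/seteqP; split => [x [h1 h2] i|x h] /=.
    by move=> _; split; case: ifPn => // hi; [exact: h1|exact: h2].
  split => i /= hi.
    by have /= := h i; rewrite mem_undup mem_cat hi => /(_ isT) [].
  by have /= := h i; rewrite mem_undup mem_cat hi orbT => /(_ isT) [].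
Qed.

Lemma bigcap_seq_big (s : seq I) (B : I -> set T) :
  \bigcap_(i in [set i | i \in s]) B i = \big[setI/setT]_(i <- s) B i.
Proof.
elim: s => [|i s IH]; first by rewrite big_nil; apply/seteqP; split => // x _ i.
rewrite big_cons -IH; apply/seteqP; split => [x h|x [h1 h2] j /=].
  by split => [|j /= js]; apply: h; rewrite /= inE ?eqxx// js orbT.
by rewrite inE => /orP[/eqP -> //|js]; exact: h2.
Qed.

Lemma finite_meets_measurable D : finite_meets D `<=` measurable.
Proof.
move=> _ [s [B [_ _ FB ->]]].
rewrite bigcap_seq_big.
by elim: s FB => [|i s IH] FB; rewrite ?big_nil ?big_cons//; apply: measurableI;
  [apply/Fm/FB/mem_head|apply: IH => j js; apply: FB; rewrite inE js orbT].
Qed.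

Lemma finite_meets_indep D1 D2 A1 A2 : D1 `&` D2 = set0 ->
  finite_meets D1 A1 -> finite_meets D2 A2 -> P (A1 `&` A2) = (P A1 * P A2)%E.
Proof.
move=> D12 [s1 [B1 [u1 H1 F1 E1]]] [s2 [B2 [u2 H2 F2 E2]]].
have disj i : i \in s2 -> i \in s1 -> False.
  move=> /H2 h2 /H1 h1; have : (D1 `&` D2) i by [].
  by rewrite D12.
pose B i := if i \in s1 then B1 i else B2 i.
have us : uniq (s1 ++ s2).
  rewrite cat_uniq u1 u2 andbT /=; apply/hasPn => i is2; apply/negP => is1.
  exact: disj is2 is1.
have FB i : i \in s1 ++ s2 -> F i (B i).
  by rewrite mem_cat /B; case: ifPn => [h _|_]; [exact: F1|exact: F2].
have := indF us FB; rewrite big_cat/=.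
have e1 : (\prod_(i <- s1) P (B i))%E = P A1.
  rewrite E1 (indF u1 F1) big_seq [RHS]big_seq; apply: eq_bigr => i h.
  by rewrite /B h.
have e2 : (\prod_(i <- s2) P (B i))%E = P A2.
  rewrite E2 (indF u2 F2) big_seq [RHS]big_seq; apply: eq_bigr => i h.
  by rewrite /B; case: ifPn => // /(disj _ h).
rewrite e1 e2 => <-; congr (P _); rewrite E1 E2.
apply/seteqP; split => [x [h1 h2] i /=|x h].
  rewrite mem_cat /B; case: ifPn => [hi _|_ /= hi]; [exact: h1|exact: h2].
split => i /= hi; have := h i; rewrite /= mem_cat hi ?orbT => /(_ isT); rewrite /B ?hi//.
by case: ifPn => // /(disj _ hi).
Qed.

Lemma sub_sigma_measurable D : <<s finite_meets D >> `<=` measurable.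
Proof. exact: smallest_sub (@sigma_algebra_measurable _ T) (@finite_meets_measurable D). Qed.

(** With [A2] fixed, [P] restricted to [A2] and [P] scaled by [P A2] are finite measures that agree
    on a pi-system generating the sigma-algebra of [D1], hence on all of it. The same argument in
    the other variable gives [sigma_indep]. *)
Lemma sigma_indep_l D1 D2 A1 A2 : D1 `&` D2 = set0 ->
  <<s finite_meets D1 >> A1 -> finite_meets D2 A2 ->
  P (A1 `&` A2) = (P A1 * P A2)%E.
Proof.
move=> D12 h1 h2.
have mA2 := finite_meets_measurable h2.
have c0 : (0 <= fine (P A2))%R by rewrite fine_ge0.
pose c : {nonneg R} := NngNum c0.
rewrite muleC.
have -> : (P A2 * P A1)%E = mscale c P A1.
  by rewrite /mscale/= fineK// fin_num_measure.
rewrite -[LHS]/(mrestr P mA2 A1).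
apply: (@g_sigma_algebra_measure_unique _ R T (finite_meets D1) _ (fun=> setT)) => //.
- exact: finite_meets_measurable.
- by move=> _; exact: finite_meets_setT.
- exact: bigcup_const.
- exact: finite_meetsI.
- move=> A h; rewrite -[LHS]/(P (A `&` A2)) -[RHS]/((fine (P A2))%:E * P A)%E.
  rewrite fineK ?fin_num_measure// muleC.
  exact: finite_meets_indep D12 h h2.
- move=> _; rewrite -[X in (X < _)%E]/(P (setT `&` _)) setTI; apply: le_lt_trans (probability_le1 _ _) _; rewrite ?ltry//.
Qed.

Lemma sigma_indep D1 D2 A1 A2 : D1 `&` D2 = set0 ->
  <<s finite_meets D1 >> A1 -> <<s finite_meets D2 >> A2 ->
  P (A1 `&` A2) = (P A1 * P A2)%E.
Proof.
move=> D12 h1 h2.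
have mA1 := sub_sigma_measurable h1.
have c0 : (0 <= fine (P A1))%R by rewrite fine_ge0.
pose c : {nonneg R} := NngNum c0.
have -> : (P A1 * P A2)%E = mscale c P A2.
  by rewrite /mscale/= fineK// fin_num_measure.
rewrite setIC -[LHS]/(mrestr P mA1 A2).
apply: (@g_sigma_algebra_measure_unique _ R T (finite_meets D2) _ (fun=> setT)) => //.
- exact: finite_meets_measurable.
- by move=> _; exact: finite_meets_setT.
- exact: bigcup_const.
- exact: finite_meetsI.
- move=> A h; rewrite -[LHS]/(P (A `&` A1)) -[RHS]/((fine (P A1))%:E * P A)%E.
  rewrite fineK ?fin_num_measure// setIC.
  exact: sigma_indep_l D12 h1 h.
- move=> _; rewrite -[X in (X < _)%E]/(P (setT `&` _)) setTI; apply: le_lt_trans (probability_le1 _ _) _; rewrite ?ltry//.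
Qed.

Lemma sigma_indep_family (J : eqType) (D : J -> set I) (A : J -> set T) (s : seq J) :
  (forall i j, i != j -> D i `&` D j = set0) -> uniq s ->
  (forall j, j \in s -> <<s finite_meets (D j) >> (A j)) ->
  P (\big[setI/setT]_(j <- s) A j) = (\prod_(j <- s) P (A j))%E.
Proof.
move=> dis; elim: s => [|j s IH]; first by rewrite !big_nil probability_setT.
rewrite /= => /andP[js us] hA; rewrite !big_cons -IH//; last first.
  by move=> i h; apply: hA; rewrite inE h orbT.
apply: (@sigma_indep (D j) (\bigcup_(i in [set i | i \in s]) D i)).
- rewrite setI_bigcupr; apply: bigcup0 => i /= h; apply: dis.
  by apply: contraNneq js => ->.
- by apply: hA; rewrite mem_head.
(* The remaining events are moved into the sigma-algebra of the union of their index sets, which is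
   disjoint from the index set of the head. *)
- have {}hA i : i \in s -> <<s finite_meets (\bigcup_(i in [set i | i \in s]) D i) >> (A i).
    move=> h; have := hA i; rewrite inE h orbT => /(_ isT).
    apply: smallest_sub; first exact: smallest_sigma_algebra.
    move=> B hB; apply: sub_sigma_algebra; apply: finite_meetsS hB => k Dk.
    by exists i.
  elim: s {IH js us} (\bigcup_(_ in _) _) hA => [|i s IH] E hA; rewrite ?big_nil ?big_cons.
    by apply: sub_sigma_algebra; exact: finite_meets_setT.
  pose TE : measurableType _ := g_sigma_algebraType (finite_meets E).
  apply: (@measurableI _ TE); first by apply: hA; rewrite mem_head.
  by apply: IH => k h; apply: hA; rewrite inE h orbT.
Qed.

End independence.

Section decoupling.
Context (R : realType) (disp d1 d2 : measure_display) (T : measurableType disp)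
  (T1 : measurableType d1) (T2 : measurableType d2)
  (P : probability T R) (X1 : T -> T1) (X2 : T -> T2).
Hypotheses (m1 : measurable_fun setT X1) (m2 : measurable_fun setT X2).
Hypothesis ind : forall A B, measurable A -> measurable B ->
  P (X1 @^-1` A `&` X2 @^-1` B) = (P (X1 @^-1` A) * P (X2 @^-1` B))%E.

(** The joint law agrees with the product of the marginals on rectangles, hence everywhere, and
    Tonelli applies. This replaces conditioning on [X1], whose value is frozen in the inner
    integral. *)
Lemma decoupling (f : T1 * T2 -> \bar R) : measurable_fun setT f ->
  (forall x, 0 <= f x)%E ->
  (\int[P]_w f (X1 w, X2 w) = \int[P]_w \int[P]_w' f (X1 w, X2 w'))%E.
Proof.
move=> mf f0.
have mdg : measurable_fun setT (fun w => (X1 w, X2 w)) by exact: measurable_fun_pair.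
pose i1 : {mfun T >-> T1} := HB.pack X1 (isMeasurableFun.Build _ _ _ _ _ m1).
pose i2 : {mfun T >-> T2} := HB.pack X2 (isMeasurableFun.Build _ _ _ _ _ m2).
pose dg : {mfun T >-> (T1 * T2)%type} :=
  HB.pack (fun w => (X1 w, X2 w)) (isMeasurableFun.Build _ _ _ _ _ mdg).
pose P1 : probability T1 R := distribution P i1.
pose P2 : probability T2 R := distribution P i2.
have e : forall A, measurable A -> (P1 \x P2)%E A = distribution P dg A.
  apply: product_measure_unique => A B mA mB.
  rewrite -[LHS]/(P (X1 @^-1` A `&` X2 @^-1` B)); exact: ind.
transitivity (\int[distribution P dg]_x f x)%E.
  by rewrite ge0_integral_distribution.
transitivity (\int[(P1 \x P2)%E]_x f x)%E.
  by apply: eq_measure_integral => A mA _; exact/esym/e.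
rewrite fubini_tonelli1//.
rewrite ge0_integral_distribution//=; last 2 first.
- exact: measurable_fun_fubini_tonelli_F.
- by move=> x; apply: integral_ge0.
apply: eq_integral => w _ /=; rewrite /fubini_F.
rewrite ge0_integral_distribution//=; exact: measurableT_comp.
Qed.

End decoupling.

(** * Densities and convolutions *)

Section lebesgue_invariance.
Context (R : realType).
Local Notation mu := (@lebesgue_measure R).
Local Open Scope ereal_scope.

Lemma lebesgue_measureD (c : R) (A : set R) : measurable A ->
  pushforward mu ((fun x => x + c)%R : R -> measurableTypeR R) A = mu A.
Proof.
move=> mA.
have mc : measurable_fun setT ((fun x => x + c)%R : R -> measurableTypeR R).
  exact: measurable_funD.
pose g : {mfun R >-> measurableTypeR R} := HB.pack (fun x : R => x + c)%R (isMeasurableFun.Build _ _ _ _ _ mc).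
apply/esym; apply: (@lebesgue_measure_unique _ (pushforward mu g)) => //= _ [[a b]] _ <-.
rewrite /pushforward/=.
have -> : (fun x : R => x + c)%R @^-1` `]a, b] = `](a - c)%R, (b - c)%R]%classic.
  by apply/seteqP; split => x /=; rewrite !in_itv/= ltrBlDr lerBrDr.
rewrite !lebesgue_measure_itv/= !lte_fin ltrD2r; case: ifP => // _.
by rewrite -!EFinD opprB addrA subrK.
Qed.

Lemma ge0_integral_translate (c : R) (f : R -> \bar R) :
  measurable_fun setT f -> (forall x, 0 <= f x) ->
  \int[mu]_x f (x + c)%R = \int[mu]_x f x.
Proof.
move=> mf f0.
have mc : measurable_fun setT ((fun x => x + c)%R : R -> measurableTypeR R).
  exact: measurable_funD.
pose g : {mfun R >-> measurableTypeR R} := HB.pack (fun x : R => x + c)%R (isMeasurableFun.Build _ _ _ _ _ mc).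
transitivity (\int[pushforward mu g]_x f x).
  by rewrite ge0_integral_pushforward.
by apply: eq_measure_integral => A mA _; exact: lebesgue_measureD.
Qed.

Lemma ge0_integral_opp (f : R -> \bar R) :
  measurable_fun setT f -> (forall x, 0 <= f x) ->
  \int[mu]_x f (- x)%R = \int[mu]_x f x.
Proof.
move=> mf f0.
have mc : measurable_fun setT ((fun x => - x)%R : R -> measurableTypeR R).
  exact: (measurableT_comp (@oppr_measurable R setT)).
pose g : {mfun R >-> measurableTypeR R} := HB.pack (fun x : R => - x)%R (isMeasurableFun.Build _ _ _ _ _ mc).
transitivity (\int[pushforward mu g]_x f x).
  by rewrite ge0_integral_pushforward.
by apply: eq_measure_integral => A mA _; exact: lebesgue_measureN.
Qed.

Lemma integrable_opp (f : R -> R) : mu.-integrable setT (EFin \o f) ->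
  mu.-integrable setT (EFin \o (fun x => f (- x)%R)).
Proof.
move=> /integrableP[mf fi]; apply/integrableP; split.
  by apply: (measurableT_comp mf).
rewrite (@ge0_integral_opp (fun x => `|(f x)%:E|))//.
exact: measurableT_comp.
Qed.

Lemma integral_odd (f : R -> R) : mu.-integrable setT (EFin \o f) ->
  (forall x, f (- x)%R = (- f x)%R) -> \int[mu]_x (f x)%:E = 0.
Proof.
move=> fi fodd.
have mf : measurable_fun setT (EFin \o f) by have /integrableP[] := fi.
rewrite integralE.
have -> : \int[mu]_x (fun x => (f x)%:E)^\- x = \int[mu]_x (fun x => (f x)%:E)^\+ x.
  rewrite -(@ge0_integral_opp ((fun x => (f x)%:E)^\+)).
  - by apply: eq_integral => x _; rewrite funenegE funeposE fodd EFinN.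
  - exact: measurable_funepos.
  - by move=> x; rewrite funepos_ge0.
rewrite subee//.
apply: integrable_pos_fin_num => //.
Qed.

End lebesgue_invariance.

Section density.
Context (R : realType) (d : measure_display) (T : measurableType d)
  (P : probability T R) (X : T -> R) (p : R -> R).
Hypothesis mX : measurable_fun setT X.
Hypothesis pX : is_density P X p.
Local Notation mu := (@lebesgue_measure R).
Local Open Scope ereal_scope.

Let mp : measurable_fun setT p. Proof. by case: pX. Qed.
Let p0 u : (0 <= p u)%R. Proof. by case: pX. Qed.

Lemma integral_density : \int[mu]_u (p u)%:E = 1.
Proof.
by case: pX => _ _ /(_ _ measurableT) <-; rewrite preimage_setT probability_setT.
Qed.

Lemma integrable_density : mu.-integrable setT (EFin \o p).
Proof.
apply/integrableP; split; first exact/measurable_EFinP.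
suff -> : \int[mu]_x `|(EFin \o p) x| = 1 by rewrite ltry.
rewrite -integral_density; apply: eq_integral => u _ /=; congr EFin.
by rewrite ger0_norm.
Qed.

Import HBNNSimple.

(** The definition of a density is the case of an indicator; simple functions and monotone
    convergence on both sides give the rest. *)
Lemma ge0_integral_density (f : R -> \bar R) : measurable_fun setT f ->
  (forall u, 0 <= f u) ->
  \int[P]_w f (X w) = \int[mu]_u (f u * (p u)%:E).
Proof.
move=> mf f0.
pose Y : {mfun T >-> R} := HB.pack X (isMeasurableFun.Build _ _ _ _ _ mX).
pose nu := distribution P Y.
transitivity (\int[nu]_u f u).
  by rewrite ge0_integral_distribution.
have nuE B : measurable B -> nu B = \int[mu]_(u in B) (p u)%:E.
  by move=> mB; case: pX => _ _ /(_ _ mB) <-.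
pose f_ := nnsfun_approx measurableT mf.
transitivity (limn (fun n => \int[nu]_x (f_ n x)%:E)).
  rewrite -monotone_convergence//.
  - apply: eq_integral => y _; apply/esym/cvg_lim => //.
    by apply: cvg_nnsfun_approx.
  - by move=> n; exact/measurable_EFinP/measurable_funP.
  - by move=> n y _; rewrite lee_fin.
  - by move=> y _ m n mn; rewrite lee_fin; exact/lefP/nd_nnsfun_approx.
transitivity (limn (fun n => \int[mu]_x ((f_ n x)%:E * (p x)%:E))); last first.
  rewrite -monotone_convergence//.
  - apply: eq_integral => y _; apply/cvg_lim => //.
    apply: cvgeMr => //; exact: cvg_nnsfun_approx.
  - move=> n.
    have : measurable_fun [set: R] (fun x => (f_ n x)%:E * (p x)%:E)%E.
      by apply: emeasurable_funM; exact/measurable_EFinP.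
    exact.
  - by move=> n y _; rewrite mule_ge0// lee_fin.
  - move=> y _ m n mn; apply: lee_wpmul2r; rewrite lee_fin ?p0//.
    have /lefP h := nd_nnsfun_approx measurableT mf mn.
    exact: h.
congr (limn _); apply/funext => n.
have mfn r : measurable (f_ n @^-1` [set r]) by exact: measurable_sfunP.
transitivity (\sum_(k \in range (f_ n)) \int[mu]_x ((k * \1_(f_ n @^-1` [set k]) x)%:E * (p x)%:E)); last first.
  rewrite -ge0_integral_fsum//.
  - apply: eq_integral => x _; rewrite -ge0_mule_fsuml; last first.
      by move=> r; rewrite nnfun_muleindic_ge0.
    by rewrite fsumEFin// -fimfunE.
  - move=> r.
    have : measurable_fun [set: R] (fun x => (r * \1_(f_ n @^-1` [set r]) x)%:E * (p x)%:E)%E.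
      apply: emeasurable_funM; apply/measurable_EFinP => //.
      exact: measurable_funM.
    exact.
  - move=> r x _; rewrite mule_ge0 ?lee_fin ?p0//.
    have [r0|r0] := ltP r 0%R; last by rewrite mulr_ge0.
    by rewrite (preimage_nnfun0 _ r0) indic0 mulr0.
rewrite integralT_nnsfun sintegralE; apply: eq_fsbigr => r _.
rewrite -[X in _ * X = _]/(nu _) nuE//.
have [r0|r0] := ltP r 0%R.
  rewrite (preimage_nnfun0 _ r0) integral_set0 mule0.
  rewrite (eq_integral (cst 0)) ?integral0// => x _.
  by rewrite indic0 mulr0 mul0e.
have mr : measurable_fun [set: R] ((fun x => (p x)%:E) \_ (f_ n @^-1` [set r])).
  by apply/(measurable_restrictT _ _).1 => //; apply/measurable_funTS/measurable_EFinP.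
rewrite integral_mkcond -ge0_integralZl//.
- apply: eq_integral => x _; rewrite patchE indicE.
  by case: ifPn => _; rewrite ?mulr1 ?mulr0 ?mule0 ?mul0e.
- by move=> x _; rewrite erestrict_ge0// => y _; rewrite lee_fin.
Qed.

End density.

Section convolution_operators.
Context (R : realType).
Local Notation mu := (@lebesgue_measure R).
Local Open Scope ereal_scope.
Implicit Types (s f g h : R -> \bar R) (c : R).

(* Averages [h] against [c] times a variable of density [s]. *)
Definition conv_op c s h : R -> \bar R :=
  fun x => \int[mu]_u (h (x + c * u)%R * s u).

Lemma conv_op_measurable c s h : measurable_fun setT s -> measurable_fun setT h ->
  (forall u, 0 <= s u) -> (forall u, 0 <= h u) -> measurable_fun setT (conv_op c s h).
Proof.
move=> ms mh s0 h0.
pose F (z : measurableTypeR R * measurableTypeR R) := h (z.1 + c * z.2)%R * s z.2.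
have mF : measurable_fun setT F.
  apply: emeasurable_funM; last exact: measurableT_comp.
  apply: (measurableT_comp mh).
  apply: measurable_funD => //; exact: measurable_funM.
have := @measurable_fun_fubini_tonelli_F _ _ _ _ _ mu F mF.
by apply => z; rewrite mule_ge0.
Qed.

Lemma conv_op_ge0 c s h x : (forall u, 0 <= s u) -> (forall u, 0 <= h u) ->
  0 <= conv_op c s h x.
Proof. by move=> s0 h0; apply: integral_ge0 => u _; rewrite mule_ge0. Qed.

Lemma convolution_ge0 f g x : (forall u, 0 <= f u) -> (forall u, 0 <= g u) ->
  0 <= convolution f g x.
Proof. by move=> f0 g0; apply: integral_ge0 => u _; rewrite mule_ge0. Qed.

Lemma convolution_measurable f g : measurable_fun setT f -> measurable_fun setT g ->
  (forall u, 0 <= f u) -> (forall u, 0 <= g u) -> measurable_fun setT (convolution f g).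
Proof.
move=> mf mg f0 g0.
pose F (z : measurableTypeR R * measurableTypeR R) := f (z.1 - z.2)%R * g z.2.
have mF : measurable_fun setT F.
  apply: emeasurable_funM; last exact: measurableT_comp.
  by apply: (measurableT_comp mf); apply: measurable_funB.
have := @measurable_fun_fubini_tonelli_F _ _ _ _ _ mu F mF.
by apply => z; rewrite mule_ge0.
Qed.

(** Tonelli followed by a translation of [u] by [v]: averaging over a sum is averaging over one
    summand after the other. *)
Lemma conv_op_convolution c f g h x :
  measurable_fun setT f -> measurable_fun setT g -> measurable_fun setT h ->
  (forall u, 0 <= f u) -> (forall u, 0 <= g u) -> (forall u, 0 <= h u) ->
  conv_op c (convolution f g) h x = conv_op c g (conv_op c f h) x.
Proof.
move=> mf mg mh f0 g0 h0.
pose F (z : measurableTypeR R * measurableTypeR R) :=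
  h (x + c * z.1)%R * (f (z.1 - z.2)%R * g z.2).
have mF : measurable_fun setT F.
  apply: emeasurable_funM.
    apply: (measurableT_comp mh); apply: measurable_funD => //; exact: measurable_funM.
  apply: emeasurable_funM; last exact: measurableT_comp.
  by apply: (measurableT_comp mf); apply: measurable_funB.
have F0 z : 0 <= F z by rewrite /F !mule_ge0.
transitivity (\int[mu]_u \int[mu]_v F (u, v)).
  apply: eq_integral => u _; rewrite /F/= ge0_integralZl//.
    have : measurable_fun [set: R] (fun v => f (u - v)%R * g v).
      apply: emeasurable_funM => //; apply: (measurableT_comp mf).
      exact: measurable_funB.
    exact.
  by move=> v _; rewrite mule_ge0.
rewrite fubini_tonelli//.
apply: eq_integral => v _.
pose k (u : R) := h (x + c * u)%R * f (u - v)%R.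
have mk : measurable_fun setT k.
  apply: emeasurable_funM.
    apply: (measurableT_comp mh); apply: measurable_funD => //; exact: measurable_funM.
  by apply: (measurableT_comp mf); apply: measurable_funB.
transitivity (g v * \int[mu]_u k u).
  rewrite -ge0_integralZl//.
  - by apply: eq_integral => u _; rewrite /F /k /= muleA muleC.
  - by move=> u _; rewrite /k mule_ge0.
rewrite -(@ge0_integral_translate _ v k)//; last first.
  by move=> u; rewrite /k mule_ge0.
rewrite muleC; congr (_ * _); apply: eq_integral => u _.
by rewrite /k addrK mulrDr (addrC (c * u)%R) addrA.
Qed.

Lemma convolution_pow_ge0 s k x : (forall u, 0 <= s u) -> 0 <= convolution_pow s k x.
Proof.
move=> s0; rewrite /convolution_pow; elim: k.-1 x => [|j IH] x //=.
exact: convolution_ge0.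
Qed.

Lemma convolution_pow_measurable s k : measurable_fun setT s ->
  (forall u, 0 <= s u) -> measurable_fun setT (convolution_pow s k).
Proof.
move=> ms s0; rewrite /convolution_pow; elim: k.-1 => [|j IH] //=.
apply: convolution_measurable => // u.
exact: (@convolution_pow_ge0 s j.+1).
Qed.

Lemma conv_op_pow c s k h x : measurable_fun setT s -> measurable_fun setT h ->
  (forall u, 0 <= s u) -> (forall u, 0 <= h u) ->
  conv_op c (convolution_pow s k.+1) h x = iter k.+1 (conv_op c s) h x.
Proof.
move=> ms mh s0 h0; elim: k h mh h0 => [|k IH] h mh h0 //.
have -> : iter k.+2 (conv_op c s) h = iter k.+1 (conv_op c s) (conv_op c s h) by rewrite iterSr.
rewrite -IH; last 2 first.
- exact: conv_op_measurable.
- by move=> u; exact: conv_op_ge0.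
rewrite -conv_op_convolution//.
- exact: convolution_pow_measurable.
- by move=> u; exact: convolution_pow_ge0.
Qed.

End convolution_operators.

Section bounded_integrals.
Context (R : realType) (d : measure_display) (T : measurableType d)
  (P : probability T R).

Lemma bounded_integrable (b : T -> R) (C : R) : measurable_fun setT b ->
  (forall w, `|b w| <= C) -> P.-integrable setT (EFin \o b).
Proof.
move=> mb bC; apply: (@le_integrable _ _ _ _ _ measurableT _ (cst C%:E)).
- exact/measurable_EFinP.
- by move=> w _ /=; rewrite lee_fin (le_trans (bC w))// ler_norm.
- by apply/integrableP; split => //; rewrite integral_cst//= probability_setT mule1 ltry.
Qed.

Lemma Rintegral_cst_prob (c : R) : \int[P]_w c = c.
Proof.
rewrite Rintegral_cst// -[X in fine X]/(P setT).
by rewrite probability_setT mulr1.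
Qed.

Lemma Rintegral_bounded (b : T -> R) (C : R) : measurable_fun setT b ->
  (forall w, `|b w| <= C) -> `|\int[P]_w b w| <= C.
Proof.
move=> mb bC; have ib := bounded_integrable mb bC.
apply: le_trans (le_normr_Rintegral measurableT ib) _.
rewrite -[leRHS]Rintegral_cst_prob; apply: le_Rintegral => //.
- exact: integrable_norm.
- have : P.-integrable setT (EFin \o (cst C)).
    apply: (@bounded_integrable _ `|C|) => //.
  exact.
Qed.

Lemma EFin_Rintegral (b : T -> R) (C : R) : measurable_fun setT b ->
  (forall w, `|b w| <= C) -> (\int[P]_w (b w)%:E)%E = (\int[P]_w b w)%:E.
Proof.
move=> mb bC; rewrite /Rintegral fineK//.
exact: integrable_fin_num (bounded_integrable mb bC).
Qed.

Lemma measurable_Rintegral (d' : measure_display) (T' : measurableType d')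
  (g : T' * T -> R) (C : R) : measurable_fun setT g -> (forall z, `|g z| <= C) ->
  measurable_fun setT (fun x => \int[P]_w g (x, w)).
Proof.
move=> mg gC.
have mgx x : measurable_fun setT (fun w => g (x, w)) by exact: measurableT_comp.
(* Adding [C] makes the integrand nonnegative, so that measurability of Tonelli integrals
   applies. *)
have -> : (fun x => \int[P]_w g (x, w)) = (fun x => fine (\int[P]_w (g (x, w) + C)%:E)%E - C).
  apply/funext => x.
  have e : (\int[P]_w (g (x, w) + C) = \int[P]_w g (x, w) + C).
    rewrite RintegralD//; first by rewrite Rintegral_cst_prob.
    - exact: bounded_integrable (mgx x) (fun w => gC (x, w)).
    - by have : P.-integrable setT (EFin \o (cst C)) by exact: (@bounded_integrable _ `|C|).
  by rewrite -[fine _]/(\int[P]_w (g (x, w) + C)) e addrK.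
apply: measurable_funB => //.
apply: (measurableT_comp (fine_measurable _)) => //.
pose F (z : T' * T) := (g z + C)%:E.
have mF : measurable_fun setT F by apply/measurable_EFinP; exact: measurable_funD.
have := @measurable_fun_fubini_tonelli_F _ _ _ _ _ P F mF.
apply => z; rewrite /F lee_fin -lerBlDr sub0r.
by have := gC z; rewrite ler_norml => /andP[].
Qed.

End bounded_integrals.

(** * Symmetrization by Lindeberg swapping *)

Section odd_moment.
Context (R : realType) (d : measure_display) (T : measurableType d)
  (P : probability T R) (X : T -> R) (p : R -> R) (M : R).
Hypothesis mX : measurable_fun setT X.
Hypothesis pX : is_density P X p.
Local Notation mu := (@lebesgue_measure R).
Hypothesis odd1 : (\int[mu]_u (u * odd_part p u)%:E = 0)%E.
Hypothesis odd2 : (\int[mu]_u (u ^+ 2 * `|odd_part p u|)%:E <= M%:E)%E.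

Let mp : measurable_fun [set: R] p. Proof. by case: pX. Qed.
Let p0 u : 0 <= p u. Proof. by case: pX. Qed.

Let mpN : measurable_fun [set: R] (fun u => p (- u)).
Proof. exact: measurableT_comp. Qed.

Lemma odd_part_measurable : measurable_fun [set: R] (odd_part p).
Proof. by apply: measurable_funM => //; exact: measurable_funB. Qed.

Lemma even_part_measurable : measurable_fun [set: R] (even_part p).
Proof. by apply: measurable_funM => //; exact: measurable_funD. Qed.

Lemma even_part_ge0 u : 0 <= even_part p u.
Proof. by rewrite divr_ge0// addr_ge0. Qed.

Lemma even_partN u : even_part p (- u) = even_part p u.
Proof. by rewrite /even_part opprK addrC. Qed.

Let ip := integrable_density pX.
Let ipN : mu.-integrable setT (EFin \o (fun u => p (- u))).
Proof. exact: integrable_opp. Qed.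

Lemma integrable_even_part : mu.-integrable setT (EFin \o even_part p).
Proof.
have := integrableZl measurableT (2^-1) (integrableD measurableT ip ipN).
by apply: eq_integrable => // u _ /=; rewrite -EFinD -EFinM mulrC.
Qed.

Lemma integrable_odd_part : mu.-integrable setT (EFin \o odd_part p).
Proof.
have := integrableZl measurableT (2^-1) (integrableB measurableT ip ipN).
by apply: eq_integrable => // u _ /=; rewrite -EFinD -EFinM mulrC.
Qed.

Lemma integrable_bounded_mul (k q : R -> R) (C : R) :
  measurable_fun [set: R] k -> measurable_fun [set: R] q ->
  (forall u, `|k u| <= C) -> mu.-integrable setT (EFin \o q) ->
  mu.-integrable setT (EFin \o (fun u => k u * q u)).
Proof.
move=> mk mq kC iq.
have C0 : 0 <= C by exact: le_trans (normr_ge0 _) (kC 0).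
have iCq := integrableZl measurableT C iq.
apply: (le_integrable measurableT _ _ iCq).
  have : measurable_fun [set: R] (EFin \o (fun u => k u * q u)).
    by apply/measurable_EFinP; exact: measurable_funM.
  exact.
by move=> u _; rewrite -EFinM /= lee_fin !normrM (ger0_norm C0) ler_wpM2r.
Qed.

Lemma integral_density_bounded (k : R -> R) (C : R) : measurable_fun [set: R] k ->
  (forall u, `|k u| <= C) ->
  (\int[P]_w (k (X w))%:E = \int[mu]_u (k u * p u)%:E)%E.
Proof.
move=> mk kC.
have ikX : P.-integrable setT (EFin \o (fun w => k (X w))).
  by apply: (@bounded_integrable _ _ _ _ _ C) => //; exact: measurableT_comp.
have ikp := integrable_bounded_mul mk mp kC ip.
have iCp := integrableZl measurableT C ip.
have iC : P.-integrable setT (EFin \o (cst C)).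
  by exact: (@bounded_integrable _ _ _ _ _ `|C|).
have h : (\int[P]_w (k (X w) + C)%:E = \int[mu]_u ((k u + C)%:E * (p u)%:E))%E.
  rewrite -(ge0_integral_density mX pX)//.
  - by apply/measurable_EFinP; exact: measurable_funD.
  - by move=> u; rewrite lee_fin -lerBlDr sub0r; have := kC u; rewrite ler_norml => /andP[].
have e1 : (\int[P]_w (k (X w) + C)%:E = \int[P]_w (k (X w))%:E + C%:E)%E.
  rewrite (integralD measurableT ikX iC) /=; congr (_ + _)%E.
  by rewrite integral_cst//= probability_setT mule1.
have e2 : (\int[mu]_u ((k u + C)%:E * (p u)%:E) = \int[mu]_u (k u * p u)%:E + C%:E)%E.
  transitivity (\int[mu]_u ((k u * p u)%:E + C%:E * (p u)%:E))%E.
    by apply: eq_integral => u _ /=; rewrite -!EFinM -EFinD mulrDl.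
  rewrite (integralD measurableT ikp iCp) (integralZl measurableT ip).
  by have -> := integral_density pX; rewrite mule1.
move: h; rewrite e1 e2 => /(congr1 (fun x => x - C%:E)%E).
by rewrite !addeK.
Qed.

(** Against an odd [k] only the odd part of the density contributes. That part annihilates the
    linear function [a u] and has absolute second moment at most [M], so only the quadratic
    remainder is left. [X] itself need not be integrable. *)
Lemma odd_mean_bound (k : R -> R) (C a e : R) : measurable_fun [set: R] k ->
  (forall u, `|k u| <= C) -> (forall u, k (- u) = - k u) -> 0 <= e ->
  (forall u, `|k u - a * u| <= e * u ^+ 2) ->
  `|\int[P]_w k (X w)| <= e * M.
Proof.
move=> mk kC kodd e0 kq.
have mk' : measurable_fun setT (fun w => k (X w)) by exact: measurableT_comp.
have mo := odd_part_measurable; have me := even_part_measurable.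
have io := integrable_odd_part; have ie := integrable_even_part.
have iko := integrable_bounded_mul mk mo kC io.
have ike := integrable_bounded_mul mk me kC ie.
have io2 : mu.-integrable setT (EFin \o (fun u => u ^+ 2 * `|odd_part p u|)).
  apply/integrableP; split.
    have : measurable_fun [set: R] (EFin \o (fun u => u ^+ 2 * `|odd_part p u|)).
      apply/measurable_EFinP; apply: measurable_funM => //.
      exact: (measurableT_comp (@normr_measurable _ _)).
    exact.
  apply: (@le_lt_trans _ _ M%:E); last by rewrite ltry.
  apply: le_trans odd2; rewrite le_eqVlt; apply/orP; left; apply/eqP.
  by apply: eq_integral => u _ /=; rewrite ger0_norm// mulr_ge0// sqr_ge0.
have io1 : mu.-integrable setT (EFin \o (fun u => u * odd_part p u)).
  have dom : mu.-integrable setT (EFin \o (fun u => `|odd_part p u| + u ^+ 2 * `|odd_part p u|)).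
    have := integrableD measurableT (integrable_norm io) io2.
    by apply: eq_integrable => // u _ /=; rewrite -EFinD.
  apply: (le_integrable measurableT _ _ dom).
    have : measurable_fun [set: R] (EFin \o (fun u => u * odd_part p u)).
      by apply/measurable_EFinP; apply: measurable_funM.
    exact.
  move=> u _ /=; rewrite lee_fin normrM [leRHS]ger0_norm; last first.
    by rewrite addr_ge0// mulr_ge0// sqr_ge0.
  rewrite -[X in X + _]mul1r -mulrDl ler_wpM2r// -(real_normK (num_real u)).
  have := sqr_ge0 (`|u| - 1); have := normr_ge0 u; nra.
have alg (u : R) : k u * odd_part p u - a * (u * odd_part p u) = (k u - a * u) * odd_part p u.
  by ring.
have E : ((\int[P]_w k (X w))%:E = \int[mu]_u ((k u - a * u) * odd_part p u)%:E)%E.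
  rewrite -(EFin_Rintegral P mk' (fun w => kC (X w))) (integral_density_bounded mk kC).
  transitivity (\int[mu]_u ((k u * even_part p u)%:E + (k u * odd_part p u)%:E))%E.
    apply: eq_integral => u _; rewrite -EFinD -mulrDr; congr (k u * _)%:E.
    by rewrite /even_part /odd_part; field.
  rewrite (integralD measurableT ike iko) /=.
  rewrite (integral_odd ike) ?add0e; last by move=> u; rewrite kodd even_partN mulNr.
  transitivity (\int[mu]_u ((k u * odd_part p u)%:E - a%:E * (u * odd_part p u)%:E))%E.
    rewrite (integralB measurableT iko (integrableZl measurableT a io1)).
    by rewrite (integralZl measurableT io1) odd1 mule0 sube0.
  apply: eq_integral => u _; rewrite -EFinM -EFinB; congr EFin.
  exact: alg.
have mkau : measurable_fun [set: R] (EFin \o (fun u => (k u - a * u) * odd_part p u)).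
  apply/measurable_EFinP; apply: measurable_funM => //.
  by apply: measurable_funB => //; exact: measurable_funM.
rewrite -lee_fin -abse_EFin E; apply: le_trans (le_abse_integral _ _ _) _ => //.
apply: (@le_trans _ _ (\int[mu]_u (e%:E * (u ^+ 2 * `|odd_part p u|)%:E))%E).
  apply: ge0_le_integral => //.
  - by apply: measurableT_comp.
  - by have /integrableP[] := integrableZl measurableT e io2.
  - by move=> u _; rewrite -EFinM lee_fin /= normrM mulrA ler_wpM2r.
by rewrite (integralZl measurableT io2) EFinM lee_wpmul2l.
Qed.

End odd_moment.

Section lindeberg.
Context (R : realType) (d : measure_display) (T : measurableType d)
  (P : probability T R) (Y : T -> R).
Hypothesis mY : measurable_fun setT Y.
Implicit Types h g q : R -> R.

Definition unit_valued h := measurable_fun [set: R] h /\ forall x, 0 <= h x <= 1.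

(** The bound [|h''| <= 2 H] written as a Taylor remainder: in this form it passes to averages of
    [h], with the averaged [h'], and nothing is differentiated under an integral. *)
Definition quadratic_remainder (H : R) h h' :=
  forall x v, `|h (x + v) - h x - v * h' x| <= H * v ^+ 2.

Definition smooth_test (H : R) h := unit_valued h /\
  exists2 h', measurable_fun [set: R] h' & quadratic_remainder H h h'.

Definition shift_mean h x := \int[P]_w h (x + Y w).

(* Averages [h] against the symmetrized law of [Y], whose density is the even
   part of that of [Y]. *)
Definition sym_mean h x := \int[P]_w ((h (x + Y w) + h (x - Y w)) / 2).

Let madd x : measurable_fun setT (fun w => x + Y w).
Proof. exact: measurable_funD. Qed.

Let msub x : measurable_fun setT (fun w => x - Y w).
Proof. exact: measurable_funB. Qed.

Lemma unit_norm h x : unit_valued h -> `|h x| <= 1.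
Proof. by move=> [_ /(_ x)/andP[h0 h1]]; rewrite ger0_norm. Qed.

Lemma measurable_shift_fun (h : R -> R) x : measurable_fun [set: R] h ->
  measurable_fun setT (fun w => h (x + Y w)).
Proof. by move=> mh; apply: measurableT_comp. Qed.

Lemma measurable_sym_fun (h : R -> R) x : measurable_fun [set: R] h ->
  measurable_fun setT (fun w => (h (x + Y w) + h (x - Y w)) / 2).
Proof.
by move=> mh; apply: measurable_funM => //; apply: measurable_funD; apply: measurableT_comp.
Qed.

Lemma Rintegral_unit (b : T -> R) : measurable_fun setT b ->
  (forall w, 0 <= b w <= 1) -> 0 <= \int[P]_w b w <= 1.
Proof.
move=> mb b01; rewrite Rintegral_ge0/=; last by move=> w _; have /andP[] := b01 w.
apply: le_trans (ler_norm _) _; apply: Rintegral_bounded => // w.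
by have /andP[b0 b1] := b01 w; rewrite ger0_norm.
Qed.

Lemma bounded_mean_shift_measurable (h : R -> R) (C : R) : measurable_fun [set: R] h ->
  (forall x, `|h x| <= C) -> measurable_fun [set: R] (shift_mean h).
Proof.
move=> mh hC.
apply: (@measurable_Rintegral _ _ _ _ _ _ (fun z : R * T => h (z.1 + Y z.2)) C) => //.
apply: (measurableT_comp mh); apply: measurable_funD => //.
exact: measurableT_comp.
Qed.

Lemma bounded_mean_sym_measurable (h : R -> R) (C : R) : measurable_fun [set: R] h ->
  (forall x, `|h x| <= C) -> measurable_fun [set: R] (sym_mean h).
Proof.
move=> mh hC.
apply: (@measurable_Rintegral _ _ _ _ _ _ (fun z : R * T => (h (z.1 + Y z.2) + h (z.1 - Y z.2)) / 2) C) => [|z].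
  apply: measurable_funM => //; apply: measurable_funD; apply: (measurableT_comp mh).
    by apply: measurable_funD => //; exact: measurableT_comp.
  by apply: measurable_funB => //; exact: measurableT_comp.
have := hC (z.1 + Y z.2); have := hC (z.1 - Y z.2).
rewrite !ler_norml => /andP[? ?] /andP[? ?]; apply/andP; split; lra.
Qed.

Lemma unit_shift h : unit_valued h -> unit_valued (shift_mean h).
Proof.
move=> hU; have [mh h01] := hU; split.
  by apply: (@bounded_mean_shift_measurable _ 1) => // x; exact: unit_norm.
by move=> x; apply: Rintegral_unit => //; exact: measurable_shift_fun.
Qed.

Lemma unit_sym h : unit_valued h -> unit_valued (sym_mean h).
Proof.
move=> hU; have [mh h01] := hU; split.
  by apply: (@bounded_mean_sym_measurable _ 1) => // x; exact: unit_norm.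
move=> x; apply: Rintegral_unit; first exact: measurable_sym_fun.
move=> w; have /andP[? ?] := h01 (x + Y w); have /andP[? ?] := h01 (x - Y w).
by apply/andP; split; lra.
Qed.

(** The remainder at [v = 1]; it makes the averages of [h'] well defined. *)
Lemma smooth_derivative_bounded H h h' x : unit_valued h ->
  quadratic_remainder H h h' -> `|h' x| <= H + 1.
Proof.
move=> [_ h01] hq; have := hq x 1; rewrite expr1n !mul1r mulr1.
have /andP[? ?] := h01 x; have /andP[? ?] := h01 (x + 1).
rewrite !ler_norml => /andP[? ?]; apply/andP; split; lra.
Qed.

Lemma Rintegral_sym_lin (b1 b2 : T -> R) (C1 C2 : R) (v : R) :
  measurable_fun setT b1 -> measurable_fun setT b2 ->
  (forall w, `|b1 w| <= C1) -> (forall w, `|b2 w| <= C2) ->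
  \int[P]_w b1 w - v * \int[P]_w b2 w = \int[P]_w (b1 w - v * b2 w).
Proof.
move=> m1 m2 h1 h2.
have i1 := bounded_integrable P m1 h1; have i2 := bounded_integrable P m2 h2.
rewrite RintegralB ?RintegralZl//.
by have := integrableZl measurableT v i2; apply: eq_integrable.
Qed.

Lemma smooth_sym H h : smooth_test H h -> smooth_test H (sym_mean h).
Proof.
move=> [hU [h' mh' hq]]; split; first exact: unit_sym.
have [mh h01] := hU.
have h'b x := smooth_derivative_bounded x hU hq.
exists (sym_mean h'); first exact: bounded_mean_sym_measurable h'b.
move=> x v.
have sb g C (gC : forall x, `|g x| <= C) y w : `|(g (y + Y w) + g (y - Y w)) / 2| <= C.
  have := gC (y + Y w); have := gC (y - Y w).
  rewrite !ler_norml => /andP[? ?] /andP[? ?]; apply/andP; split; lra.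
have h1 y : `|h y| <= 1 by exact: unit_norm.
have e1 : sym_mean h (x + v) - sym_mean h x =
   \int[P]_w ((h (x + v + Y w) + h (x + v - Y w)) / 2 - 1 * ((h (x + Y w) + h (x - Y w)) / 2)).
  rewrite -(@Rintegral_sym_lin _ _ 1 1) ?mul1r//; try exact: measurable_sym_fun; by move=> w; exact: sb.
have m0 := measurable_sym_fun (x + v) mh; have m1 := measurable_sym_fun x mh.
rewrite e1 (@Rintegral_sym_lin _ _ 2 (H + 1)).
- apply: Rintegral_bounded => [|w].
    apply: measurable_funB; first by apply: measurable_funB => //; exact: measurable_funM.
    by apply: measurable_funM => //; exact: measurable_sym_fun.
  have q1 := hq (x + Y w) v; have q2 := hq (x - Y w) v.
  rewrite -(addrAC x v) in q1; rewrite -(addrAC x v) in q2.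
  move: q1 q2; rewrite !ler_norml => /andP[? ?] /andP[? ?]; apply/andP; split; lra.
- by apply: measurable_funB => //; exact: measurable_funM.
- exact: measurable_sym_fun.
- move=> w; rewrite mul1r; have := sb h 1 h1 (x + v) w; have := sb h 1 h1 x w.
  rewrite !ler_norml => /andP[? ?] /andP[? ?]; apply/andP; split; lra.
- by move=> w; exact: sb.
Qed.

Lemma shift_mean_close g q (e : R) x : unit_valued g -> unit_valued q ->
  (forall x, `|g x - q x| <= e) -> `|shift_mean g x - shift_mean q x| <= e.
Proof.
move=> gU qU gq; have [mg _] := gU; have [mq _] := qU.
rewrite /shift_mean -[X in _ - X]mul1r (@Rintegral_sym_lin _ _ 1 1);
  [|exact: measurable_shift_fun|exact: measurable_shift_fun|by move=> w; exact: unit_norm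
  |by move=> w; exact: unit_norm].
apply: Rintegral_bounded => [|w]; last by rewrite mul1r.
by apply: measurable_funB; [|apply: measurable_funM => //]; exact: measurable_shift_fun.
Qed.

Lemma iter_unit_shift k h : unit_valued h -> unit_valued (iter k shift_mean h).
Proof. by move=> hU; elim: k => //= k; exact: unit_shift. Qed.

Lemma iter_unit_sym k h : unit_valued h -> unit_valued (iter k sym_mean h).
Proof. by move=> hU; elim: k => //= k; exact: unit_sym. Qed.

Lemma iter_smooth_sym k H h : smooth_test H h -> smooth_test H (iter k sym_mean h).
Proof. by move=> hU; elim: k => //= k; exact: smooth_sym. Qed.

(** One average is exchanged at a time. The outer [shift_mean] does not increase the sup distance
    accumulated so far, and the new exchange acts on [iter k sym_mean h], which is still a smooth
    test with the same [H]. *)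
Lemma lindeberg (k : nat) (H e : R) h x :
  (forall g y, smooth_test H g -> `|shift_mean g y - sym_mean g y| <= e) ->
  smooth_test H h ->
  `|iter k shift_mean h x - iter k sym_mean h x| <= k%:R * e.
Proof.
move=> step hS; elim: k x => [|k IH] x; first by rewrite /= subrr normr0 mul0r.
rewrite /= -(subrKA (shift_mean (iter k sym_mean h) x)) -natr1 mulrDl mul1r.
apply: le_trans (ler_normD _ _) _; apply: lerD.
  apply: shift_mean_close => //; first by apply: iter_unit_shift; case: hS.
  by apply: iter_unit_sym; case: hS.
by apply: step; exact: iter_smooth_sym.
Qed.

(** The symmetrized law is even, so at [x = 0] a test and its reflection have the same symmetrized
    mean; the two tails of a block are compared through this common value. *)
Lemma iter_sym_mean_flip k h x :
  iter k sym_mean (fun y => h (- y)) x = iter k sym_mean h (- x).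
Proof.
elim: k x => [|k IH] x //=; apply: eq_Rintegral => w _.
by rewrite !IH !opprD opprK addrC.
Qed.

End lindeberg.

Lemma ge0_lebesgue_integralD (R : realType) (f g : R -> \bar R) :
  measurable_fun setT f -> measurable_fun setT g ->
  (forall x, 0 <= f x)%E -> (forall x, 0 <= g x)%E ->
  (\int[@lebesgue_measure R]_x (f x + g x) =
   \int[@lebesgue_measure R]_x f x + \int[@lebesgue_measure R]_x g x)%E.
Proof. by move=> mf mg f0 g0; apply: ge0_integralD. Qed.

Section one_swap.
Context (R : realType) (d : measure_display) (T : measurableType d)
  (P : probability T R) (X : T -> R) (p : R -> R) (M c : R).
Hypothesis mX : measurable_fun setT X.
Hypothesis pX : is_density P X p.
Local Notation mu := (@lebesgue_measure R).
Hypothesis odd1 : (\int[mu]_u (u * odd_part p u)%:E = 0)%E.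
Hypothesis odd2 : (\int[mu]_u (u ^+ 2 * `|odd_part p u|)%:E <= M%:E)%E.

Let Y w := c * X w.

Let mY : measurable_fun setT Y. Proof. exact: measurable_funM. Qed.

(* The linear term of the Taylor expansion vanishes because the odd part of the
   density has zero mean. *)
Lemma swap_bound (H : R) h x : 0 <= H -> smooth_test H h ->
  `|shift_mean P Y h x - sym_mean P Y h x| <= H * c ^+ 2 * M.
Proof.
move=> H0 [hU [h' mh' hq]]; have [mh h01] := hU.
have h1 y : `|h y| <= 1 by exact: unit_norm.
(* The difference of the two means is the mean of the part of [h (x + c * u)] that is odd in [u]. *)
pose k u := (h (x + c * u) - h (x - c * u)) / 2.
have mk : measurable_fun [set: R] k.
  apply: measurable_funM => //; apply: measurable_funB; apply: (measurableT_comp mh).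
    by apply: measurable_funD => //; exact: measurable_funM.
  by apply: measurable_funB => //; exact: measurable_funM.
have -> : shift_mean P Y h x - sym_mean P Y h x = \int[P]_w k (X w).
  rewrite /shift_mean /sym_mean -[X in _ - X]mul1r (@Rintegral_sym_lin _ _ _ _ _ _ 1 1).
  - by apply: eq_Rintegral => w _; rewrite /k /Y; field.
  - exact: measurable_shift_fun.
  - exact: measurable_sym_fun.
  - by [].
  - move=> w; have := h1 (x + Y w); have := h1 (x - Y w).
    rewrite !ler_norml => /andP[? ?] /andP[? ?]; apply/andP; split; lra.
apply: (@odd_mean_bound _ _ _ _ _ _ _ mX pX odd1 odd2 k 1 (c * h' x)) => //.
- move=> u; have := h1 (x + c * u); have := h1 (x - c * u); rewrite /k.
  rewrite !ler_norml => /andP[? ?] /andP[? ?]; apply/andP; split; lra.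
- by move=> u; rewrite /k mulrN opprK; lra.
- by rewrite mulr_ge0// sqr_ge0.
- move=> u; have := hq x (c * u); have := hq x (- (c * u)); rewrite /k.
  rewrite sqrrN exprMn mulrA.
  rewrite !ler_norml => /andP[? ?] /andP[? ?]; apply/andP; split; lra.
Qed.

Lemma lindeberg_scaled (k : nat) (H : R) h x : 0 <= H -> smooth_test H h ->
  `|iter k (shift_mean P Y) h x - iter k (sym_mean P Y) h x| <= k%:R * (H * c ^+ 2 * M).
Proof. by move=> H0; apply: lindeberg => // g y; exact: swap_bound. Qed.

(** Reflecting [u] in the half of the integral that contains [h (x - c * u)] moves the
    symmetrization from the test to the density. *)
Lemma sym_mean_conv_op h x : unit_valued h ->
  (sym_mean P Y h x)%:E = conv_op c (EFin \o even_part p) (EFin \o h) x.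
Proof.
move=> hU; have [mh h01] := hU.
have h1 y : `|h y| <= 1 by exact: unit_norm.
have h0 y : 0 <= h y by have /andP[] := h01 y.
have p0 : forall u, 0 <= p u by case: pX.
have mp : measurable_fun [set: R] p by case: pX.
have maff : measurable_fun [set: R] (fun u => x + c * u).
  by apply: measurable_funD => //; exact: measurable_funM.
have maff' : measurable_fun [set: R] (fun u => x - c * u).
  by apply: measurable_funB => //; exact: measurable_funM.
rewrite /sym_mean -(@EFin_Rintegral _ _ _ _ _ 1); last 2 first.
- exact: measurable_sym_fun.
- move=> w; have := h1 (x + Y w); have := h1 (x - Y w).
  rewrite !ler_norml => /andP[? ?] /andP[? ?]; apply/andP; split; lra.
rewrite (@ge0_integral_density _ _ _ _ _ _ mX pX (fun u => ((h (x + c * u) + h (x - c * u)) / 2)%:E)).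
- pose A u := h (x + c * u) * p u / 2; pose B u := h (x - c * u) * p u / 2.
  have mA : measurable_fun [set: R] (EFin \o A).
    apply/measurable_EFinP; apply: measurable_funM => //; apply: measurable_funM => //.
    exact: (measurableT_comp mh).
  have mB : measurable_fun [set: R] (EFin \o B).
    apply/measurable_EFinP; apply: measurable_funM => //; apply: measurable_funM => //.
    exact: (measurableT_comp mh).
  have A0 u : (0 <= (A u)%:E)%E by rewrite lee_fin /A !mulr_ge0.
  have B0 u : (0 <= (B u)%:E)%E by rewrite lee_fin /B !mulr_ge0.
  transitivity (\int[mu]_u ((A u)%:E + (B u)%:E))%E.
    apply: eq_integral => u _; rewrite -EFinM -EFinD; congr EFin.
    by move: (u : R) => v; rewrite /A /B; field.
  rewrite (ge0_lebesgue_integralD mA mB A0 B0).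
  rewrite -(@ge0_integral_opp _ (EFin \o B))//.
  have mBN : measurable_fun [set: R] (fun u => (B (- u))%:E).
    exact: (measurableT_comp mB).
  rewrite -(ge0_lebesgue_integralD mA mBN A0 (fun u => B0 (- u))).
  apply: eq_integral => u _; rewrite -EFinM -EFinD; congr EFin.
  by move: (u : R) => v; rewrite /A /B /even_part mulrN opprK; field.
- apply/measurable_EFinP; apply: measurable_funM => //.
  by apply: measurable_funD; apply: (measurableT_comp mh).
- by move=> u; rewrite lee_fin divr_ge0// addr_ge0.
Qed.

Lemma iter_sym_mean_conv_op k h x : unit_valued h ->
  (iter k (sym_mean P Y) h x)%:E = iter k (conv_op c (EFin \o even_part p)) (EFin \o h) x.
Proof.
move=> hU; elim: k x => [|k IH] x //=.
rewrite sym_mean_conv_op; last exact: iter_unit_sym.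
by congr conv_op; apply/funext => y; rewrite /= IH.
Qed.

End one_swap.

(** * Heavy tails of the symmetrized sum *)

Section inverse_square.
Context (R : realType).
Local Notation mu := (@lebesgue_measure R).

Lemma integral_inv_sqr (a : R) : 0 < a ->
  (\int[mu]_(x in `[a, +oo[) (x ^- 2)%:E = (a^-1)%:E)%E.
Proof.
move=> a0.
have dV (x : R) : 0 < x -> is_derive x 1 (fun y : R => - y^-1) (x ^- 2).
  move=> x0; have xn : x != 0 by rewrite gt_eqF.
  have dv := is_deriveN (is_deriveV xn (is_derive_id x 1)).
  by apply: is_derive_eq dv _; rewrite scaleNr opprK -[LHS]/(_ * _) mulr1.
have cV (x : R) : 0 < x -> {for x, continuous (fun y : R => y^-1)}.
  by move=> x0; apply: cvgV => //; rewrite gt_eqF.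
have c2 (x : R) : 0 < x -> {for x, continuous (fun y : R => y ^- 2)}.
  move=> x0; apply: (@continuousV _ _ (fun y : R => y ^+ 2)).
    by rewrite sqrf_eq0 gt_eqF.
  exact: exprn_continuous.
rewrite (@ge0_continuous_FTC2y _ (fun x => x ^- 2) (fun x => - x^-1) a 0).
- by rewrite sub0e EFinN oppeK.
- by move=> x _; rewrite invr_ge0 sqr_ge0.
- apply/continuous_within_itvcyP; split => [x|].
    by rewrite in_itv/= andbT => ax; apply: c2; exact: lt_trans ax.
  by apply: cvg_at_right_filter; exact: c2.
- rewrite -oppr0; apply: cvgN; apply/gtr0_cvgV0; last exact: cvg_id.
  by near do by [].
- by move=> x ax; have [] := dV x (lt_trans a0 ax).
- by apply: cvg_at_right_filter; apply: cvgN; exact: cV.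
- move=> x; rewrite in_itv/= andbT => ax; rewrite derive1E.
  by have [_ ->] := dV x (lt_trans a0 ax).
Unshelve. all: by end_near. Qed.

Definition inv_sqr_tail (a x : R) : R := \1_(`[a, +oo[%classic) x * x ^- 2.

Lemma inv_sqr_tail_ge0 a x : 0 <= inv_sqr_tail a x.
Proof. by rewrite mulr_ge0// invr_ge0 sqr_ge0. Qed.

Lemma inv_sqr_tail_measurable (a : R) : 0 < a -> measurable_fun [set: R] (inv_sqr_tail a).
Proof.
move=> a0.
have -> : inv_sqr_tail a = fun x => \1_(`[a, +oo[%classic) x * x `^ (- 2%:R).
  apply/funext => x; rewrite /inv_sqr_tail indicE.
  have [|_] := boolP (x \in _); last by rewrite !mul0r.
  rewrite inE/= in_itv/= andbT => ax; rewrite powRN powR_mulrn//.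
  exact: le_trans (ltW a0) ax.
by apply: measurable_funM => //; exact: measurable_powR.
Qed.

Lemma integral_inv_sqr_tail (a : R) : 0 < a -> (\int[mu]_x (inv_sqr_tail a x)%:E = (a^-1)%:E)%E.
Proof.
move=> a0; rewrite -integral_inv_sqr// [RHS]integral_mkcond.
apply: eq_integral => x _; rewrite /inv_sqr_tail patchE indicE.
by case: ifPn => _; rewrite ?mul1r ?mul0r.
Qed.

(** A majorant of [1 / (a^2 + x^2)], piecewise so that its integral is elementary. *)
Definition inv_sqr_cap (a x : R) : R :=
  \1_(`[- a, a]%classic) x * a ^- 2 + (inv_sqr_tail a x + inv_sqr_tail a (- x)).

Lemma inv_sqr_cap_ge0 a x : 0 <= inv_sqr_cap a x.
Proof.
by rewrite !addr_ge0 ?inv_sqr_tail_ge0// mulr_ge0// invr_ge0 sqr_ge0.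
Qed.

Lemma inv_sqr_cap_measurable (a : R) : 0 < a -> measurable_fun [set: R] (inv_sqr_cap a).
Proof.
move=> a0; apply: measurable_funD; first exact: measurable_funM.
apply: measurable_funD; first exact: inv_sqr_tail_measurable.
exact: (measurableT_comp (inv_sqr_tail_measurable a0)).
Qed.

Lemma integral_inv_sqr_cap (a : R) : 0 < a -> (\int[mu]_x (inv_sqr_cap a x)%:E = (4 / a)%:E)%E.
Proof.
move=> a0; have mt := inv_sqr_tail_measurable a0.
have mt' : measurable_fun [set: R] (fun x => inv_sqr_tail a (- x)) by exact: measurableT_comp.
have t0 x : (0 <= (inv_sqr_tail a x)%:E)%E by rewrite lee_fin inv_sqr_tail_ge0.
have i0 x : (0 <= (\1_(`[- a, a]%classic) x * a ^- 2)%:E)%E.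
  by rewrite lee_fin mulr_ge0// invr_ge0 sqr_ge0.
rewrite (@ge0_lebesgue_integralD _ (fun x => (\1_(`[- a, a]%classic) x * a ^- 2)%:E)
  (fun x => (inv_sqr_tail a x + inv_sqr_tail a (- x))%:E))//; last 3 first.
- by apply/measurable_EFinP; exact: measurable_funM.
- by apply/measurable_EFinP; exact: measurable_funD.
- by move=> x; rewrite EFinD adde_ge0.
rewrite (@ge0_lebesgue_integralD _ (fun x => (inv_sqr_tail a x)%:E)
  (fun x => (inv_sqr_tail a (- x))%:E))//; try exact/measurable_EFinP.
rewrite (@ge0_integral_opp _ (fun x => (inv_sqr_tail a x)%:E))//; last exact/measurable_EFinP.
rewrite integral_inv_sqr_tail//.
have -> : (\int[mu]_x (\1_(`[- a, a]%classic) x * a ^- 2)%:E = (2 / a)%:E)%E.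
  transitivity (\int[mu]_x ((a ^- 2)%:E * (\1_(`[- a, a]%classic) x)%:E))%E.
    by apply: eq_integral => x _; rewrite -EFinM mulrC.
  rewrite ge0_integralZl//; last 2 first.
  - have : measurable_fun [set: R] (EFin \o (\1_(`[- a, a]%classic) : R -> R)).
    by apply: measurableT_comp.
  exact.
  - by rewrite lee_fin invr_ge0 sqr_ge0.
  have -> : (\int[mu]_x (\1_(`[- a, a]%classic) x)%:E = (a - - a)%:E)%E.
    rewrite (@integral_indic _ _ _ mu _ measurableT) ?setIT//.
    rewrite -[LHS]/(lebesgue_measure (`[- a, a]%classic : set R)) lebesgue_measure_itv/= lte_fin.
    by have -> : - a < a by lra.
  by rewrite -EFinM; congr EFin; field; rewrite gt_eqF.
by rewrite -!EFinD; congr EFin; field; rewrite gt_eqF.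
Qed.

Lemma inv_sqr_cap_ge (a x : R) : 0 < a -> (a ^+ 2 + x ^+ 2)^-1 <= inv_sqr_cap a x.
Proof.
move=> a0; have a20 : 0 < a ^+ 2 by rewrite exprn_gt0.
have x20 := sqr_ge0 x.
have [t1 t2] := (inv_sqr_tail_ge0 a x, inv_sqr_tail_ge0 a (- x)).
have i0 : 0 <= \1_(`[- a, a]%classic) x * a ^- 2 by rewrite mulr_ge0// invr_ge0 sqr_ge0.
rewrite /inv_sqr_cap; have [xa|xa] := leP `|x| a.
  apply: (@le_trans _ _ (\1_(`[- a, a]%classic) x * a ^- 2)); last lra.
  rewrite indicE mem_set ?mul1r; last by rewrite /= in_itv/= -ler_norml.
  by rewrite lef_pV2 ?posrE// ?lerDl//; lra.
have x0 : 0 < x ^+ 2 by rewrite -real_normK ?num_real// exprn_gt0// (lt_trans a0).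
have h : (a ^+ 2 + x ^+ 2)^-1 <= x ^- 2.
  by rewrite lef_pV2 ?posrE// ?lerDr//; lra.
have [xp|xn] := leP 0 x.
  apply: (@le_trans _ _ (inv_sqr_tail a x)); last lra.
  rewrite /inv_sqr_tail indicE mem_set ?mul1r//= in_itv/= andbT.
  by rewrite ger0_norm// in xa; exact: ltW.
apply: (@le_trans _ _ (inv_sqr_tail a (- x))); last lra.
rewrite /inv_sqr_tail indicE mem_set ?mul1r ?sqrrN//= in_itv/= andbT.
by rewrite ltr0_norm// in xa; exact: ltW.
Qed.

End inverse_square.

(** * Estimates for the Gaussian density *)

Section gaussian_bounds.
Context (R : realType).
Local Notation mu := (@lebesgue_measure R).
Local Notation phi := (normal_pdf (0 : R) 1).

Lemma normal_pdf01E (u : R) : phi u = normal_peak (1 : R) * expR (- (u ^+ 2 / 2)).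
Proof.
by rewrite normal_pdfE ?oner_eq0// /normal_fun subr0 expr1n -mulr_natl mulr1 mulNr.
Qed.

Lemma normal_peak1_le1 : normal_peak (1 : R) <= 1.
Proof.
rewrite /normal_peak expr1n mul1r invf_le1 ?sqrtr_gt0.
  rewrite -[leLHS]sqrtr1 ler_sqrt; last by rewrite mulrn_wge0// pi_ge0.
  by have := pi_ge2 R; rewrite -mulr_natl; lra.
by rewrite mulrn_wgt0// pi_gt0.
Qed.

Lemma normal_pdf01_even (u : R) : phi (- u) = phi u.
Proof. by rewrite !normal_pdf01E sqrrN. Qed.

Lemma normal_pdf01_le_inv_sqr (u : R) : u != 0 -> phi u <= 2 * u ^- 2.
Proof.
move=> u0; have u20 : 0 < u ^+ 2 by rewrite lt_neqAle sqr_ge0 eq_sym sqrf_eq0 u0.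
rewrite normal_pdf01E; apply: (@le_trans _ _ (expR (- (u ^+ 2 / 2)))).
  by rewrite ler_piMl ?expR_ge0 ?normal_peak1_le1.
rewrite (_ : 2 * u ^- 2 = (u ^+ 2 / 2)^-1); last by rewrite invf_div.
rewrite expRN lef_pV2 ?posrE ?expR_gt0 ?divr_gt0//.
by apply: le_trans (expR_ge1Dx _); lra.
Qed.

(** By evenness it suffices to treat [0 <= a <= b]. If [b - a >= 1] the bound is trivial; otherwise
    the exponential drops by at most [(b - a) (b + a) / 2 * exp(- a^2 / 2)], and [b + a <= 2 a + 1]
    is absorbed by the exponential. *)
Lemma normal_pdf01_lipschitz (u v : R) : `|phi u - phi v| <= 2 * `|u - v|.
Proof.
wlog uv : u v / `|u| <= `|v|.
  move=> H; have [/H//|/ltW/H] := leP `|u| `|v|.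
  by rewrite distrC [in leRHS]distrC.
rewrite !normal_pdf01E -mulrBr normrM ger0_norm ?normal_peak_ge0//.
apply: (@le_trans _ _ `|expR (- (u ^+ 2 / 2)) - expR (- (v ^+ 2 / 2))|).
  by rewrite ler_piMl ?normal_peak1_le1.
apply: (@le_trans _ _ (2 * (`|v| - `|u|))); last first.
  by rewrite ler_pM2l//; apply: le_trans (ler_norm _) _; rewrite distrC; exact: ler_dist_dist.
rewrite -(real_normK (num_real u)) -(real_normK (num_real v)).
move: `|u| `|v| (normr_ge0 u) (normr_ge0 v) uv => a b a0 b0 ab.
have ab2 : a ^+ 2 <= b ^+ 2 by rewrite ler_pXn2r.
rewrite ger0_norm; last by rewrite subr_ge0 ler_expR lerN2 ler_pM2r ?invr_gt0.
have e1 : expR (- (a ^+ 2 / 2)) <= 1 by rewrite expR_le1 oppr_le0 divr_ge0 ?sqr_ge0.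
have e2 := expR_ge0 (- (b ^+ 2 / 2)); have e3 := expR_ge0 (- (a ^+ 2 / 2)).
have [h|h] := leP 1 (b - a); first lra.
have e4 : expR (- (a ^+ 2 / 2)) * (1 + a ^+ 2 / 2) <= 1.
  rewrite expRN mulrC ler_pdivrMr ?expR_gt0// mul1r; exact: expR_ge1Dx.
have e5 : expR (- (a ^+ 2 / 2)) * (1 - (b ^+ 2 - a ^+ 2) / 2) <= expR (- (b ^+ 2 / 2)).
  have -> : - (b ^+ 2 / 2) = - (a ^+ 2 / 2) + (- ((b ^+ 2 - a ^+ 2) / 2)) by lra.
  by rewrite expRD ler_wpM2l// expR_ge1Dx.
set E := expR _ in e1 e3 e4 e5 *.
have e6 : E * ((b + a) / 2) <= 2.
  have : (b + a) / 2 <= 3 / 2 * (1 + a ^+ 2 / 2) by have := sqr_ge0 (a - 1); nra.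
  move=> /(ler_wpM2l e3); lra.
have ba : 0 <= b - a by lra.
have := ler_wpM2l ba e6; lra.
Qed.

(** Far from sharp, but of the same order [1 / t] as the tail of the symmetrized sum to which it is
    added. *)
Lemma normal_tail (a : R) : 0 < a ->
  (\int[mu]_(x in `]a, +oo[) (phi x)%:E <= (2 / a)%:E)%E.
Proof.
move=> a0.
apply: (@le_trans _ _ (\int[mu]_x (2 * inv_sqr_tail a x)%:E)%E).
  rewrite integral_mkcond; apply: ge0_le_integral => //.
  - by move=> x _; rewrite erestrict_ge0// => y _; rewrite lee_fin normal_pdf_ge0.
  - have : measurable_fun [set: R] ((fun x => (phi x)%:E) \_ `]a, +oo[%classic).
      apply/(measurable_restrictT _ _).1 => //; apply/measurable_funTS/measurable_EFinP.
      exact: measurable_normal_pdf.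
    exact.
  - have : measurable_fun [set: R] (fun x => (2 * inv_sqr_tail a x)%:E).
      by apply/measurable_EFinP; apply: measurable_funM => //; exact: inv_sqr_tail_measurable.
    exact.
  - move=> x _; rewrite patchE; case: ifPn => [|_].
      rewrite inE/= in_itv/= andbT => ax; rewrite lee_fin /inv_sqr_tail.
      rewrite indicE mem_set ?mul1r/=; last by rewrite in_itv/= andbT ltW.
      by apply: normal_pdf01_le_inv_sqr; rewrite gt_eqF// (lt_trans a0).
    by rewrite lee_fin mulr_ge0// inv_sqr_tail_ge0.
rewrite le_eqVlt; apply/orP; left; apply/eqP.
transitivity (\int[mu]_x (2%:E * (inv_sqr_tail a x)%:E))%E => //.
rewrite ge0_integralZl//.
- by rewrite integral_inv_sqr_tail// -EFinM.
- have : measurable_fun [set: R] (fun x => (inv_sqr_tail a x)%:E).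
    by apply/measurable_EFinP; exact: inv_sqr_tail_measurable.
  exact.
- by move=> x _; rewrite lee_fin inv_sqr_tail_ge0.
Qed.

End gaussian_bounds.

(** * A smooth test function for two-sided tails *)

Section tail_test.
Context (R : realType).
Implicit Types (s x : R).

(* A smooth substitute for the indicator of [|x| > s], up to a factor 2. *)
Definition tail_test s x : R := x ^+ 2 / (s ^+ 2 + x ^+ 2).

Lemma tail_test_unit s : 0 < s -> unit_valued (tail_test s).
Proof.
move=> s0; have D x : 0 < s ^+ 2 + x ^+ 2 by rewrite ltr_wpDr ?sqr_ge0// exprn_gt0.
split => [|x]; last first.
  rewrite /tail_test; apply/andP; split; first by rewrite divr_ge0 ?sqr_ge0// ltW.
  by rewrite ler_pdivrMr// mul1r lerDr sqr_ge0.
apply: continuous_measurable_fun => x.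
apply: (@cvgM _ _ _ _ (fun y : R => y ^+ 2) (fun y => (s ^+ 2 + y ^+ 2)^-1)).
  exact: exprn_continuous.
apply: (@cvgV _ _ _ _ (fun y : R => s ^+ 2 + y ^+ 2)); first by rewrite gt_eqF.
by apply: cvgD; [exact: cvg_cst|exact: exprn_continuous].
Qed.

Lemma tail_test_smooth s : 0 < s -> smooth_test (2 / s ^+ 2) (tail_test s).
Proof.
move=> s0; have s20 : 0 < s ^+ 2 by rewrite exprn_gt0.
have D x : 0 < s ^+ 2 + x ^+ 2 by rewrite ltr_wpDr ?sqr_ge0.
split; first exact: tail_test_unit.
exists (fun x => 2 * x * s ^+ 2 / (s ^+ 2 + x ^+ 2) ^+ 2).
  apply: continuous_measurable_fun => x.
  apply: (@cvgM _ _ _ _ (fun y : R => 2 * y * s ^+ 2) (fun y => ((s ^+ 2 + y ^+ 2) ^+ 2)^-1)).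
    by apply: cvgM; [apply: cvgM; [exact: cvg_cst|exact: cvg_id]|exact: cvg_cst].
  apply: (@cvgV _ _ _ _ (fun y : R => (s ^+ 2 + y ^+ 2) ^+ 2)).
    by rewrite sqrf_eq0 gt_eqF.
  apply: (cvg_comp _ (fun z : R => z ^+ 2)); last exact: exprn_continuous.
  by apply: cvgD; [exact: cvg_cst|exact: exprn_continuous].
move=> x v; rewrite /tail_test; set y := x + v.
have Dx := D x; have Dy := D y.
(* The remainder is an explicit multiple of [v^2], so no second derivative is computed. *)
have -> : y ^+ 2 / (s ^+ 2 + y ^+ 2) - x ^+ 2 / (s ^+ 2 + x ^+ 2)
    - v * (2 * x * s ^+ 2 / (s ^+ 2 + x ^+ 2) ^+ 2) =
  s ^+ 2 * v ^+ 2 * (s ^+ 2 - x ^+ 2 - 2 * x * y)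
    / ((s ^+ 2 + x ^+ 2) ^+ 2 * (s ^+ 2 + y ^+ 2)).
  by rewrite /y in Dy *; field; rewrite !gt_eqF.
rewrite normrM [X in _ * X]ger0_norm; last first.
  by rewrite invr_ge0 mulr_ge0 ?sqr_ge0 ?ltW.
rewrite ler_pdivrMr; last by rewrite mulr_gt0 ?exprn_gt0.
rewrite 2![in leLHS]normrM (ger0_norm (sqr_ge0 s)) (ger0_norm (sqr_ge0 v)).
have key : `|s ^+ 2 - x ^+ 2 - 2 * x * y| * s ^+ 4 <=
   2 * ((s ^+ 2 + x ^+ 2) ^+ 2 * (s ^+ 2 + y ^+ 2)).
  have -> : s ^+ 4 = s ^+ 2 * s ^+ 2 by rewrite -exprD.
  move: (s ^+ 2) s20 Dx Dy => S S0 Dx Dy.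
  have x2 := sqr_ge0 x; have y2 := sqr_ge0 y.
  have h1 : `|S - x ^+ 2 - 2 * x * y| <= (S + x ^+ 2) + 2 * `|x * y|.
    apply: le_trans (ler_normB _ _) _; apply: lerD; last by rewrite -mulrA normrM ger0_norm.
    by rewrite ler_norml; apply/andP; split; lra.
  have h2 : 2 * `|x * y| * S <= (S + x ^+ 2) * (S + y ^+ 2).
    have : 2 * `|x * y| <= x ^+ 2 + y ^+ 2.
      rewrite normrM -(real_normK (num_real x)) -(real_normK (num_real y)).
      by have := sqr_ge0 (`|x| - `|y|); nra.
    move=> /(ler_wpM2r (ltW S0)); nra.
  have h3 : (S + x ^+ 2) * (S * S) <= (S + x ^+ 2) ^+ 2 * (S + y ^+ 2).
    rewrite expr2 -!mulrA ler_pM2l//; apply: ler_pM; lra.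
  have h4 : (2 * `|x * y| * S) * S <= (S + x ^+ 2) ^+ 2 * (S + y ^+ 2).
    have -> : (S + x ^+ 2) ^+ 2 * (S + y ^+ 2) = (S + x ^+ 2) * (S + y ^+ 2) * (S + x ^+ 2) by ring.
    apply: ler_pM => //; try lra.
    by rewrite mulr_ge0 ?(ltW S0)// mulr_ge0.
  have := ler_wpM2r (ltW (mulr_gt0 S0 S0)) h1; lra.
have v2 := sqr_ge0 v.
have -> : 2 / s ^+ 2 * v ^+ 2 * ((s ^+ 2 + x ^+ 2) ^+ 2 * (s ^+ 2 + y ^+ 2)) =
  v ^+ 2 / s ^+ 2 * (2 * ((s ^+ 2 + x ^+ 2) ^+ 2 * (s ^+ 2 + y ^+ 2))).
  by field; rewrite gt_eqF.
have -> : s ^+ 2 * v ^+ 2 * `|s ^+ 2 - x ^+ 2 - 2 * x * y| =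
  v ^+ 2 / s ^+ 2 * (`|s ^+ 2 - x ^+ 2 - 2 * x * y| * s ^+ 4).
  by field; rewrite gt_eqF.
by apply: ler_wpM2l => //; rewrite divr_ge0// ltW.
Qed.

Lemma tail_test_ge s x : 0 < s -> s <= `|x| -> 2^-1 <= tail_test s x.
Proof.
move=> s0 sx; rewrite /tail_test.
have : s ^+ 2 <= x ^+ 2.
  by rewrite -(real_normK (num_real x)) ler_pXn2r// nnegrE ltW.
rewrite ler_pdivlMr; last by rewrite ltr_wpDr ?sqr_ge0// exprn_gt0.
lra.
Qed.

End tail_test.

Lemma powR_addr (R : realType) (x r s : R) : 0 < x -> x `^ (r + s) = x `^ r * x `^ s.
Proof. by move=> x0; rewrite powRD// (gt_eqF x0) implybT. Qed.

(** * The tail of the symmetrized mean from the convolution bound *)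

Section stable_tail.
Context (R : realType) (d : measure_display) (T : measurableType d)
  (P : probability T R) (X : T -> R) (p : R -> R) (B beta : R) (n : nat).
Hypothesis mX : measurable_fun setT X.
Hypothesis pX : is_density P X p.
Hypotheses (B0 : 0 < B) (beta1 : 1 <= beta) (n0 : (0 < n)%N).
Local Notation mu := (@lebesgue_measure R).
Local Notation s_n := (convolution_pow (EFin \o even_part p) n).
Hypothesis sn : forall u : R, (s_n u <= (B * n%:R / (n%:R `^ ((beta + 1) / beta)
   + `|u| `^ (1 + beta)))%:E)%E.

(* The solution of [(n tau)^beta = B n]: beyond [n tau] the bound on the n-fold
   convolution is at most [n tau / u^2]. *)
Definition tail_scale : R := (B / n%:R `^ (beta - 1)) `^ (1 / beta).

Let nr0 : 0 < n%:R :> R. Proof. by rewrite ltr0n. Qed.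
Let b0 : 0 < beta. Proof. exact: lt_le_trans beta1. Qed.

Lemma tail_scale_gt0 : 0 < tail_scale.
Proof. by rewrite powR_gt0// divr_gt0// powR_gt0. Qed.

Let ntau0 : 0 < n%:R * tail_scale. Proof. exact: mulr_gt0 nr0 tail_scale_gt0. Qed.

Lemma tail_scale_powR : (n%:R * tail_scale) `^ beta = B * n%:R.
Proof.
rewrite powRM ?ltW ?tail_scale_gt0// /tail_scale -powRrM.
rewrite mul1r mulVf ?gt_eqF// powRr1; last by rewrite divr_ge0 ?powR_ge0 ?ltW.
rewrite mulrCA; congr (_ * _).
rewrite -powRN -powR_addr//.
by rewrite opprB addrC subrK powRr1// ltW.
Qed.

(** Dropping the first term of the denominator leaves [(n tau)^beta / |u|^(1 + beta)], and
    [beta >= 1] lets [|u|^(beta - 1)] be bounded below by [(n tau)^(beta - 1)]. The exponent of [u]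
    is then the same for every [beta]. *)
Lemma convolution_tail (u : R) : n%:R * tail_scale <= `|u| ->
  (s_n u <= (n%:R * tail_scale / u ^+ 2)%:E)%E.
Proof.
move=> hu; apply: le_trans (sn u) _; rewrite lee_fin -tail_scale_powR.
have u0 : 0 < `|u| by exact: lt_le_trans hu.
apply: (@le_trans _ _ ((n%:R * tail_scale) `^ beta / `|u| `^ (1 + beta))).
  rewrite ler_wpM2l ?powR_ge0// lef_pV2 ?posrE ?addr_gt0 ?powR_gt0//.
  by rewrite lerDr powR_ge0.
rewrite (_ : 1 + beta = 2%:R + (beta - 1)); last by lra.
rewrite powR_addr//.
rewrite powR_mulrn; last exact: ltW.
rewrite real_normK ?num_real//.
have u20 : 0 < u ^+ 2 by rewrite -(real_normK (num_real u)) exprn_gt0.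
have := ntau0; move: (n%:R * tail_scale) hu => t hu t0.
have -> : t `^ beta = t * t `^ (beta - 1).
  rewrite -[X in X * _]powRr1; last by rewrite ltW.
  by rewrite -powR_addr//; congr (_ `^ _); lra.
rewrite ler_pdivrMr; last by rewrite mulr_gt0// powR_gt0.
rewrite mulrA divfK ?gt_eqF// ler_pM2l//.
by apply: ge0_ler_powR; rewrite ?nnegrE ?subr_ge0// ltW.
Qed.

Let Y w := n%:R^-1 * X w.

Let ps0 : forall u : R, (0 <= (EFin \o even_part p) u)%E.
Proof. by move=> u; rewrite lee_fin; exact: (even_part_ge0 pX). Qed.

Let psm : measurable_fun [set: R] (EFin \o even_part p).
Proof. by apply/measurable_EFinP; exact: (even_part_measurable pX). Qed.

Lemma sym_mean_convolution (h : R -> R) (x : R) : unit_valued h ->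
  (iter n (sym_mean P Y) h x)%:E =
  (\int[mu]_u ((h (x + n%:R^-1 * u))%:E * s_n u))%E.
Proof.
move=> hU; have [mh h01] := hU.
rewrite (iter_sym_mean_conv_op _ mX pX)//.
case: n n0 => // k _; rewrite -conv_op_pow//.
- exact/measurable_EFinP.
- by move=> u; rewrite lee_fin; have /andP[] := h01 u.
Qed.

(** The case of the constant test 1, which symmetrized averaging fixes. *)
Lemma integral_convolution_pow : (\int[mu]_u s_n u = 1)%E.
Proof.
have one_unit : unit_valued (cst (1 : R)) by split => // x; rewrite /= ler01 lexx.
have e : iter n (sym_mean P Y) (cst 1) = cst 1.
  elim: n => // k IH; rewrite iterS IH; apply/funext => x; rewrite /sym_mean /cst/=.
  rewrite -[RHS](@Rintegral_cst_prob _ _ _ P); apply: eq_Rintegral => w _; by field.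
have := sym_mean_convolution 0 one_unit; rewrite e /= => ->.
by apply: eq_integral => u _; rewrite mul1e.
Qed.

(** The integral is split at [|u| = n tau]. Below, the test is at most [tau / s], being bounded both
    by 1 and by [(tau / s)^2], and the convolution has mass 1. Above, the factor [u^2] of the test
    cancels the decay of the convolution and leaves [n tau / ((n s)^2 + u^2)], of integral at most
    [4 tau / s]. *)
Lemma sym_tail_test (s : R) : 0 < s ->
  iter n (sym_mean P Y) (tail_test s) 0 <= 5 * tail_scale / s.
Proof.
move=> s0; have hU := tail_test_unit s0; have [mt t01] := hU.
have tau0 := tail_scale_gt0; have ns0 : 0 < n%:R * s by rewrite mulr_gt0.
rewrite -lee_fin sym_mean_convolution//.
have ms : measurable_fun [set: R] s_n by exact: convolution_pow_measurable.
have s_ge0 u : (0 <= s_n u)%E by exact: convolution_pow_ge0.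
have mq := inv_sqr_cap_measurable ns0.
pose F1 u := ((tail_scale / s)%:E * s_n u)%E.
pose F2 u := ((n%:R * tail_scale)%:E * (inv_sqr_cap (n%:R * s) u)%:E)%E.
have F10 u : (0 <= F1 u)%E by rewrite mule_ge0// lee_fin ltW// divr_gt0.
have F20 u : (0 <= F2 u)%E.
  by rewrite mule_ge0// lee_fin ?inv_sqr_cap_ge0// ltW.
have mF1 : measurable_fun [set: R] F1 by exact: measurable_funeM.
have mF2 : measurable_fun [set: R] F2.
  by apply: measurable_funeM; exact/measurable_EFinP.
apply: (@le_trans _ _ (\int[mu]_u (F1 u + F2 u))%E).
  apply: ge0_le_integral => //.
  - by move=> u _; rewrite mule_ge0// lee_fin; have /andP[] := t01 (0 + n%:R^-1 * u).
  - have : measurable_fun [set: R] (fun u => (tail_test s (0 + n%:R^-1 * u))%:E * s_n u)%E.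
      apply: emeasurable_funM => //; apply/measurable_EFinP.
      apply: (measurableT_comp mt); apply: measurable_funD => //; exact: measurable_funM.
    exact.
  - have : measurable_fun [set: R] (fun u => F1 u + F2 u)%E by exact: emeasurable_funD.
    exact.
  - move=> u _; rewrite add0r.
    have tE : tail_test s (n%:R^-1 * u) = u ^+ 2 / ((n%:R * s) ^+ 2 + u ^+ 2).
      have D : 0 < (n%:R * s) ^+ 2 + (u : R) ^+ 2 by rewrite ltr_wpDr ?sqr_ge0// exprn_gt0.
      have D2 : 0 < s ^+ 2 + (n%:R^-1 * u : R) ^+ 2 by rewrite ltr_wpDr ?sqr_ge0// exprn_gt0.
      rewrite /tail_test; move: (u : R) D D2 => v D D2.
      rewrite exprMn exprVn; have n2 : 0 < n%:R ^+ 2 :> R by rewrite exprn_gt0.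
      have -> : s ^+ 2 + n%:R ^- 2 * v ^+ 2 = ((n%:R * s) ^+ 2 + v ^+ 2) / n%:R ^+ 2.
        by field; rewrite gt_eqF.
      by rewrite invf_div; field; rewrite !gt_eqF.
    have /andP[t0 t1] := t01 (n%:R^-1 * u).
    have [hu|hu] := leP `|u : R| (n%:R * tail_scale).
      apply: le_trans (_ : F1 u <= _)%E; last by rewrite leeDl.
      apply: lee_wpmul2r => //; rewrite lee_fin.
      have [ts|ts] := leP s tail_scale.
        by apply: le_trans t1 _; rewrite ler_pdivlMr// mul1r.
      apply: (@le_trans _ _ ((tail_scale / s) ^+ 2)); last first.
        rewrite expr2 ler_piMr//; first by rewrite divr_ge0// ltW.
        by rewrite ler_pdivrMr// mul1r ltW.
      rewrite tE; apply: (@le_trans _ _ ((n%:R * tail_scale) ^+ 2 / (n%:R * s) ^+ 2)).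
        apply: ler_pM; rewrite ?sqr_ge0 ?invr_ge0 ?addr_ge0 ?sqr_ge0//.
          by rewrite -(real_normK (num_real u)) ler_pXn2r// nnegrE// ltW// mulr_gt0.
        by rewrite lef_pV2 ?posrE ?lerDl ?sqr_ge0// ?ltr_wpDr ?sqr_ge0 ?exprn_gt0.
      by rewrite le_eqVlt; apply/orP; left; apply/eqP; field; rewrite !gt_eqF.
    apply: le_trans (_ : F2 u <= _)%E; last by rewrite leeDr.
    apply: (@le_trans _ _ ((tail_test s (n%:R^-1 * u))%:E * (n%:R * tail_scale / u ^+ 2)%:E)%E).
      apply: lee_wpmul2l; first by rewrite lee_fin.
      by apply: convolution_tail; exact: ltW.
    have u20 : 0 < (u : R) ^+ 2.
      by rewrite -(real_normK (num_real u)) exprn_gt0// (lt_trans _ hu)// mulr_gt0.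
    rewrite -EFinM lee_fin tE.
    have D : 0 < (n%:R * s) ^+ 2 + (u : R) ^+ 2 by rewrite ltr_wpDr ?sqr_ge0// exprn_gt0.
    have -> : u ^+ 2 / ((n%:R * s) ^+ 2 + u ^+ 2) * (n%:R * tail_scale / u ^+ 2)
      = (n%:R * tail_scale) * ((n%:R * s) ^+ 2 + u ^+ 2)^-1.
      have un : (u : R) != 0 by move: u20; rewrite -sqrf_eq0 => /gt_eqF ->.
      by move: (u : R) un D => v v0 D; field; rewrite v0 gt_eqF.
    by rewrite ler_pM2l//; exact: inv_sqr_cap_ge.
rewrite (@ge0_lebesgue_integralD _ F1 F2)//.
have -> : (\int[mu]_u F1 u = (tail_scale / s)%:E)%E.
  rewrite /F1 ge0_integralZl//; last by rewrite lee_fin divr_ge0// ltW.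
  by have -> := integral_convolution_pow; rewrite mule1.
have -> : (\int[mu]_u F2 u = (n%:R * tail_scale * (4 / (n%:R * s)))%:E)%E.
  rewrite /F2 ge0_integralZl//.
  - by rewrite integral_inv_sqr_cap.
  - have : measurable_fun [set: R] (fun u => (inv_sqr_cap (n%:R * s) u)%:E) by exact/measurable_EFinP.
    exact.
  - by move=> u _; rewrite lee_fin inv_sqr_cap_ge0.
  - by rewrite lee_fin ltW.
rewrite -EFinD lee_fin le_eqVlt; apply/orP; left; apply/eqP; field.
by rewrite !gt_eqF.
Qed.

End stable_tail.

(** * Gaussian smoothing and fresh randomness *)

Section gaussian_smoothing.
Context (R : realType).
Local Notation mu := (@lebesgue_measure R).
Local Notation phi := (normal_pdf (0 : R) 1).
Local Notation gauss := (normal_prob (0 : R) 1).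

Lemma gaussE (A : set R) : gauss A = (\int[mu]_(u in A) (phi u)%:E)%E.
Proof. by []. Qed.

Let iphi (A : set (measurableTypeR R)) : measurable A -> mu.-integrable A (EFin \o phi).
Proof.
move=> mA; apply: (integrableS measurableT) => //.
exact: integrable_normal_pdf.
Qed.

(** By the Lipschitz bound the density stays within [2 (b - a)] of its value at [c]. *)
Lemma gauss_itv_lin (a b c : R) : a <= b -> a <= c <= b ->
  `|fine (gauss `]a, b]) - (b - a) * phi c| <= 2 * (b - a) ^+ 2.
Proof.
move=> ab /andP[ac cb].
have mI : measurable (`]a, b]%classic : set (measurableTypeR R)) by exact: (@measurable_itv R).
have muI : mu `]a, b]%classic = (b - a)%:E.
  rewrite -[LHS]/(lebesgue_measure (`]a, b]%classic : set R)) lebesgue_measure_itv/= lte_fin.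
  by case: ltgtP ab => // -> _; rewrite subrr.
have icst (r : R) : mu.-integrable `]a, b] (EFin \o cst r).
  apply/integrableP; split.
    have : measurable_fun [set: R] (cst r%:E : R -> \bar R) by exact: measurable_cst.
    by move=> h; apply: measurable_funTS.
  rewrite /= integral_cst// -[X in (_ * X)%E]/(mu `]a, b]%classic) muI.
  by rewrite -EFinM ltry.
have cstE (r : R) : \int[mu]_(u in `]a, b]) r = r * (b - a).
  by rewrite Rintegral_cst// -[X in fine X]/(mu `]a, b]%classic) muI.
rewrite mulrC -cstE -[fine _]/(\int[mu]_(u in `]a, b]) phi u).
have iB : mu.-integrable `]a, b] (EFin \o (fun u => phi u - phi c)).
  by have := integrableB mI (iphi mI) (icst (phi c)); apply: eq_integrable.
rewrite -(RintegralB mI (iphi mI) (icst (phi c))).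
apply: le_trans (le_normr_Rintegral mI iB) _.
rewrite expr2 mulrA -cstE; apply: le_Rintegral => //.
- by have := integrable_norm iB; apply: eq_integrable.
- exact: icst.
move=> u; rewrite /= in_itv/= => /andP[au ub].
apply: le_trans (normal_pdf01_lipschitz _ _) _.
by rewrite ler_pM2l// ler_norml; apply/andP; split; lra.
Qed.

Lemma gauss_fin_num (A : set R) : measurable A -> gauss A \is a fin_num.
Proof. by move=> mA; exact: fin_num_measure. Qed.

Lemma gauss_split (a b : R) : a <= b ->
  fine (gauss `]a, +oo[) = fine (gauss `]a, b]) + fine (gauss `]b, +oo[).
Proof.
move=> ab; rewrite -fineD ?gauss_fin_num//; congr fine.
have -> : `]a, +oo[%classic = `]a, b]%classic `|` `]b, +oo[%classic.
  by rewrite -itv_bndbnd_setU// bnd_simp.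
rewrite [LHS](measureU (normal_prob (0 : R) 1))//.
apply/seteqP; split => // x [] /=; rewrite !in_itv/= andbT => /andP[_ xb].
by move=> /(le_lt_trans xb); rewrite ltxx.
Qed.

(** The chance that [x] plus [theta] times a standard Gaussian exceeds [t]. The Gaussian turns an
    indicator into an admissible test, with remainder constant [2 / theta^2]. *)
Definition gauss_upper (theta t x : R) : R :=
  fine (gauss `](t - x) / theta, +oo[).

Lemma gauss_upper_unit (theta t : R) : 0 < theta -> unit_valued (gauss_upper theta t).
Proof.
move=> theta0; split; last first.
  move=> x; rewrite /gauss_upper fine_ge0//= -[leRHS]/(fine 1%E).
  by apply: fine_le => //; rewrite ?gauss_fin_num//; exact: probability_le1.
apply: nondecreasing_measurable => // x y xy.
rewrite /gauss_upper fine_le ?gauss_fin_num//.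
apply: (le_measure (normal_prob (0 : R) 1)); rewrite ?inE//.
by apply: subset_itvr; rewrite bnd_simp ler_pM2r ?invr_gt0//; lra.
Qed.

Lemma gauss_upper_smooth (theta t : R) : 0 < theta ->
  smooth_test (2 / theta ^+ 2) (gauss_upper theta t).
Proof.
move=> theta0; split; first exact: gauss_upper_unit.
exists (fun x => phi ((t - x) / theta) / theta).
  apply: measurable_funM => //.
  apply: (measurableT_comp (measurable_normal_pdf _ _)).
  by apply: measurable_funM => //; exact: measurable_funB.
move=> x v; rewrite /gauss_upper.
set a := (t - x) / theta.
have aE : (t - (x + v)) / theta = a - v / theta by rewrite /a; field; rewrite gt_eqF.
have -> : v * (phi a / theta) = v / theta * phi a by field; rewrite gt_eqF.
have -> : 2 / theta ^+ 2 * v ^+ 2 = 2 * (v / theta) ^+ 2 by field; rewrite gt_eqF.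
rewrite aE; move: (v / theta) => u.
have [u0|u0] := leP 0 u.
  rewrite (@gauss_split (a - u) a); last by lra.
  have := @gauss_itv_lin (a - u) a a; rewrite (_ : a - (a - u) = u); last by ring.
  by rewrite addrK; apply; [lra|apply/andP; split; lra].
rewrite (@gauss_split a (a - u)); last by lra.
have := @gauss_itv_lin a (a - u) a; rewrite (_ : a - u - a = - u); last by ring.
rewrite sqrrN mulNr opprK => h.
rewrite opprD addrCA subrr addr0 -opprD normrN.
by apply: h; [lra|apply/andP; split; lra].
Qed.

Lemma gauss_opp (a : R) : gauss `]-oo, (- a)%R[ = gauss `]a, +oo[.
Proof.
rewrite !gaussE integral_mkcond [RHS]integral_mkcond.
have m1 : measurable_fun [set: R] ((fun u => (phi u)%:E) \_ `]a, +oo[%classic).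
  apply/(measurable_restrictT _ _).1 => //; apply/measurable_funTS/measurable_EFinP.
  exact: measurable_normal_pdf.
rewrite -[RHS](ge0_integral_opp m1) => [|u].
- apply: eq_integral => u _; rewrite !patchE normal_pdf01_even.
  congr (if _ then _ else _); apply/idP/idP.
    by rewrite !inE/= !in_itv/= andbT ltrNr.
  by rewrite !inE/= !in_itv/= andbT ltrNr.
- by rewrite erestrict_ge0// => y _; rewrite lee_fin normal_pdf_ge0.
Qed.

End gaussian_smoothing.

Section fresh.
Context (R : realType) (d q : nat) (disp : measure_display)
  (T : measurableType disp) (disp' : measure_display)
  (Xi : measurableType disp') (P : probability T R) (law : probability Xi R)
  (xi : nat -> T -> Xi) (eta : nat -> 'I_q -> T -> 'rV[R]_d).
Hypothesis fr : fresh_randomness P law xi eta.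

Local Notation F := (events_of xi eta).
Local Notation I := (nat + nat * 'I_q * 'I_d)%type.

Lemma events_of_setT i : F i setT.
Proof. by case: i => [t|[[k j] l]]; exists setT => //; rewrite setTI preimage_setT. Qed.

Lemma events_of_setI i : setI_closed (F i).
Proof.
by case: i => [t|[[k j] l]] _ _ [A mA <-] [B mB <-]; exists (A `&` B);
  rewrite ?setTI ?preimage_setI//; exact: measurableI.
Qed.

Lemma events_of_measurable i : F i `<=` measurable.
Proof.
case: fr => m1 _ m2 _ _.
by case: i => [t|[[k j] l]] _ [A mA <-]; [exact: m1|exact: m2].
Qed.

Let indF : mutually_independent P F. Proof. by case: fr. Qed.

(* [T] with the sigma-algebra of the random inputs in [D] only: measurability
   on it expresses that a quantity depends on no other input. *)
Definition generated_type (D : set I) : measurableType _ :=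
  g_sigma_algebraType (finite_meets F D).

Lemma generated_measurable (D : set I) (d1 : measure_display) (T1 : measurableType d1)
  (X : T -> T1) : measurable_fun setT (X : generated_type D -> T1) -> measurable_fun setT X.
Proof.
move=> mX _ A mA; have := mX measurableT A mA.
exact: (sub_sigma_measurable events_of_measurable).
Qed.

Lemma measurable_seed (D : set I) t : D (inl t) ->
  measurable_fun setT (xi t : generated_type D -> Xi).
Proof.
move=> Dt _ A mA; apply: sub_sigma_algebra; apply: (@finite_meets_gen _ _ _ F D (inl t)) => //.
by exists A.
Qed.

Lemma measurable_gauss (D : set I) k j l : D (inr (k, j, l)) ->
  measurable_fun setT ((fun w => eta k j w 0 l) : generated_type D -> R).
Proof.
move=> Dt _ A mA; apply: sub_sigma_algebra; apply: (@finite_meets_gen _ _ _ F D (inr (k, j, l))) => //.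
by exists A.
Qed.

Lemma fresh_decoupling (D1 D2 : set I) (d1 d2 : measure_display)
  (T1 : measurableType d1) (T2 : measurableType d2) (X1 : T -> T1) (X2 : T -> T2)
  (f : T1 * T2 -> \bar R) : D1 `&` D2 = set0 ->
  measurable_fun setT (X1 : generated_type D1 -> T1) ->
  measurable_fun setT (X2 : generated_type D2 -> T2) ->
  measurable_fun setT f -> (forall z, 0 <= f z)%E ->
  (\int[P]_w f (X1 w, X2 w) = \int[P]_w \int[P]_w' f (X1 w, X2 w'))%E.
Proof.
move=> D12 m1 m2 mf f0.
apply: decoupling => //; [exact: (generated_measurable m1)|exact: (generated_measurable m2)|].
move=> A B mA mB.
apply: (sigma_indep events_of_setT events_of_setI events_of_measurable indF D12).
  by have := m1 measurableT A mA; rewrite setTI.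
by have := m2 measurableT B mB; rewrite setTI.
Qed.

Lemma integral_seed t (f : Xi -> \bar R) : measurable_fun setT f ->
  (forall z, 0 <= f z)%E -> (\int[P]_w f (xi t w) = \int[law]_z f z)%E.
Proof.
move=> mf f0; case: fr => m1 e1 _ _ _.
pose Y : {mfun T >-> Xi} := HB.pack (xi t) (isMeasurableFun.Build _ _ _ _ _ (m1 t)).
transitivity (\int[distribution P Y]_z f z)%E.
  by rewrite ge0_integral_distribution.
by apply: eq_measure_integral => A mA _; exact: e1.
Qed.

Section seeds.
Variable Y : Xi -> R.
Hypothesis mY : measurable_fun setT Y.

Definition seed_sum t0 k w := \sum_(i < k) Y (xi (t0 + i) w).

Lemma seed_sum_measurable (D : set I) t0 k :
  (forall i, (i < k)%N -> D (inl (t0 + i)%N)) ->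
  measurable_fun setT (seed_sum t0 k : generated_type D -> R).
Proof.
move=> hD; apply: measurable_sum => i.
by apply: (measurableT_comp mY); apply: measurable_seed; apply: hD.
Qed.

Lemma seed_sum_measurableT t0 k : measurable_fun setT (seed_sum t0 k).
Proof. by apply: (@generated_measurable setT); apply: seed_sum_measurable. Qed.

(** By independence the last seed can be integrated first, against its own law. The expectation over
    [T] becomes an iterated average under [law], the form in which variables are swapped one at a
    time. *)
Lemma seed_sum_mean t0 k (h : R -> R) x : unit_valued h ->
  \int[P]_w h (x + seed_sum t0 k w) = iter k (shift_mean law Y) h x.
Proof.
elim: k h => [|k IH] h hU.
  have -> : (fun w => h (x + seed_sum t0 0 w)) = cst (h x).
    by apply/funext => w; rewrite /seed_sum big_ord0 addr0.
  by rewrite Rintegral_cst_prob.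
have [mh h01] := hU.
have hN y : `|h y| <= 1 by exact: unit_norm.
rewrite iterSr -IH; last exact: unit_shift.
apply: EFin_inj.
have msx k' : measurable_fun setT (fun w => x + seed_sum t0 k' w).
  by apply: measurable_funD => //; exact: seed_sum_measurableT.
rewrite -(@EFin_Rintegral _ _ _ P _ 1)//; last exact: (measurableT_comp mh).
have [msh sh01] := unit_shift law mY hU.
rewrite -(@EFin_Rintegral _ _ _ P _ 1)//; last 2 first.
- by apply: (measurableT_comp msh).
- by move=> w; apply: unit_norm; exact: unit_shift.
pose f (z : R * Xi) := (h (x + z.1 + Y z.2))%:E.
have mf : measurable_fun setT f.
  apply/measurable_EFinP; apply: (measurableT_comp mh).
  apply: measurable_funD; last exact: measurableT_comp.
  exact: measurable_funD.
transitivity (\int[P]_w f (seed_sum t0 k w, xi (t0 + k) w))%E.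
  by apply: eq_integral => w _; rewrite /f /= /seed_sum big_ord_recr /= addrA.
rewrite (@fresh_decoupling [set i | exists2 j, (j < k)%N & i = inl (t0 + j)%N]
  [set inl (t0 + k)%N] _ _ R Xi (seed_sum t0 k) (xi (t0 + k)))//.
- apply: eq_integral => w _.
  rewrite (@integral_seed _ (fun z => f (seed_sum t0 k w, z)))//.
  + rewrite (@EFin_Rintegral _ _ _ law _ 1)//.
    by rewrite /=; apply: (measurableT_comp mh); apply: measurable_funD.
  + exact: measurableT_comp.
  + by move=> z; rewrite lee_fin; have /andP[] := h01 (x + seed_sum t0 k w + Y z).
- apply/seteqP; split => // i [[j jk ->] [] /= /addnI jE].
  by rewrite jE ltnn in jk.
- by apply: seed_sum_measurable => i ik; exists i.
- by apply: measurable_seed.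
- by move=> z; rewrite lee_fin; have /andP[] := h01 (x + z.1 + Y z.2).
Qed.

End seeds.

End fresh.

Lemma measurable_gt_set (R : realType) (disp : measure_display) (T : measurableType disp)
  (X : T -> R) (t : R) : measurable_fun setT X -> measurable [set w | t < X w].
Proof. by move=> mX; rewrite -preimage_itvoy -[_ @^-1` _]setTI; exact: mX. Qed.

Lemma measurable_lt_set (R : realType) (disp : measure_display) (T : measurableType disp)
  (X : T -> R) (t : R) : measurable_fun setT X -> measurable [set w | X w < t].
Proof. by move=> mX; rewrite -preimage_itvNyo -[_ @^-1` _]setTI; exact: mX. Qed.

Lemma prob_integral_indic (R : realType) (disp : measure_display)
  (T : measurableType disp) (P : probability T R) (A : set T) : measurable A ->
  P A = (\int[P]_w (\1_A w)%:E)%E.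
Proof. by move=> mA; rewrite integral_indic// setIT. Qed.

Lemma ler_dist_via (R : realDomainType) (x y z e : R) :
  `|x - z| <= e -> `|y - z| <= e -> `|x - y| <= e + e.
Proof.
by move=> xz yz; apply: le_trans (ler_distD z _ _) _; rewrite [`|z - y|]distrC lerD.
Qed.

(** * Symmetry and tails of one smoothed block *)

Section block.
Context (R : realType) (d q : nat) (disp : measure_display)
  (T : measurableType disp) (disp' : measure_display)
  (Xi : measurableType disp') (P : probability T R) (law : probability Xi R)
  (xi : nat -> T -> Xi) (eta : nat -> 'I_q -> T -> 'rV[R]_d).
Hypothesis fr : fresh_randomness P law xi eta.
Variables (nu : Xi -> R) (p : R -> R) (M B beta theta : R) (n : nat).
Hypothesis mnu : measurable_fun setT nu.
Hypothesis pnu : is_density law nu p.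
Local Notation mu := (@lebesgue_measure R).
Local Notation gauss := (normal_prob (0 : R) 1).
Hypotheses (M0 : 0 < M) (B0 : 0 < B) (beta1 : 1 <= beta) (n0 : (0 < n)%N).
Hypotheses (theta0 : 0 < theta) (Mn : M <= n%:R * theta ^+ 2).
Hypothesis odd1 : (\int[mu]_u (u * odd_part p u)%:E = 0)%E.
Hypothesis odd2 : (\int[mu]_u (u ^+ 2 * `|odd_part p u|)%:E <= M%:E)%E.
Hypothesis sn : forall u : R, (convolution_pow (EFin \o even_part p) n u <=
  (B * n%:R / (n%:R `^ ((beta + 1) / beta) + `|u| `^ (1 + beta)))%:E)%E.
Variables (t0 k : nat) (b : 'I_q) (l : 'I_d).

Let Y z := n%:R^-1 * nu z.
Let S := seed_sum xi Y t0 n.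
Let e w : R := eta k b w 0 l.

Definition noise_block w := S w + theta * e w.

Let nr0 : 0 < n%:R :> R. Proof. by rewrite ltr0n. Qed.

Let mY : measurable_fun setT Y.
Proof. exact: measurable_funM. Qed.

Let mS : measurable_fun setT S.
Proof. exact: (seed_sum_measurableT fr mY). Qed.

Let me : measurable_fun setT e.
Proof. by case: fr => _ _ h _ _; exact: h. Qed.

Let gaussE (A : set R) : measurable A -> P (e @^-1` A) = gauss A.
Proof. by move=> mA; case: fr => _ _ _ + _; apply. Qed.

Definition block_index : set (nat + nat * 'I_q * 'I_d) :=
  [set i | (exists2 j, (j < n)%N & i = inl (t0 + j)%N) \/ i = inr (k, b, l)].

Lemma noise_block_measurable (D : set (nat + nat * 'I_q * 'I_d)) : block_index `<=` D ->
  measurable_fun setT (noise_block : generated_type xi eta D -> R).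
Proof.
move=> hD; apply: measurable_funD.
  by apply: seed_sum_measurable => // i ik; apply: hD; left; exists i.
apply: measurable_funM => //.
by apply: (@measurable_gauss _ _ _ _ _ _ _ xi eta D k b l); apply: hD; right.
Qed.

Lemma noise_block_measurableT : measurable_fun setT noise_block.
Proof. by apply: measurable_funD => //; apply: measurable_funM. Qed.

Lemma smoothed_event (A : set R) : measurable A ->
  (P (noise_block @^-1` A) = \int[P]_w gauss ((fun u => S w + theta * u)%R @^-1` A))%E.
Proof.
move=> mA.
pose g (z : R * R) := z.1 + theta * z.2.
have mg : measurable_fun setT g.
  by apply: measurable_funD => //; apply: measurable_funM.
have mgA : measurable (g @^-1` A) by rewrite -[_ @^-1` _]setTI; exact: mg.
pose f (z : R * R) : \bar R := (\1_(g @^-1` A) z)%:E.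
have mUA : measurable (noise_block @^-1` A).
  by rewrite -[_ @^-1` _]setTI; exact: noise_block_measurableT.
transitivity (\int[P]_w f (S w, e w))%E.
  by rewrite prob_integral_indic.
rewrite (fresh_decoupling fr (D1 := [set i | exists2 j, (j < n)%N & i = inl (t0 + j)%N])
  (D2 := [set inr (k, b, l)]))//.
- apply: eq_integral => w _.
  have mB : measurable ((fun u => S w + theta * u) @^-1` A).
    rewrite -[_ @^-1` _]setTI; have : measurable_fun setT (fun u : R => S w + theta * u).
      by apply: measurable_funD => //; apply: measurable_funM.
    exact.
  rewrite -gaussE// prob_integral_indic//.
  by rewrite -[_ @^-1` _]setTI; exact: me.
- by apply/seteqP; split => // i [[j jk ->] [] /=].
- by apply: seed_sum_measurable => // i ik; exists i.
- by apply: measurable_gauss.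
- by apply/measurable_EFinP.
- by move=> z; rewrite lee_fin.
Qed.

Lemma upper_event (t : R) :
  fine (P [set w | t < noise_block w]) = \int[P]_w gauss_upper theta t (S w).
Proof.
have -> : [set w | t < noise_block w] = noise_block @^-1` `]t, +oo[.
  by apply/seteqP; split => w /=; rewrite in_itv/= andbT.
rewrite smoothed_event//; congr fine; apply: eq_integral => w _.
rewrite /gauss_upper fineK ?gauss_fin_num//; congr (gauss _).
apply/seteqP; split => u /=; rewrite !in_itv/= !andbT ltr_pdivrMr// ltrBlDl;
  by rewrite mulrC.
Qed.

Lemma lower_event (t : R) :
  fine (P [set w | noise_block w < - t]) = \int[P]_w gauss_upper theta t (- S w).
Proof.
have -> : [set w | noise_block w < - t] = noise_block @^-1` `]-oo, - t[.
  by apply/seteqP; split => w /=; rewrite in_itv/=.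
rewrite smoothed_event//; congr fine; apply: eq_integral => w _.
rewrite /gauss_upper fineK ?gauss_fin_num// -gauss_opp; congr (gauss _).
have -> : - ((t - - S w) / theta) = (- t - S w) / theta by rewrite opprK -mulNr opprD.
apply/seteqP; split => u /=; rewrite !in_itv/= ltr_pdivlMr// ltrBrDl;
  by rewrite mulrC.
Qed.

(** The two tails are the means of [gauss_upper] and of its reflection, which share one symmetrized
    value at 0. Each differs from it by the cost of [n] swaps, [n * (2 / theta^2) * n^-2 * M]. *)
Lemma block_symmetry (t : R) :
  `|fine (P [set w | t < noise_block w]) - fine (P [set w | noise_block w < - t])| <=
  4 * (M / (n%:R * theta ^+ 2)).
Proof.
have gs := gauss_upper_smooth t theta0; have gU := gauss_upper_unit t theta0.
pose h x := gauss_upper theta t (- x).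
have hs : smooth_test (2 / theta ^+ 2) h.
  have [_ [g' mg' gq]] := gs; have [mg g01] := gU; split.
    by split => [|x]; [exact: measurableT_comp|exact: g01].
  exists (fun x => - g' (- x)).
    by apply: measurable_funN; exact: measurableT_comp.
  move=> x v; have := gq (- x) (- v).
  by rewrite /h opprD sqrrN mulNr mulrN.
have H0 : 0 <= 2 / theta ^+ 2 by rewrite divr_ge0// sqr_ge0.
have l1 := lindeberg_scaled n%:R^-1 mnu pnu odd1 odd2 n 0 H0 gs.
have l2 := lindeberg_scaled n%:R^-1 mnu pnu odd1 odd2 n 0 H0 hs.
have hU : unit_valued h by case: hs.
have E1 := seed_sum_mean fr mY t0 n 0 gU.
have E2 := seed_sum_mean fr mY t0 n 0 hU.
rewrite -/Y in l1 l2; rewrite -E1 in l1; rewrite -E2 in l2.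
rewrite iter_sym_mean_flip oppr0 in l2.
rewrite upper_event lower_event.
have F1 : \int[P]_w gauss_upper theta t (0 + S w) = \int[P]_w gauss_upper theta t (S w).
  by apply: eq_Rintegral => w _; rewrite add0r.
have F2 : \int[P]_w h (0 + S w) = \int[P]_w gauss_upper theta t (- S w).
  by apply: eq_Rintegral => w _; rewrite add0r.
rewrite -/S F1 in l1; rewrite -/S F2 in l2.
have -> : 4 * (M / (n%:R * theta ^+ 2)) = n%:R * (2 / theta ^+ 2 * n%:R^-1 ^+ 2 * M)
    + n%:R * (2 / theta ^+ 2 * n%:R^-1 ^+ 2 * M).
  by field; rewrite !gt_eqF.
exact: ler_dist_via l1 l2.
Qed.

(** For [t <= theta] the right side exceeds 1. Otherwise the sum exceeds [t / 2] or the Gaussian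
    exceeds [t / (2 theta)]. The swapping error [16 M / (n t^2)] is at most [16 theta / t], by
    [M <= n theta^2] and [theta < t]; with [8 theta / t] from the Gaussian this makes [24], and
    [tau] only needs [20]. *)
Lemma block_tail (t : R) : 0 < t ->
  fine (P [set w | t < `|noise_block w|]) <= 24 * ((tail_scale B beta n + theta) / t).
Proof.
move=> t_gt0; have tau0 := tail_scale_gt0 beta B0 n0.
have mabs (X : T -> R) (c : R) : measurable_fun setT X -> measurable [set w | c < `|X w|].
  move=> mX.
  have -> : [set w | c < `|X w|] = (fun w => `|X w|) @^-1` `]c, +oo[.
    by apply/seteqP; split => w /=; rewrite in_itv/= andbT.
  rewrite -[_ @^-1` _]setTI.
  exact: (measurableT_comp (@normr_measurable _ _) mX measurableT (measurable_itv _)).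
have [tth|tth] := leP t theta.
  apply: (@le_trans _ _ 1).
    rewrite -[leRHS]/(fine 1%E); apply: fine_le => //.
      by rewrite fin_num_measure//; apply: mabs; exact: noise_block_measurableT.
    by apply: probability_le1; apply: mabs; exact: noise_block_measurableT.
  rewrite mulrA ler_pdivlMr//; lra.
have s0 : 0 < t / 2 by rewrite divr_gt0.
have msum := mabs S (t / 2) mS.
have me' := mabs e (t / (2 * theta)) me.
have PS : fine (P [set w | t / 2 < `|S w|]) <= 2 * (5 * tail_scale B beta n / (t / 2)
    + n%:R * (2 / (t / 2) ^+ 2 * n%:R^-1 ^+ 2 * M)).
  have [hU _] := tail_test_smooth s0.
  have H0 : 0 <= 2 / (t / 2) ^+ 2 by rewrite divr_ge0// sqr_ge0.
  have l1 := lindeberg_scaled n%:R^-1 mnu pnu odd1 odd2 n 0 H0 (tail_test_smooth s0).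
  have l2 := sym_tail_test mnu pnu B0 beta1 n0 sn s0.
  have E1 := seed_sum_mean fr mY t0 n 0 hU.
  rewrite -/Y in l1; rewrite -E1 in l1.
  apply: (@le_trans _ _ (2 * \int[P]_w tail_test (t / 2) (0 + seed_sum xi Y t0 n w))); last first.
    rewrite ler_pM2l//; have := le_trans (ler_norm _) l1; rewrite lerBlDr => /le_trans; apply.
    by rewrite [leRHS]addrC lerD2l.
  have [mt t01] := hU.
  have mtS : measurable_fun setT (fun w => tail_test (t / 2) (0 + seed_sum xi Y t0 n w)).
    by apply: (measurableT_comp mt); apply: measurable_funD.
  rewrite -lee_fin fineK ?fin_num_measure// EFinM -(@EFin_Rintegral _ _ _ P _ 1)//; last first.
    by move=> w; exact: unit_norm.
  rewrite -ge0_integralZl//; last 2 first.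
  - exact/measurable_EFinP.
  - by move=> w _; rewrite lee_fin; have /andP[] := t01 (0 + seed_sum xi Y t0 n w).
  rewrite prob_integral_indic//; apply: ge0_le_integral => //.
  - by apply/measurable_EFinP; exact: measurable_indic.
  - by apply: measurable_funeM; exact/measurable_EFinP.
  - move=> w _; rewrite -EFinM lee_fin indicE add0r.
    have [|_] := boolP (w \in _); last first.
      by rewrite mulr_ge0//; have /andP[] := t01 (seed_sum xi Y t0 n w).
    rewrite inE /= => h; have := tail_test_ge s0 (ltW h); rewrite /S; lra.
have Pe : fine (P [set w | t / (2 * theta) < `|e w|]) <= 8 * (theta / t).
  have a0 : 0 < t / (2 * theta) by rewrite divr_gt0// mulr_gt0.
  rewrite -lee_fin fineK ?fin_num_measure//.
  set a := t / (2 * theta) in a0 me' *.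
  have -> : [set w | a < `|e w|] = e @^-1` `]a, +oo[ `|` e @^-1` `]-oo, - a[.
    apply/seteqP; split => w /=; rewrite !in_itv/= andbT.
      by rewrite ltr_normr => /orP[|]; [left|rewrite ltrNr; right].
    by rewrite ltr_normr ltrNr => -[->|->]; rewrite ?orbT.
  have mA1 : measurable (e @^-1` `]a, +oo[) by rewrite -[_ @^-1` _]setTI; exact: me.
  have mA2 : measurable (e @^-1` `]-oo, - a[) by rewrite -[_ @^-1` _]setTI; exact: me.
  apply: (@le_trans _ _ (P (e @^-1` `]a, +oo[) + P (e @^-1` `]-oo, (- a)%R[))%E).
    exact: measureU2.
  rewrite !gaussE// gauss_opp.
  have -> : 8 * (theta / t) = 2 / a + 2 / a by rewrite /a; field; rewrite !gt_eqF.
  by rewrite EFinD leeD//; exact: normal_tail.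
have sub : [set w | t < `|noise_block w|] `<=`
    [set w | t / 2 < `|S w|] `|` [set w | t / (2 * theta) < `|e w|].
  move=> w /= h; have [hS|hS] := ltP (t / 2) `|S w|; [by left|right].
  have : `|noise_block w| <= `|S w| + theta * `|e w|.
    by apply: le_trans (ler_normD _ _) _; rewrite normrM gtr0_norm.
  move=> h2; rewrite ltr_pdivrMr ?mulr_gt0//; lra.
have mU := mabs noise_block t noise_block_measurableT.
apply: (@le_trans _ _ (fine (P [set w | t / 2 < `|S w|]) + fine (P [set w | t / (2 * theta) < `|e w|]))).
  rewrite -fineD ?fin_num_measure//; apply: fine_le.
  - exact: fin_num_measure.
  - by rewrite fin_numD !fin_num_measure.
  apply: (le_trans (le_measure P _ _ sub)); rewrite ?inE//; first exact: measurableU.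
  exact: measureU2.
apply: (le_trans (lerD PS Pe)).
have -> : 2 * (5 * tail_scale B beta n / (t / 2) + n%:R * (2 / (t / 2) ^+ 2 * n%:R^-1 ^+ 2 * M))
   = 20 * (tail_scale B beta n / t) + 16 * (M / n%:R / t / t).
  by field; rewrite !gt_eqF.
have : M / n%:R / t / t <= theta / t.
  rewrite ler_pM2r ?invr_gt0// ler_pdivrMr// ler_pdivrMr//.
  apply: le_trans Mn _; rewrite mulrC expr2 ler_pM2r// ler_pM2l//; exact: ltW.
have := divr_gt0 tau0 t_gt0; rewrite [X in 24 * X]mulrDl; lra.
Qed.

End block.

(** * Medians and binomial tails *)

Section median_counts.
Context (R : realType).

(** In the sorted list the median sits at position [m], so it exceeds [t] exactly when the [m + 1]
    entries from there on do. *)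
Lemma median_gt (m : nat) (s : seq R) (t : R) : size s = m.*2.+1 ->
  (t < median s) = (m < count (fun x => (t < x)%R) s)%N.
Proof.
move=> hs; rewrite /median hs /= uphalf_double.
set s' := sort _ s.
have ps : perm_eq s' s by rewrite perm_sort.
have ss : size s' = m.*2.+1 by rewrite size_sort.
have so : sorted <=%R s' by exact: sort_le_sorted.
rewrite -(permP ps).
have mono i j : (i <= j < size s')%N -> nth 0 s' i <= nth 0 s' j.
  by move=> /andP[ij js]; apply: (sorted_leq_nth le_trans le_refl) => //; rewrite inE ?(leq_ltn_trans ij).
have ms : (m < size s')%N by rewrite ss ltnS -addnn leq_addr.
apply/idP/idP => [h|].
  have : (size (drop m s') <= count (fun x => (t < x)%R) s')%N.
    rewrite -{2}(cat_take_drop m s') count_cat; apply: leq_trans (leq_addl _ _).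
    rewrite leq_eqVlt eq_sym -all_count; apply/orP; left; apply/(all_nthP 0) => i; rewrite size_drop => hi.
    rewrite nth_drop; apply: lt_le_trans h _; apply: mono.
    by rewrite leq_addr/= -ltn_subRL.
  by apply: leq_trans; rewrite size_drop ss subSn ?ltnS -addnn ?addnK ?leq_addr.
apply: contraTT; rewrite -leNgt -leqNgt => h.
rewrite -(cat_take_drop m.+1 s') count_cat.
have -> : count (fun x => (t < x)%R) (take m.+1 s') = 0%N.
  apply/eqP; rewrite eqn0Ngt -has_count -all_predC; apply/(all_nthP 0) => i.
  rewrite size_takel// => hi; rewrite nth_take//= -leNgt; apply: le_trans h; apply: mono.
  by rewrite -ltnS hi.
rewrite add0n; apply: leq_trans (count_size _ _) _.
by rewrite size_drop ss subSS -addnn addnK.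
Qed.

Lemma median_lt (m : nat) (s : seq R) (t : R) : size s = m.*2.+1 ->
  (median s < t) = (m < count (fun x => (x < t)%R) s)%N.
Proof.
move=> hs; rewrite /median hs /= uphalf_double.
set s' := sort _ s.
have ps : perm_eq s' s by rewrite perm_sort.
have ss : size s' = m.*2.+1 by rewrite size_sort.
have so : sorted <=%R s' by exact: sort_le_sorted.
rewrite -(permP ps).
have mono i j : (i <= j < size s')%N -> nth 0 s' i <= nth 0 s' j.
  by move=> /andP[ij js]; apply: (sorted_leq_nth le_trans le_refl) => //; rewrite inE ?(leq_ltn_trans ij).
have ms : (m < size s')%N by rewrite ss ltnS -addnn leq_addr.
apply/idP/idP => [h|].
  have : (size (take m.+1 s') <= count (fun x => (x < t)%R) s')%N.
    rewrite -{2}(cat_take_drop m.+1 s') count_cat; apply: leq_trans (leq_addr _ _).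
    rewrite leq_eqVlt eq_sym -all_count; apply/orP; left; apply/(all_nthP 0) => i; rewrite size_takel// => hi.
    rewrite nth_take//; apply: le_lt_trans h; apply: mono.
    by rewrite -ltnS hi.
  by rewrite size_takel.
apply: contraTT; rewrite -leNgt -leqNgt => h.
rewrite -(cat_take_drop m s') count_cat.
have -> : count (fun x => (x < t)%R) (drop m s') = 0%N.
  apply/eqP; rewrite eqn0Ngt -has_count -all_predC; apply/(all_nthP 0) => i.
  rewrite size_drop => hi; rewrite nth_drop /= -leNgt; apply: le_trans h _; apply: mono.
  by rewrite leq_addr/= -ltn_subRL.
by rewrite addn0; apply: leq_trans (count_size _ _) _; rewrite size_takel// ltnW.
Qed.

End median_counts.

Section binomial_tail.
Context (R : realType).
Implicit Types x y r : R.

(** The probability that more than [m] of [q] independent events of probability [x] occur. The sum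
    runs over the sets of occurring events instead of their sizes, which is the shape of the
    decomposition into atoms. *)
Definition majority (q m : nat) (x : R) : R :=
  \sum_(J : {set 'I_q} | (m < #|J|)%N) x ^+ #|J| * (1 - x) ^+ (q - #|J|).

Lemma majority_le (q m : nat) x r : 0 <= x <= 1 -> x <= r -> r <= 1 ->
  majority q m x <= 2 ^+ q * r ^+ m.+1.
Proof.
move=> /andP[x0 x1] xr r1; have r0 : 0 <= r by exact: le_trans xr.
apply: (@le_trans _ _ (\sum_(J : {set 'I_q} | (m < #|J|)%N) r ^+ m.+1)).
  apply: ler_sum => J hJ; rewrite -[leRHS]mulr1; apply: ler_pM.
  - by rewrite exprn_ge0.
  - by rewrite exprn_ge0// subr_ge0.
  - apply: (@le_trans _ _ (r ^+ #|J|)); first exact: lerXn2r.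
    by rewrite ler_wiXn2l.
  - by apply: exprn_ile1; lra.
apply: (@le_trans _ _ (\sum_(J : {set 'I_q}) r ^+ m.+1)).
  by rewrite [leRHS](bigID (fun J : {set 'I_q} => (m < #|J|)%N))/= lerDl sumr_ge0// => J _; rewrite exprn_ge0.
by rewrite sumr_const -cardsT -powersetT card_powerset cardsT card_ord -[leLHS]mulr_natl natrX.
Qed.

Lemma exprn_lipschitz (a : nat) x y r : 0 <= x <= r -> 0 <= y <= r -> r <= 1 ->
  `|x ^+ a.+1 - y ^+ a.+1| <= a.+1%:R * r ^+ a * `|x - y|.
Proof.
move=> /andP[x0 xr] /andP[y0 yr] r1; elim: a => [|a IH].
  by rewrite !expr1 expr0 !mul1r.
have r0 : 0 <= r by exact: le_trans xr.
have -> : x ^+ a.+2 - y ^+ a.+2 = x * (x ^+ a.+1 - y ^+ a.+1) + (x - y) * y ^+ a.+1.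
  by rewrite !(exprS _ a.+1); ring.
apply: le_trans (ler_normD _ _) _; rewrite !normrM (ger0_norm x0).
have -> : a.+2%:R * r ^+ a.+1 * `|x - y| = r * (a.+1%:R * r ^+ a * `|x - y|) + `|x - y| * r ^+ a.+1.
  by rewrite -natr1 exprS; ring.
apply: lerD; first by apply: ler_pM.
rewrite ler_wpM2l// ger0_norm ?exprn_ge0// ler_pXn2r// nnegrE//.
Qed.

(** Each term contains a power of [x] of order at least [m + 1], so its increment keeps a factor
    [r^m]; there are at most [2^q] terms. *)
Lemma majority_lipschitz (q m : nat) x y r : 0 <= x <= r -> 0 <= y <= r -> r <= 1 ->
  `|majority q m x - majority q m y| <= 2 ^+ q * (q%:R * r ^+ m * `|x - y|).
Proof.
move=> hx hy r1; have [/andP[x0 xr] /andP[y0 yr]] := (hx, hy).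
have r0 : 0 <= r by exact: le_trans xr.
have B0 : 0 <= q%:R * r ^+ m * `|x - y| by rewrite !mulr_ge0// exprn_ge0.
rewrite /majority -sumrB.
apply: le_trans (ler_norm_sum _ _ _) _.
apply: (@le_trans _ _ (\sum_(J : {set 'I_q} | (m < #|J|)%N) (q%:R * r ^+ m * `|x - y|))); last first.
  apply: (@le_trans _ _ (\sum_(J : {set 'I_q}) (q%:R * r ^+ m * `|x - y|))).
    by rewrite [leRHS](bigID (fun J : {set 'I_q} => (m < #|J|)%N))/= lerDl sumr_ge0.
  by rewrite sumr_const -cardsT -powersetT card_powerset cardsT card_ord -[leLHS]mulr_natl natrX.
apply: ler_sum => J hJ.
have Jq : (#|J| <= q)%N by rewrite -[leqRHS]card_ord max_card.
case E : #|J| hJ Jq => [//|a] hJ Jq.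
have -> : x ^+ a.+1 * (1 - x) ^+ (q - a.+1) - y ^+ a.+1 * (1 - y) ^+ (q - a.+1) =
   (x ^+ a.+1 - y ^+ a.+1) * (1 - x) ^+ (q - a.+1)
   + y ^+ a.+1 * ((1 - x) ^+ (q - a.+1) - (1 - y) ^+ (q - a.+1)) by ring.
have h1 : `|x ^+ a.+1 - y ^+ a.+1| <= a.+1%:R * r ^+ m * `|x - y|.
  apply: le_trans (exprn_lipschitz a hx hy r1) _.
  by rewrite ler_wpM2r// ler_wpM2l// ler_wiXn2l.
have h2 : `|(1 - x) ^+ (q - a.+1) - (1 - y) ^+ (q - a.+1)| <= (q - a.+1)%:R * `|x - y|.
  case: (q - a.+1)%N => [|b]; first by rewrite !expr0 subrr normr0 mul0r.
  have := @exprn_lipschitz b (1 - x) (1 - y) 1.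
  rewrite expr1n mulr1 (_ : 1 - x - (1 - y) = y - x); last by ring.
  by rewrite (distrC y); apply; [apply/andP; split; lra|apply/andP; split; lra|].
apply: le_trans (ler_normD _ _) _.
have -> : q%:R * r ^+ m * `|x - y| = a.+1%:R * r ^+ m * `|x - y| * 1 + r ^+ m * ((q - a.+1)%:R * `|x - y|).
  by rewrite -{1}(subnK Jq) natrD; ring.
apply: lerD; rewrite normrM; apply: ler_pM => //.
- by rewrite ger0_norm ?exprn_ge0 ?exprn_ile1//; lra.
- rewrite ger0_norm ?exprn_ge0//; apply: (@le_trans _ _ (r ^+ a.+1)).
    by rewrite ler_pXn2r// nnegrE.
  by rewrite ler_wiXn2l// ltnW.
Qed.

End binomial_tail.

Definition hits (T : Type) (q : nat) (E : 'I_q -> set T) (w : T) : {set 'I_q} :=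
  [set j | w \in E j]%SET.

Lemma in_hits (T : Type) (q : nat) (E : 'I_q -> set T) (w : T) j :
  (j \in hits E w) = (w \in E j).
Proof. by rewrite /hits finset.inE. Qed.

Section median_event.
Context (R : realType) (disp : measure_display) (T : measurableType disp).

Lemma measurable_fun_gt (X : T -> R) : (forall t, measurable [set w | t < X w]) ->
  measurable_fun setT X.
Proof.
move=> h; apply: (measurability _ (RGenOInfty.measurableE R)) => _ [_ [t ->] <-].
by rewrite setTI preimage_itvoy.
Qed.

Lemma count_sum_indic (q : nat) (E : 'I_q -> set T) w :
  (#|hits E w|%:R : R) = \sum_j \1_(E j) w.
Proof.
rewrite -sum1_card natr_sum big_mkcond/=; apply: eq_bigr => j _; rewrite /hits.
by rewrite inE indicE; case: (w \in E j).
Qed.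

Lemma measurable_count (q m : nat) (E : 'I_q -> set T) : (forall j, measurable (E j)) ->
  measurable [set w | (m < #|hits E w|)%N].
Proof.
move=> mE.
have mS : measurable_fun setT (fun w => \sum_j \1_(E j) w : R).
  by apply: measurable_sum => j; exact: measurable_indic.
rewrite (_ : [set w | _] = (fun w => \sum_j \1_(E j) w : R) @^-1` `]m%:R, +oo[).
  by rewrite -[_ @^-1` _]setTI; exact: mS.
by apply/seteqP; split => w /=; rewrite in_itv/= andbT -count_sum_indic ltr_nat.
Qed.

Lemma count_set (q : nat) (F : 'I_q -> R) (a : pred R) :
  count a [seq F j | j <- enum 'I_q] = #|[set j | a (F j)]%SET|.
Proof. rewrite count_map -size_filter cardE; congr size.
by rewrite enumT [RHS]/(enum _) -enumT /enum_mem; apply: eq_filter => j; rewrite !inE. Qed.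

Variables (m : nat) (F : 'I_(m.*2.+1) -> T -> R).
Let med w := median [seq F j w | j <- enum 'I_(m.*2.+1)].

Lemma median_gt_event t :
  [set w | t < med w] = [set w | (m < #|hits (fun j => [set w | (t < F j w)%R]) w|)%N].
Proof.
have sz w : size [seq F j w | j <- enum 'I_(m.*2.+1)] = m.*2.+1 by rewrite size_map size_enum_ord.
apply/funext => w /=; apply/propext; rewrite /med (median_gt _ (sz w)) (count_set (F ^~ w)).
set X := hits _ w; set Y := finset _; suff -> : #|Y| = #|X| by [].
by apply: eq_card => j; rewrite in_hits finset.inE; apply/idP/idP; rewrite inE.
Qed.

Lemma median_lt_event t :
  [set w | med w < t] = [set w | (m < #|hits (fun j => [set w | (F j w < t)%R]) w|)%N].
Proof.
have sz w : size [seq F j w | j <- enum 'I_(m.*2.+1)] = m.*2.+1 by rewrite size_map size_enum_ord.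
apply/funext => w /=; apply/propext; rewrite /med (median_lt _ (sz w)) (count_set (F ^~ w)).
set X := hits _ w; set Y := finset _; suff -> : #|Y| = #|X| by [].
by apply: eq_card => j; rewrite in_hits finset.inE; apply/idP/idP; rewrite inE.
Qed.

Lemma measurable_median : (forall j, measurable_fun setT (F j)) -> measurable_fun setT med.
Proof.
move=> mF; apply: measurable_fun_gt => t; rewrite median_gt_event.
apply: measurable_count => j; apply: measurable_gt_set; exact: mF.
Qed.

End median_event.

Section majority_probability.
Context (R : realType) (disp : measure_display) (T : measurableType disp)
  (P : probability T R) (q m : nat) (E : 'I_q -> set T) (x : R).
Hypothesis mE : forall j, measurable (E j).
Hypothesis PE : forall j, P (E j) = x%:E.
Hypothesis indE : forall J : {set 'I_q},
  P (\big[setI/setT]_j (if j \in J then E j else ~` E j)) =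
  (\prod_j P (if j \in J then E j else ~` E j))%E.

Let atom (J : {set 'I_q}) : set T := \big[setI/setT]_j (if j \in J then E j else ~` E j).

Let matom J : measurable (atom J).
Proof. by apply: bigsetI_measurable => j _; case: ifP => // _; exact: measurableC. Qed.

Let atomP J w : (w \in atom J) = (J == hits E w).
Proof.
rewrite /atom (big_morph (fun A => w \in A) (in_setI w) (in_setT w)) big_andE.
apply/forallP/eqP => [h|-> j]; last first.
  by rewrite in_hits /=; case E0 : (w \in E j); rewrite ?E0// in_setC E0.
by apply/setP => j; rewrite in_hits; have := h j; case: ifPn => // _; rewrite in_setC => /negbTE.
Qed.

Let Patom J : P (atom J) = (x ^+ #|J| * (1 - x) ^+ (q - #|J|))%:E.
Proof.
rewrite indE (bigID (mem J))/=.
rewrite (eq_bigr (fun=> x%:E)) => [|j ->]; last by rewrite PE.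
rewrite [X in (_ * X)%E](eq_bigr (fun=> (1 - x)%:E)) => [|j /negbTE ->]; last first.
  by rewrite probability_setC// PE.
rewrite !prodEFin -EFinM !prodr_const; congr (_ * _ ^+ _)%:E.
apply: (@addnI #|J|); rewrite subnKC ?cardC ?card_ord//.
by rewrite -[leqRHS]card_ord max_card.
Qed.

(** Every point lies in exactly one atom, the one indexed by its own [hits], and the probability of
    an atom factorizes by [indE]. *)
Lemma majority_probability :
  P [set w | (m < #|hits E w|)%N] = (majority q m x)%:E.
Proof.
rewrite (@prob_integral_indic _ _ _ P _ (measurable_count R _ mE)).
transitivity (\int[P]_w (\sum_(J <- seq.filter (fun J : {set 'I_q} => (m < #|J|)%N) (index_enum _)) (\1_(atom J) w)%:E))%E.
  apply: eq_integral => w _; rewrite indicE.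
  set J0 := hits E w.
  rewrite sumEFin; congr EFin; rewrite big_filter.
  rewrite (eq_bigr (fun J => (J == J0)%:R)) => [|J _]; last by rewrite indicE atomP.
  have [h|h] := boolP (w \in _).
    rewrite (bigD1 J0)/=; last by move: h; rewrite inE.
    by rewrite eqxx big1 ?addr0// => J /andP[_ /negbTE ->].
  rewrite big1// => J hJ; case: eqP => // JJ; move: h; rewrite notin_setE /= -/J0 -JJ.
  by move=> /(_ hJ).
rewrite ge0_integral_sum//; first last.
- by move=> J; apply/measurable_EFinP; exact: measurable_indic.
rewrite big_filter /majority -sumEFin; apply: eq_bigr => J _.
by rewrite -prob_integral_indic// Patom.
Qed.

End majority_probability.

(** * Moments from tails *)

Section tail_moments.
Context (R : realType) (disp : measure_display) (T : measurableType disp)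
  (P : probability T R).
Local Notation mu := (@lebesgue_measure R).

Lemma ge0_integral_tail (Y : T -> R) : measurable_fun setT Y -> (forall w, 0 <= Y w) ->
  (\int[P]_w (Y w)%:E = \int[mu]_(t in `[0%R, +oo[) P [set w | (t < Y w)%R])%E.
Proof.
move=> mY Y0.
pose V : {RV P >-> R} := HB.pack Y (isMeasurableFun.Build _ _ _ _ _ mY).
transitivity ('E_P[V])%E; first by rewrite expectation_def.
rewrite ge0_expectation_ccdf//; apply: eq_integral => t _; congr (P _).
by rewrite preimage_itvoy.
Qed.

Lemma measurable_tail (Y : T -> R) : measurable_fun setT Y ->
  measurable_fun [set: R] (fun t : R => P [set w | (t < Y w)%R]).
Proof.
move=> mY; pose V : {RV P >-> R} := HB.pack Y (isMeasurableFun.Build _ _ _ _ _ mY).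
have := ccdf_measurable V; congr (measurable_fun _ _); apply/funext => t; congr (P _).
by rewrite preimage_itvoy.
Qed.

(** By the layer cake formula the two integrals differ by at most that of [e * min(1, (a / t)^2)]
    over [t >= 0], where [[0, a]] and the rest contribute [e * a] each. *)
Lemma ge0_integral_tail_le (Y Z : T -> R) (a e : R) : 0 < a -> 0 <= e ->
  measurable_fun setT Y -> (forall w, 0 <= Y w) ->
  measurable_fun setT Z -> (forall w, 0 <= Z w) ->
  (forall t : R, 0 <= t -> (P [set w | (t < Y w)%R] <= P [set w | (t < Z w)%R] + e%:E)%E) ->
  (forall t : R, 0 < t ->
    (P [set w | (t < Y w)%R] <= P [set w | (t < Z w)%R] + (e * (a / t) ^+ 2)%:E)%E) ->
  (\int[P]_w (Y w)%:E <= \int[P]_w (Z w)%:E + (2 * e * a)%:E)%E.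
Proof.
move=> a0 e0 mY Y0 mZ Z0 h1 h2; rewrite !ge0_integral_tail//.
have mtY : measurable_fun [set: R] (fun t : R => P [set w | (t < Y w)%R]) := measurable_tail mY.
have mtZ : measurable_fun [set: R] (fun t : R => P [set w | (t < Z w)%R]) := measurable_tail mZ.
pose b (t : R) : R := \1_(`[0, a]%classic) t + a ^+ 2 * inv_sqr_tail a t.
have b0 t : 0 <= b t by rewrite addr_ge0// mulr_ge0 ?sqr_ge0// inv_sqr_tail_ge0.
have m1 : measurable_fun [set: R] (fun t : R => \1_(`[0, a]%classic) t : R).
  exact: measurable_indic.
have m2 : measurable_fun [set: R] (fun t : R => a ^+ 2 * inv_sqr_tail a t).
  by apply: measurable_funM => //; exact: inv_sqr_tail_measurable.
have mb : measurable_fun [set: R] b by exact: measurable_funD.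
have ib : (\int[mu]_t (b t)%:E = (2 * a)%:E)%E.
  under eq_integral do rewrite EFinD.
  rewrite ge0_integralD//; first last.
  - exact/measurable_EFinP.
  - by move=> t _; rewrite lee_fin mulr_ge0 ?sqr_ge0// inv_sqr_tail_ge0.
  - exact/measurable_EFinP.
  under [X in (_ + X)%E]eq_integral do rewrite EFinM.
  rewrite ge0_integralZl//; first last.
  - by rewrite lee_fin sqr_ge0.
  - by move=> t _; rewrite lee_fin inv_sqr_tail_ge0.
  - by apply/measurable_EFinP; exact: inv_sqr_tail_measurable.
  rewrite integral_inv_sqr_tail// integral_indic// setIT.
  rewrite -[X in (X + _)%E]/(lebesgue_measure (`[0, a]%classic : set R)) lebesgue_measure_itv/= lte_fin a0.
  by rewrite oppr0 -EFinM -!EFinD; congr EFin; field; rewrite gt_eqF.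
have mbe : measurable_fun [set: R] (fun t : R => (e%:E * (b t)%:E)%E).
  by apply: measurable_funeM; exact/measurable_EFinP.
apply: (@le_trans _ _ (\int[mu]_(t in `[0%R, +oo[) (P [set w | (t < Z w)%R] + e%:E * (b t)%:E))%E).
  apply: ge0_le_integral => //.
  - exact: measurable_funTS.
  - by apply: measurable_funTS; exact: emeasurable_funD.
  move=> t; rewrite /= in_itv/= andbT => t0; rewrite -EFinM /b indicE.
  have [ta|ta] := leP t a.
    have -> : (t \in `[0, a]%classic) = true by rewrite mem_set//= in_itv/= t0.
    apply: le_trans (h1 t t0) _.
    rewrite leeD2l// lee_fin ler_peMr// lerDl.
    by rewrite mulr_ge0 ?sqr_ge0// inv_sqr_tail_ge0.
  have -> : (t \in `[0, a]%classic) = false.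
    by rewrite memNset//= in_itv/= t0/=; apply/negP; rewrite -ltNge.
  rewrite add0r.
  have t0' : 0 < t by exact: lt_trans ta.
  apply: le_trans (h2 t t0') _; rewrite leeD2l// lee_fin ler_wpM2l//.
  by rewrite /inv_sqr_tail indicE mem_set ?mul1r ?expr_div_n//= in_itv/= andbT ltW.
rewrite ge0_integralD//; first last.
- exact: measurable_funTS.
- by move=> t _; rewrite -EFinM lee_fin mulr_ge0.
- exact: measurable_funTS.
rewrite leeD2l//.
apply: (@le_trans _ _ (\int[mu]_t (e%:E * (b t)%:E))%E).
  apply: ge0_subset_integral => //.
  by move=> t _; rewrite -EFinM lee_fin mulr_ge0.
rewrite ge0_integralZl//; first last.
- by move=> t _; rewrite lee_fin.
- exact/measurable_EFinP.
by rewrite ib -EFinM lee_fin; lra.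
Qed.

Lemma second_moment_tail (X : T -> R) (a K : R) : 0 < a -> 1 <= K -> measurable_fun setT X ->
  (forall t : R, 0 < t -> fine (P [set w | t < `|X w|]) <= K * (a / t) ^+ 4) ->
  (\int[P]_w (X w ^+ 2)%:E <= (2 * K * a ^+ 2)%:E)%E.
Proof.
move=> a0 K1 mX h.
have mX2 : measurable_fun setT (fun w => X w ^+ 2) by exact: measurable_funX.
have E0 : (\int[P]_w ((fun=> 0 : R) w)%:E = 0)%E by rewrite integral0.
have mS t : measurable [set w | t < X w ^+ 2].
  by apply: measurable_gt_set; exact: mX2.
(* Applied to [X^2] at scale [a^2], against the zero variable: [K (a / sqrt t)^4 = K (a^2 / t)^2] is
   the required decay. *)
rewrite -[leRHS]add0e -E0; apply: ge0_integral_tail_le => //.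
- by rewrite exprn_gt0.
- exact: le_trans K1.
- by move=> w; exact: sqr_ge0.
- move=> t t0; apply: (@le_trans _ _ 1%E); first exact: probability_le1.
  by rewrite -[leLHS]add0e leeD// lee_fin.
- move=> t t0; rewrite -[leLHS]add0e leeD//.
  have st : 0 < Num.sqrt t by rewrite sqrtr_gt0.
  have -> : [set w | t < X w ^+ 2] = [set w | Num.sqrt t < `|X w|].
    apply/seteqP; have key w : (t < X w ^+ 2) = (Num.sqrt t < `|X w|).
      by rewrite -{1}(sqr_sqrtr (ltW t0)) -(real_normK (num_real (X w))) ltr_pXn2r ?nnegrE// sqrtr_ge0.
    by split => w /=; rewrite key.
  rewrite -[leLHS]fineK; last first.
    apply: fin_num_measure.
    have -> : [set w | Num.sqrt t < `|X w|] = (fun w => `|X w|) @^-1` `]Num.sqrt t, +oo[.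
      by rewrite preimage_itvoy.
    by rewrite -[_ @^-1` _]setTI; exact: (measurableT_comp (@normr_measurable _ _) mX).
  rewrite lee_fin; apply: le_trans (h _ st) _.
  by rewrite (exprM (a / Num.sqrt t) 2 2) !expr_div_n sqr_sqrtr// ltW.
Qed.

(** The positive and negative parts of [X] are compared with each other through their tails, so that
    their common size cancels. *)
Lemma first_moment_tail (X : T -> R) (a e : R) : 0 < a -> 0 <= e ->
  P.-integrable setT (EFin \o X) ->
  (forall t : R, 0 <= t -> `|fine (P [set w | t < X w]) - fine (P [set w | X w < - t])| <= e) ->
  (forall t : R, 0 < t -> `|fine (P [set w | t < X w]) - fine (P [set w | X w < - t])|
     <= e * (a / t) ^+ 2) ->
  `|\int[P]_w X w| <= 2 * e * a.
Proof.
move=> a0 e0 iX h1 h2.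
have mX : measurable_fun setT X by apply/measurable_EFinP; case/integrableP : iX.
pose Y w := Num.max (X w) 0; pose Z w : R := Num.max (- X w) 0.
have mY : measurable_fun setT Y by exact: measurable_maxr.
have mZ : measurable_fun setT Z by apply: measurable_maxr => //; exact: measurableT_comp.
have Y0 w : 0 <= Y w by rewrite le_max lexx orbT.
have Z0 w : 0 <= Z w by rewrite le_max lexx orbT.
have YE t : 0 <= t -> [set w | t < Y w] = [set w | t < X w].
  by move=> t0; apply/seteqP; split => w /=; rewrite lt_max [t < 0]ltNge t0 orbF.
have ZE t : 0 <= t -> [set w | t < Z w] = [set w | X w < - t].
  by move=> t0; apply/seteqP; split => w /=; rewrite lt_max [t < 0]ltNge t0 orbF ltrNr.
have fY t : P [set w | t < Y w] = (fine (P [set w | t < Y w]))%:E.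
  by rewrite fineK// fin_num_measure//; apply: measurable_gt_set; exact: mY.
have fZ t : P [set w | t < Z w] = (fine (P [set w | t < Z w]))%:E.
  by rewrite fineK// fin_num_measure//; apply: measurable_gt_set; exact: mZ.
have iY : P.-integrable setT (EFin \o Y).
  apply: le_integrable iX => //; first exact/measurable_EFinP.
  move=> w _ /=; rewrite lee_fin (ger0_norm (Y0 w)) /Y ge_max ler_norm normr_ge0//.
have iZ : P.-integrable setT (EFin \o Z).
  apply: le_integrable iX => //; first exact/measurable_EFinP.
  by move=> w _ /=; rewrite lee_fin (ger0_norm (Z0 w)) /Z ge_max -[`|X w|]normrN ler_norm normr_ge0.
have XE : \int[P]_w X w = \int[P]_w Y w - \int[P]_w Z w.
  rewrite -RintegralB//; apply: eq_Rintegral => w _; rewrite /Y /Z.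
  by rewrite /Num.max; case: (ltgtP (X w) 0) => [x0|x0|->]; rewrite ?oppr0 ?ltxx ?subrr//;
    [rewrite ltNge oppr_ge0 ltW//= sub0r opprK|rewrite oppr_lt0 x0 subr0].
have fin V : P.-integrable setT (EFin \o V) -> (\int[P]_w (V w)%:E = (\int[P]_w V w)%:E)%E.
  by move=> iV; rewrite /Rintegral fineK//; exact: integrable_fin_num iV.
have l1 : \int[P]_w Y w <= \int[P]_w Z w + 2 * e * a.
  rewrite -lee_fin EFinD -!fin//; apply: ge0_integral_tail_le => //.
  - move=> t t0; rewrite fY fZ YE// ZE// -EFinD lee_fin.
    by have := h1 t t0; rewrite ler_norml => /andP[]; lra.
  - move=> t t0; have t0' := ltW t0; rewrite fY fZ YE// ZE// -EFinD lee_fin.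
    by have := h2 t t0; rewrite ler_norml => /andP[]; lra.
have l2 : \int[P]_w Z w <= \int[P]_w Y w + 2 * e * a.
  rewrite -lee_fin EFinD -!fin//; apply: ge0_integral_tail_le => //.
  - move=> t t0; rewrite fY fZ YE// ZE// -EFinD lee_fin.
    by have := h1 t t0; rewrite ler_norml => /andP[]; lra.
  - move=> t t0; have t0' := ltW t0; rewrite fY fZ YE// ZE// -EFinD lee_fin.
    by have := h2 t t0; rewrite ler_norml => /andP[]; lra.
rewrite XE ler_norml; move: l1 l2; move: (\int[P]_w Y w) (\int[P]_w Z w) (2 * e * a) => y z c.
by move=> ? ?; apply/andP; split; lra.
Qed.

End tail_moments.

(** * Moments of the median of the blocks *)

Section median_of_blocks.
Context (R : realType) (d m : nat) (disp : measure_display)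
  (T : measurableType disp) (disp' : measure_display)
  (Xi : measurableType disp') (P : probability T R) (law : probability Xi R)
  (xi : nat -> T -> Xi) (eta : nat -> 'I_(m.*2.+1) -> T -> 'rV[R]_d).
Hypothesis fr : fresh_randomness P law xi eta.
Variables (nu : Xi -> R) (p : R -> R) (M B beta theta : R) (n : nat).
Hypothesis mnu : measurable_fun setT nu.
Hypothesis pnu : is_density law nu p.
Local Notation mu := (@lebesgue_measure R).
Hypotheses (M0 : 0 < M) (B0 : 0 < B) (beta1 : 1 <= beta) (n0 : (0 < n)%N).
Hypotheses (theta0 : 0 < theta) (Mn : M <= n%:R * theta ^+ 2).
Hypothesis odd1 : (\int[mu]_u (u * odd_part p u)%:E = 0)%E.
Hypothesis odd2 : (\int[mu]_u (u ^+ 2 * `|odd_part p u|)%:E <= M%:E)%E.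
Hypothesis sn : forall u : R, (convolution_pow (EFin \o even_part p) n u <=
  (B * n%:R / (n%:R `^ ((beta + 1) / beta) + `|u| `^ (1 + beta)))%:E)%E.
Variables (t0 k : nat) (l : 'I_d).

Let Y z := n%:R^-1 * nu z.
Let mY : measurable_fun setT Y.
Proof. exact: measurable_funM. Qed.

Let blk (j : 'I_(m.*2.+1)) : T -> R := noise_block xi eta nu theta n (t0 + j * n) k j l.
Let D (j : 'I_(m.*2.+1)) := @block_index d _ n (t0 + j * n) k j l.

Definition median_noise w := median [seq blk j w | j <- enum 'I_(m.*2.+1)].

Let mblk j : measurable_fun setT (blk j).
Proof. exact: (noise_block_measurableT fr). Qed.

Lemma measurable_median_noise : measurable_fun setT median_noise.
Proof. exact: measurable_median. Qed.

Lemma block_index_disjoint i j : i != j -> D i `&` D j = set0.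
Proof.
move=> ij; apply/seteqP; split => // x [[[a an ->]|->] [[b bn]|]] //.
(* The quotient by [n] of the relative call number recovers the block. *)
- case=> /eqP; rewrite -!addnA eqn_add2l => /eqP e.
  have := congr1 (fun x => x %/ n)%N e; rewrite !divnMDl// !divn_small// !addn0 => /val_inj ij'.
  by move: ij; rewrite ij' eqxx.
- by case=> ij'; move: ij; rewrite ij' eqxx.
Qed.

Let indep (E : 'I_(m.*2.+1) -> set R) (J : {set 'I_(m.*2.+1)}) :
  (forall j, measurable (E j)) ->
  P (\big[setI/setT]_j (if j \in J then blk j @^-1` E j else ~` (blk j @^-1` E j))) =
  (\prod_j P (if j \in J then blk j @^-1` E j else ~` (blk j @^-1` E j)))%E.
Proof.
move=> mE.
apply: (@sigma_indep_family _ _ _ P _ (events_of xi eta) _ _ _ _ _ D).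
- exact: events_of_setT.
- exact: events_of_setI.
- exact: (events_of_measurable fr).
- by case: fr.
- exact: block_index_disjoint.
- exact: index_enum_uniq.
- move=> j _.
  have h : measurable_fun setT (blk j : generated_type xi eta (D j) -> R).
    exact: noise_block_measurable.
  have mA : measurable ((blk j : generated_type xi eta (D j) -> R) @^-1` E j).
    by rewrite -[_ @^-1` _]setTI; exact: h.
  case: ifP => _; first exact: mA.
  exact: (measurableC mA).
Qed.

Let pu (t : R) := fine (P [set w | t < blk ord0 w]).
Let pl (t : R) := fine (P [set w | blk ord0 w < - t]).

(** Both probabilities equal one iterated average under [law], in which the block number no longer
    occurs. *)
Let upper_same (t : R) j : P [set w | t < blk j w] = (pu t)%:E.
Proof.
have gU := gauss_upper_unit t theta0.
rewrite -[LHS]fineK; last by rewrite fin_num_measure//; apply: measurable_gt_set; exact: mblk.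
have U i : fine (P [set w | t < blk i w]) = iter n (shift_mean law Y) (gauss_upper theta t) 0.
  rewrite -(seed_sum_mean fr mY (t0 + i * n) n 0 gU).
  apply: etrans (upper_event fr n mnu theta0 _ _ _ _ _) _.
  by apply: eq_Rintegral => w _; rewrite add0r.
by rewrite /pu !U.
Qed.

Let lower_same (t : R) j : P [set w | blk j w < - t] = (pl t)%:E.
Proof.
have gU := gauss_upper_unit t theta0.
have hU : unit_valued (fun x => gauss_upper theta t (- x)).
  have [mg g01] := gU; split => //; exact: measurableT_comp.
rewrite -[LHS]fineK; last by rewrite fin_num_measure//; apply: measurable_lt_set; exact: mblk.
have U i : fine (P [set w | blk i w < - t]) = iter n (shift_mean law Y) (fun x => gauss_upper theta t (- x)) 0.
  rewrite -(seed_sum_mean fr mY (t0 + i * n) n 0 hU).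
  apply: etrans (lower_event fr n mnu theta0 _ _ _ _ _) _.
  by apply: eq_Rintegral => w _; rewrite add0r.
by rewrite /pl !U.
Qed.

Lemma median_upper (t : R) : P [set w | t < median_noise w] = (majority m.*2.+1 m (pu t))%:E.
Proof.
rewrite median_gt_event; apply: majority_probability => [j|j|J].
- by apply: measurable_gt_set; exact: mblk.
- exact: upper_same.
- under eq_bigr do rewrite -preimage_itvoy.
  under [RHS]eq_bigr do rewrite -preimage_itvoy.
  exact: (@indep (fun=> _)).
Qed.

Lemma median_lower (t : R) : P [set w | median_noise w < - t] = (majority m.*2.+1 m (pl t))%:E.
Proof.
rewrite median_lt_event; apply: majority_probability => [j|j|J].
- by apply: measurable_lt_set; exact: mblk.
- exact: lower_same.
- under eq_bigr do rewrite -preimage_itvNyo.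
  under [RHS]eq_bigr do rewrite -preimage_itvNyo.
  exact: (@indep (fun=> _)).
Qed.

Let a := 24 * (tail_scale B beta n + theta).

Let a0 : 0 < a.
Proof. by rewrite mulr_gt0// addr_gt0// tail_scale_gt0. Qed.

Let mtail (t : R) : measurable [set w | t < `|blk ord0 w|].
Proof.
rewrite -preimage_itvoy -[_ @^-1` _]setTI.
exact: (measurableT_comp (@normr_measurable _ _) (mblk ord0)).
Qed.

Let tail (t : R) : 0 < t -> fine (P [set w | t < `|blk ord0 w|]) <= a / t.
Proof.
by move=> t_gt0; rewrite /a -mulrA; exact: (block_tail fr mnu pnu B0 beta1 n0 theta0 Mn odd1 odd2 sn).
Qed.

Let pu_range (t : R) : 0 <= pu t <= 1.
Proof.
rewrite fine_ge0//= -lee_fin -(upper_same t ord0); apply: probability_le1.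
by apply: measurable_gt_set; exact: mblk.
Qed.

Let pl_range (t : R) : 0 <= pl t <= 1.
Proof.
rewrite fine_ge0//= -lee_fin -(lower_same t ord0); apply: probability_le1.
by apply: measurable_lt_set; exact: mblk.
Qed.

Let pu_tail (t : R) : 0 < t -> pu t <= a / t.
Proof.
move=> t_gt0; apply: le_trans (tail t_gt0); apply: fine_le.
- by rewrite upper_same.
- exact: fin_num_measure.
apply: le_measure; rewrite ?inE//.
  by apply: measurable_gt_set; exact: mblk.
by move=> w /= h; apply: lt_le_trans h (ler_norm _).
Qed.

Let pl_tail (t : R) : 0 < t -> pl t <= a / t.
Proof.
move=> t_gt0; apply: le_trans (tail t_gt0); apply: fine_le.
- by rewrite lower_same.
- exact: fin_num_measure.
apply: le_measure; rewrite ?inE//.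
  by apply: measurable_lt_set; exact: mblk.
by move=> w /= h; rewrite -normrN; apply: lt_le_trans (ler_norm _); rewrite ltrNr.
Qed.

Hypothesis m3 : (3 <= m)%N.
Let q := m.*2.+1.

Lemma median_second_moment :
  (\int[P]_w (median_noise w ^+ 2)%:E <= (2 * 2 ^+ q.+1 * a ^+ 2)%:E)%E.
Proof.
apply: second_moment_tail => //.
- by rewrite exprn_ege1// ler1n.
- exact: measurable_median_noise.
move=> t t_gt0.
have r0 : 0 <= a / t by rewrite divr_ge0// ltW.
have mn : measurable [set w | t < median_noise w].
  by apply: measurable_gt_set; exact: measurable_median_noise.
have mn' : measurable [set w | median_noise w < - t].
  by apply: measurable_lt_set; exact: measurable_median_noise.
have -> : [set w | t < `|median_noise w|] =
    [set w | t < median_noise w] `|` [set w | median_noise w < - t].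
  apply/seteqP; split => w /=; rewrite lter_normr ltrNr; first by move=> /orP.
  by move=> /orP.
rewrite -lee_fin fineK; last by apply: fin_num_measure; exact: measurableU.
apply: (@le_trans _ _ (P [set w | (t < median_noise w)%R] + P [set w | (median_noise w < - t)%R])%E).
  exact: measureU2.
rewrite median_upper median_lower -EFinD lee_fin.
(* [m >= 3] gives an exponent [m + 1 >= 4]; when [a / t > 1], the bound with [r = 1] is enough. *)
have bnd x : 0 <= x <= 1 -> x <= a / t -> majority m.*2.+1 m x <= 2 ^+ q * (a / t) ^+ 4.
  move=> hx xr; have [r1|r1] := leP (a / t) 1.
    apply: le_trans (majority_le _ _ hx xr r1) _.
    by rewrite ler_wpM2l ?exprn_ge0// ler_wiXn2l.
  have x1 : x <= 1 by case/andP: hx.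
  apply: le_trans (majority_le _ _ hx x1 (lexx 1)) _.
  by rewrite ler_wpM2l ?exprn_ge0// expr1n exprn_ege1// ltW.
have b1 := bnd _ (pu_range t) (pu_tail t_gt0).
have b2 := bnd _ (pl_range t) (pl_tail t_gt0).
by rewrite exprS -mulrA mulr_natl mulr2n lerD.
Qed.

Lemma median_noise_integrable : P.-integrable setT (EFin \o median_noise).
Proof.
apply/integrableP; split; first by apply/measurable_EFinP; exact: measurable_median_noise.
apply: (@le_lt_trans _ _ (\int[P]_w (1 + (median_noise w ^+ 2)%:E))%E).
  apply: ge0_le_integral => //.
  - apply: measurableT_comp => //; apply/measurable_EFinP; exact: measurable_median_noise.
  - apply: emeasurable_funD => //; apply/measurable_EFinP.
    exact: measurable_funX measurable_median_noise.
  move=> w _ /=; rewrite -EFinD lee_fin.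
  have := sqr_ge0 (`|median_noise w| - 1); rewrite -[median_noise w ^+ 2]real_normK ?num_real//.
  by have := normr_ge0 (median_noise w); nra.
rewrite ge0_integralD//; first last.
- by apply/measurable_EFinP; exact: measurable_funX measurable_median_noise.
- by move=> w _; rewrite lee_fin sqr_ge0.
rewrite integral_cst//= probability_setT mule1.
apply: lte_add_pinfty; first exact: ltry.
by apply: le_lt_trans median_second_moment _; exact: ltry.
Qed.

(* The asymmetry [4 M / (n theta^2)] of one block is multiplied by the Lipschitz
   constant of the binomial tail, which decays like [(a / t)^2] and is therefore
   integrable over [t]. *)
Lemma median_mean :
  `|\int[P]_w median_noise w| <=
  2 * (2 ^+ q * (q%:R * (4 * (M / (n%:R * theta ^+ 2))))) * a.
Proof.
have De0 : 0 <= 4 * (M / (n%:R * theta ^+ 2)).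
  by rewrite mulr_ge0// divr_ge0 ?(ltW M0)// mulr_ge0// sqr_ge0.
have sym t : `|pu t - pl t| <= 4 * (M / (n%:R * theta ^+ 2)).
  exact: (block_symmetry fr mnu pnu).
apply: first_moment_tail => //.
- by rewrite mulr_ge0 ?exprn_ge0// mulr_ge0.
- exact: median_noise_integrable.
- move=> t t0'; rewrite median_upper median_lower /=.
  have := @majority_lipschitz _ q m _ _ _ (pu_range t) (pl_range t) (lexx 1).
  rewrite expr1n mulr1 => h; apply: le_trans h _.
  by rewrite ler_wpM2l ?exprn_ge0// ler_wpM2l.
move=> t t_gt0; rewrite median_upper median_lower /=.
have r0 : 0 <= a / t by rewrite divr_ge0// ltW.
have [r1|r1] := leP (a / t) 1.
  have hu : 0 <= pu t <= a / t by rewrite pu_tail// andbT; case/andP: (pu_range t).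
  have hl : 0 <= pl t <= a / t by rewrite pl_tail// andbT; case/andP: (pl_range t).
  have := @majority_lipschitz _ q m _ _ _ hu hl r1.
  move=> h; apply: le_trans h _.
  rewrite -[leRHS]mulrA ler_wpM2l ?exprn_ge0// -mulrA -[leRHS]mulrA ler_wpM2l// mulrC.
  apply: ler_pM => //; first exact: exprn_ge0.
  by rewrite ler_wiXn2l// (leq_trans _ m3).
have := @majority_lipschitz _ q m _ _ _ (pu_range t) (pl_range t) (lexx 1).
rewrite expr1n mulr1 => h; apply: le_trans h _.
rewrite -mulrA ler_wpM2l ?exprn_ge0// -mulrA ler_wpM2l//.
apply: le_trans (sym t) _; rewrite ler_peMr// exprn_ege1// ltW//.
Qed.

End median_of_blocks.

(** * The median-of-means oracle *)

Section vector_measurability.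
Context (R : realType) (n : nat) (disp : measure_display) (T : measurableType disp).
Variable l0 : 'I_n.
Implicit Types X Y : T -> 'rV[R]_n.

(** Coordinatewise, to match the product sigma-algebra of tuples in which the oracle is jointly
    measurable. *)
Definition vector_measurable X : Prop := forall l, measurable_fun setT (fun w => X w 0 l).

Lemma vector_measurable_cst (v : 'rV[R]_n) : vector_measurable (fun=> v).
Proof. by move=> l; exact: measurable_cst. Qed.

Lemma vector_measurableD X Y : vector_measurable X -> vector_measurable Y ->
  vector_measurable (fun w => X w + Y w).
Proof.
move=> mX mY l; rewrite (_ : (fun w => _) = (fun w => X w 0 l + Y w 0 l)).
  exact: measurable_funD.
by apply/funext => w; rewrite mxE.
Qed.

Lemma vector_measurableZ (c : T -> R) X : measurable_fun setT c -> vector_measurable X ->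
  vector_measurable (fun w => c w *: X w).
Proof.
move=> mc mX l; rewrite (_ : (fun w => _) = (fun w => c w * X w 0 l)).
  exact: measurable_funM.
by apply/funext => w; rewrite mxE.
Qed.

Lemma vector_measurableB X Y : vector_measurable X -> vector_measurable Y ->
  vector_measurable (fun w => X w - Y w).
Proof.
move=> mX mY; rewrite (_ : (fun w => _) = (fun w => X w + (-1) *: Y w)).
  by apply: vector_measurableD => //; exact: vector_measurableZ.
by apply/funext => w; rewrite scaleN1r.
Qed.

Lemma measurable_dotv X Y : vector_measurable X -> vector_measurable Y ->
  measurable_fun setT (fun w => dotv (X w) (Y w)).
Proof. by move=> mX mY; apply: measurable_sum => j; exact: measurable_funM. Qed.

Lemma measurable_enorm X : vector_measurable X -> measurable_fun setT (fun w => enorm (X w)).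
Proof.
move=> mX; apply: (measurableT_comp (continuous_measurable_fun (@sqrt_continuous R))); exact: measurable_dotv.
Qed.

Lemma vector_measurable_clip X (lam : R) : vector_measurable X ->
  vector_measurable (fun w => clip (X w) lam).
Proof.
move=> mX; rewrite (_ : (fun w => _) = (fun w => Num.min 1 (lam / enorm (X w)) *: X w)).
  apply: vector_measurableZ => //; apply: measurable_minr => //.
  apply: measurable_funM => //; rewrite (_ : (fun w => _) = (fun w => enorm (X w) `^ (-1))).
    by apply: (measurableT_comp (measurable_powR (-1))); exact: measurable_enorm.
  by apply/funext => w; rewrite powR_inv1// enorm_ge0.
by apply/funext => w; rewrite /clip; case: eqP => // ->; rewrite scaler0.
Qed.

Lemma measurable_tuple X : vector_measurable X ->
  measurable_fun setT (fun w => [tuple X w 0 i | i < n]).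
Proof.
move=> mX; apply/measurable_fun_tnthP => i; rewrite (_ : _ \o _ = fun w => X w 0 i)//.
by apply/funext => w; rewrite /= tnth_mktuple.
Qed.

(* Countably many rational balls suffice, which gives the measurability of a
   continuous function of a measurable vector. *)
Lemma open_rat_balls (U : set 'rV[R]_n) x : open U -> U x ->
  exists (v : 'rV[rat]_n) (e : rat),
    ball (map_mx ratr v : 'rV[R]_n) (ratr e) `<=` U /\
    forall l, `|x 0 l - ratr (v 0 l)| < ratr e.
Proof.
move=> oU Ux; have [e e0 eU] : exists2 e : R, 0 < e & ball x e `<=` U.
  by have /nbhs_ballP[e e0 eU] := open_nbhs_nbhs (conj oU Ux); exists e.
have [r] : exists r : rat, ratr r \in `]0, (e / 2)[ by apply: rat_in_itvoo; lra.
rewrite in_itv/= => /andP[r0 re].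
have ex l : exists s : rat, ratr s \in `](x 0 l - ratr r), (x 0 l + ratr r)[.
  by apply: rat_in_itvoo; lra.
exists (\row_l xget 0 [set s : rat | (ratr s : R) \in `](x 0 l - ratr r), (x 0 l + ratr r)[]), r.
have hv l : `|x 0 l - ratr ((\row_l xget 0 [set s : rat |
    (ratr s : R) \in `](x 0 l - ratr r), (x 0 l + ratr r)[]) 0 l)| < ratr r.
  rewrite mxE; case: xgetP => [s _ /=|/(_ _) h]; last by have [s /h] := ex l.
  by rewrite in_itv/= ltr_norml => /andP[? ?]; apply/andP; split; lra.
split=> // y [_ hy]; apply: eU; split=> // i j; rewrite ord1.
have := hy 0 j; rewrite /ball/= mxE => h1; have h2 := hv j.
rewrite (_ : x 0 j - y 0 j = (x 0 j - ratr ((\row_l xget 0 [set s : rat |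
    (ratr s : R) \in `](x 0 l - ratr r), (x 0 l + ratr r)[]) 0 j))
    + (ratr ((\row_l xget 0 [set s : rat |
    (ratr s : R) \in `](x 0 l - ratr r), (x 0 l + ratr r)[]) 0 j) - y 0 j)); last by ring.
by apply: le_lt_trans (ler_normD _ _) _; lra.
Qed.

Lemma measurable_continuous_comp (f : 'rV[R]_n -> R) X : continuous f ->
  vector_measurable X -> measurable_fun setT (fun w => f (X w)).
Proof.
move=> cf mX; apply: measurable_fun_gt => t.
set U := [set x | t < f x].
have oU : open U.
  rewrite /U (_ : [set x | _] = f @^-1` `]t, +oo[); last by rewrite preimage_itvoy.
  by apply: open_comp => // x _; exact: cf.
pose J (p : 'rV[rat]_n * rat) := `[< ball (map_mx ratr p.1 : 'rV[R]_n) (ratr p.2) `<=` U >].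
pose S (p : 'rV[rat]_n * rat) : set T :=
  if J p then \big[setI/setT]_(l < n) [set w | `|X w 0 l - ratr (p.1 0 l)| < ratr p.2] else set0.
have -> : [set w | t < f (X w)] = \bigcup_p S p.
  apply/seteqP; split => w /=.
    move=> h; have [v [e [sub hv]]] := open_rat_balls oU (h : U (X w)).
    exists (v, e) => //; rewrite /S /J asboolT//= -bigcap_seq => l _ /=; exact: hv.
  move=> [[v e] _]; rewrite /S /J; case: asboolP => //= sub; rewrite -bigcap_seq => h.
  have h' l : `|X w 0 l - ratr (v 0 l)| < ratr e by apply: (h l); exact: mem_index_enum.
  apply: sub; split => [|i l]; last by rewrite ord1 mxE /ball/= distrC; apply: h'.
  (* Membership in a ball demands a positive radius, which the strict bound at the coordinate [l0]
     provides. *)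
  by have := normr_ge0 (X w 0 l0 - ratr (v 0 l0)); have := h' l0; lra.
apply: countable_bigcupT_measurable; first exact: countableP.
move=> p; rewrite /S; case: ifP => // _; apply: bigsetI_measurable => l _.
rewrite (_ : [set w | _] = (fun w => `|X w 0 l - ratr (p.1 0 l)|) @^-1` `]-oo, (ratr p.2)[).
  rewrite -[_ @^-1` _]setTI.
  apply: (measurableT_comp (@normr_measurable _ _)) => //; exact: measurable_funB.
by rewrite preimage_itvNyo.
Qed.

End vector_measurability.

Lemma sample_oracleE (R : realType) (d : nat) (answer : nat -> 'rV[R]_d -> 'rV[R]_d) N x t :
  sample_oracle answer N x t = (mkseq (fun i => answer (t + i)%N x) N, (t + N)%N).
Proof.
elim: N t => [|N IH] t /=; first by rewrite addn0.
rewrite IH addnS addSn; congr (_, _); rewrite /mkseq /= addn0; congr cons.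
rewrite (iotaDl 1 0) -map_comp; apply: eq_map => i /=.
by rewrite addSnnS.
Qed.

(** Both sides exceed the same thresholds. It serves to subtract the true gradient inside the
    median. *)
Lemma median_shift (R : realType) (m : nat) (c : R) (s : seq R) : size s = m.*2.+1 ->
  median [seq c + x | x <- s] = c + median s.
Proof.
move=> hs.
have key t : (t < median [seq c + x | x <- s]) = (t < c + median s).
  rewrite (@median_gt _ m) ?size_map// -ltrBlDl (@median_gt _ m)// count_map.
  by congr (_ < _)%N; apply: eq_count => x /=; rewrite ltrBlDl.
by apply/eqP; rewrite eq_le !leNgt key ltxx -key ltxx.
Qed.

Section smom_noise.
Context (R : realType) (d m : nat) (disp : measure_display)
  (T : measurableType disp) (disp' : measure_display) (Xi : measurableType disp')
  (xi : nat -> T -> Xi) (eta : nat -> 'I_(m.*2.+1) -> T -> 'rV[R]_d)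
  (oracle : Xi -> 'rV[R]_d -> 'rV[R]_d) (n : nat) (theta : R).

(** The call counter, the point and the outcome are separate arguments: later the point depends on
    the past only, while [w] supplies fresh inputs. *)
Definition smom_answer (k t : nat) (x : 'rV[R]_d) (w : T) : 'rV[R]_d :=
  smom n theta (mkseq (fun i => oracle (xi (t + i)%N w) x) (m.*2.+1 * n))
    (fun j => eta k j w).

Lemma smom_estimatorE k x t w :
  smom_estimator n theta (fun t => oracle (xi t w)) (fun k j => eta k j w) k x t =
  (smom_answer k t x w, (t + m.*2.+1 * n)%N).
Proof. by rewrite /smom_estimator sample_oracleE. Qed.

Lemma smom_answerE k t x w l : smom_answer k t x w 0 l =
  median [seq n%:R^-1 * (\sum_(i < n) oracle (xi (t + (j * n + i))%N w) x 0 l)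
            + theta * eta k j w 0 l | j : 'I_(m.*2.+1) <- enum 'I_(m.*2.+1)].
Proof.
rewrite mxE; congr median; apply: eq_map => j; rewrite !mxE summxE.
congr (_ * _ + _); apply: eq_bigr => i _; rewrite nth_mkseq//.
by rewrite (@leq_trans (j * n + n))// ?ltn_add2l// -mulSnr leq_mul2r ltn_ord orbT.
Qed.

Lemma smom_noiseE k t x g w l : (0 < n)%N -> (smom_answer k t x w - g) 0 l =
  median_noise xi eta (fun z => oracle z x 0 l - g 0 l) theta n t k l w.
Proof.
move=> n0; rewrite mxE smom_answerE mxE addrC -(@median_shift _ m); last first.
  by rewrite size_map size_enum_ord.
rewrite /median_noise -map_comp; congr median; apply: eq_map => j /=.
rewrite /noise_block /seed_sum -mulr_sumr sumrB sumr_const card_ord addrA; congr (_ + _).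
have -> : \sum_(i < n) oracle (xi (t + (j * n + i))%N w) x 0 l =
    \sum_(i < n) oracle (xi (t + j * n + i)%N w) x 0 l.
  by apply: eq_bigr => i _; rewrite addnA.
rewrite mulrBr -[g 0 l *+ n]mulr_natl mulrA mulVf ?mul1r 1?addrC// pnatr_eq0 -lt0n//.
Qed.

Hypothesis mor : jointly_measurable oracle.

Lemma measurable_oracle_comp (d1 : measure_display) (T1 : measurableType d1)
  (s : T1 -> Xi) (X : T1 -> 'rV[R]_d) : measurable_fun setT s -> vector_measurable X ->
  vector_measurable (fun w => oracle (s w) (X w)).
Proof.
move=> ms mX l.
have -> : (fun w => oracle (s w) (X w) 0 l) =
  (fun p : Xi * d.-tuple R => oracle p.1 (\row_i tnth p.2 i) 0 l) \o
  (fun w => (s w, [tuple X w 0 i | i < d])).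
  apply/funext => w /=; congr (oracle _ _ _ _); apply/rowP => i.
  by rewrite mxE tnth_mktuple.
apply: (measurableT_comp (mor l)).
by apply: measurable_fun_pair => //; exact: measurable_tuple.
Qed.

Lemma vector_measurable_smom (d1 : measure_display) (T1 : measurableType d1)
  (om : T1 -> T) (X : T1 -> 'rV[R]_d) (k t : nat) :
  (forall i, (i < m.*2.+1 * n)%N -> measurable_fun setT (fun w => xi (t + i)%N (om w))) ->
  (forall j l, measurable_fun setT (fun w => eta k j (om w) 0 l)) ->
  vector_measurable X ->
  vector_measurable (fun w => smom_answer k t (X w) (om w)).
Proof.
move=> mxi meta mX l; under eq_fun do rewrite smom_answerE.
apply: measurable_median => j; apply: measurable_funD; last exact: measurable_funM.
apply: measurable_funM => //; apply: measurable_sum => i.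
apply: measurable_oracle_comp => //; apply: mxi.
by rewrite (@leq_trans (j * n + n))// ?ltn_add2l// -mulSnr leq_mul2r ltn_ord orbT.
Qed.

Variables (P : probability T R) (law : probability Xi R) (M B beta : 'I_d -> R).
Hypothesis fr : fresh_randomness P law xi eta.
Hypotheses (m3 : (3 <= m)%N) (n0 : (0 < n)%N) (theta0 : 0 < theta).
Hypothesis Mn : forall j, M j <= n%:R * theta ^+ 2.

Let q := m.*2.+1.
Definition smom_scale j := 24 * (tail_scale (B j) (beta j) n + theta).
Definition smom_variance := \sum_j 2 * 2 ^+ q.+1 * smom_scale j ^+ 2.
Definition smom_coord_bias j :=
  2 * (2 ^+ q * (q%:R * (4 * (M j / (n%:R * theta ^+ 2))))) * smom_scale j.
Definition smom_bias := Num.sqrt (\sum_j smom_coord_bias j ^+ 2).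

Section at_point.
Variables (k t : nat) (x g : 'rV[R]_d).
Hypothesis sn : structured_noise law (oracle^~ x) g M B beta.

Let N w := smom_answer k t x w - g.

Let mN : vector_measurable N.
Proof.
case: fr => m1 _ m2 _ _; apply: vector_measurableB; last exact: vector_measurable_cst.
by apply: (@vector_measurable_smom _ _ idfun) => // ; exact: vector_measurable_cst.
Qed.

Let mnu l : measurable_fun setT (fun z => oracle z x 0 l - g 0 l).
Proof.
apply: measurable_funB => //; apply: (@measurable_oracle_comp _ _ idfun (fun=> x)).
  exact: measurable_id.
exact: vector_measurable_cst.
Qed.

Let nuE p l : is_density law (fun z => (oracle z x - g) 0 l) p ->
  is_density law (fun z => oracle z x 0 l - g 0 l) p.
Proof.
by rewrite (_ : (fun z => _) = (fun z => oracle z x 0 l - g 0 l))//; apply/funext => z; rewrite !mxE.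
Qed.

Lemma smom_second_moment :
  (\int[P]_w (enorm (N w) ^+ 2)%:E <= smom_variance%:E)%E.
Proof.
under eq_integral do rewrite sqr_enorm /dotv -sumEFin.
rewrite ge0_integral_sum//; first last.
- by move=> j w _; rewrite lee_fin -expr2 sqr_ge0.
- by move=> j; apply/measurable_EFinP; exact: measurable_funM.
rewrite /smom_variance -sumEFin; apply: lee_sum => l _.
have [_ /(_ l)[p [/nuE pd [M0 o1 o2] [B0 b1 sc]]]] := sn.
under eq_integral do rewrite -expr2 /N smom_noiseE//.
apply: (median_second_moment fr (mnu l) pd B0 b1 n0 theta0 (Mn l) o1 o2) => // u.
exact: sc.
Qed.

Lemma smom_noise_integrable l : P.-integrable setT (fun w => (N w 0 l)%:E).
Proof.
have [_ /(_ l)[p [/nuE pd [M0 o1 o2] [B0 b1 sc]]]] := sn.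
rewrite (_ : (fun w => _) = EFin \o median_noise xi eta (fun z => oracle z x 0 l - g 0 l) theta n t k l).
  apply: (median_noise_integrable fr (mnu l) pd B0 b1 n0 theta0 (Mn l) o1 o2) => // u.
  exact: sc.
by apply/funext => w; rewrite /= /N smom_noiseE.
Qed.

Lemma smom_dot_integrable v : P.-integrable setT (fun w => (dotv (N w) v)%:E).
Proof.
rewrite (_ : (fun w => _) = (fun w => \sum_(j <- index_enum 'I_d) (v 0 j)%:E * (N w 0 j)%:E))%E.
  apply: integrable_sum => // j _; apply: integrableZl => //; exact: smom_noise_integrable.
by apply/funext => w; rewrite /dotv -sumEFin; apply: eq_bigr => j _; rewrite mulrC.
Qed.

(** By linearity the integral is the inner product of [v] with the vector of coordinate biases, so
    Cauchy-Schwarz collects the biases in Euclidean norm. *)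
Lemma smom_mean v : `|\int[P]_w dotv (N w) v| <= enorm v * smom_bias.
Proof.
pose e : 'rV[R]_d := \row_j \int[P]_w N w 0 j.
have -> : \int[P]_w dotv (N w) v = dotv e v.
  apply: EFin_inj; rewrite [LHS]fineK; last first.
    by apply: integrable_fin_num => //; exact: smom_dot_integrable.
  transitivity (\int[P]_w (\sum_(j <- index_enum 'I_d) (v 0 j)%:E * (N w 0 j)%:E))%E.
    by apply: eq_integral => w _; rewrite /dotv -sumEFin; apply: eq_bigr => j _; rewrite mulrC.
  rewrite integral_sum//; last first.
    by move=> j; apply: integrableZl => //; exact: smom_noise_integrable.
  rewrite /dotv -sumEFin; apply: eq_bigr => j _; rewrite integralZl//; last exact: smom_noise_integrable.
  rewrite mxE EFinM muleC /Rintegral fineK//.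
  by apply: integrable_fin_num => //; exact: smom_noise_integrable.
apply: le_trans (normr_dotv_le _ _) _; rewrite mulrC ler_wpM2l ?enorm_ge0//.
rewrite enorm_sqrt_sum ler_sqrt; last by apply: sumr_ge0 => j _; exact: sqr_ge0.
apply: ler_sum => l _; rewrite mxE.
have [_ /(_ l)[p [/nuE pd [M0 o1 o2] [B0 b1 sc]]]] := sn.
have h := median_mean fr (mnu l) pd M0 B0 b1 n0 theta0 (Mn l) o1 o2 (fun u => sc n u n0) t k l m3.
have -> : \int[P]_w N w 0 l = \int[P]_w median_noise xi eta (fun z => oracle z x 0 l - g 0 l) theta n t k l w.
  by apply: eq_Rintegral => w _; rewrite /N smom_noiseE.
rewrite -real_normK ?num_real// -[leRHS]real_normK ?num_real// ler_pXn2r ?nnegrE//.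
by apply: le_trans h (ler_norm _).
Qed.

End at_point.
End smom_noise.

(** * The supermartingale argument *)

Lemma measurable_partial_integral (R : realType) (disp d1 d2 : measure_display)
  (T : measurableType disp) (T1 : measurableType d1) (T2 : measurableType d2)
  (P : probability T R) (X : T -> T2) (f : T1 * T2 -> \bar R) :
  measurable_fun setT X -> measurable_fun setT f -> (forall x, 0 <= f x)%E ->
  measurable_fun setT (fun x => \int[P]_w f (x, X w))%E.
Proof.
move=> mX mf f0.
pose i : {mfun T >-> T2} := HB.pack X (isMeasurableFun.Build _ _ _ _ _ mX).
pose P2 : probability T2 R := distribution P i.
have : measurable_fun setT (fubini_F P2 f) by exact: measurable_fun_fubini_tonelli_F.
congr (measurable_fun _ _); apply/funext => x; rewrite /fubini_F.
rewrite ge0_integral_distribution//=; exact: measurableT_comp.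
Qed.

Section decoupling_bound.
Context (R : realType) (d q : nat) (disp : measure_display)
  (T : measurableType disp) (disp' : measure_display)
  (Xi : measurableType disp') (P : probability T R) (law : probability Xi R)
  (xi : nat -> T -> Xi) (eta : nat -> 'I_q -> T -> 'rV[R]_d).
Hypothesis fr : fresh_randomness P law xi eta.

(** A conditional bound read on the diagonal: [w] carries the inputs in [D1], [w'] those in [D2],
    and the hypothesis bounds the integral over [w'] with [w] frozen. *)
Lemma decoupling_bound (D1 D2 : set (nat + nat * 'I_q * 'I_d)) (f : T -> T -> \bar R) (h : T -> \bar R) :
  D1 `&` D2 = set0 ->
  measurable_fun setT
    ((fun p => f p.1 p.2) : (generated_type xi eta D1 * generated_type xi eta D2)%type -> \bar R) ->
  (forall w w', 0 <= f w w')%E -> measurable_fun setT h ->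
  (forall w, \int[P]_w' f w w' <= h w)%E ->
  (\int[P]_w f w w <= \int[P]_w h w)%E.
Proof.
move=> D12 mf f0 mh fh.
have m1 : measurable_fun setT (idfun : generated_type xi eta D1 -> generated_type xi eta D1).
  exact: measurable_id.
have m2 : measurable_fun setT (idfun : generated_type xi eta D2 -> generated_type xi eta D2).
  exact: measurable_id.
have E := fresh_decoupling fr D12 m1 m2 mf (fun z => f0 z.1 z.2).
rewrite /= in E; rewrite E.
apply: ge0_le_integral => //.
- by move=> w _; exact: integral_ge0.
- apply: (generated_measurable fr (D := D1)).
  exact: (measurable_partial_integral P (generated_measurable fr m2) mf (fun z => f0 z.1 z.2)).
Qed.

End decoupling_bound.

Section run.
Context (R : realType) (d m : nat) (disp : measure_display)
  (T : measurableType disp) (disp' : measure_display) (Xi : measurableType disp')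
  (xi : nat -> T -> Xi) (eta : nat -> 'I_(m.*2.+1) -> T -> 'rV[R]_d)
  (oracle : Xi -> 'rV[R]_d -> 'rV[R]_d) (n : nat) (theta : R)
  (a L : R) (lam : nat -> R) (x0 : 'rV[R]_d).

Definition sstm_run (w : T) (k : nat) : sstm_state R d :=
  clipped_sstm a L lam
    (smom_estimator n theta (fun t => oracle (xi t w)) (fun k j => eta k j w)) x0 k.

(** The index of the first oracle call of iteration [k]. It does not depend on the outcome, so each
    iteration uses a fixed set of inputs. *)
Definition sstm_batch (k : nat) : nat := k * (m.*2.+1 * n).

Definition sstm_next_z (k : nat) (y z : 'rV[R]_d) (w : T) : 'rV[R]_d :=
  z - alpha a L k.+1 *: clip (smom_answer xi eta oracle n theta k (sstm_batch k)
                                (sstm_point L a k y z) w) (lam k).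

Definition sstm_next_y (k : nat) (y z : 'rV[R]_d) (w : T) : 'rV[R]_d :=
  sstm_point L a k y (sstm_next_z k y z w).

Lemma sstm_run_calls w k : sstm_calls (sstm_run w k) = sstm_batch k.
Proof.
rewrite /sstm_run; elim: k => [//|k IH] /=.
by rewrite /sstm_step (smom_estimatorE xi eta oracle) /= IH /sstm_batch mulSn addnC.
Qed.

Lemma sstm_runS w k : let s := sstm_run w k in
  (sstm_z (sstm_run w k.+1) = sstm_next_z k (sstm_y s) (sstm_z s) w) /\
  (sstm_y (sstm_run w k.+1) = sstm_next_y k (sstm_y s) (sstm_z s) w).
Proof.
move=> s; rewrite /sstm_run /= /sstm_step (smom_estimatorE xi eta oracle) /=.
by rewrite -/(sstm_run w k) sstm_run_calls.
Qed.

Definition history (k : nat) : set (nat + nat * 'I_(m.*2.+1) * 'I_d) :=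
  [set i | match i with inl t => (t < sstm_batch k)%N | inr (k', _, _) => (k' < k)%N end].

Definition step_index (k : nat) : set (nat + nat * 'I_(m.*2.+1) * 'I_d) :=
  [set i | match i with inl t => (sstm_batch k <= t)%N | inr (k', _, _) => k' = k end].

Lemma history_step_disjoint k : history k `&` step_index k = set0.
Proof.
apply/seteqP; split => // -[t|[[k' j] l]] [] /=.
  by move=> h1 h2; have := leq_ltn_trans h2 h1; rewrite ltnn.
by move=> h1 h2; rewrite h2 ltnn in h1.
Qed.

Hypothesis mor : jointly_measurable oracle.

Section measurable_step.
Context (d1 : measure_display) (T1 : measurableType d1) (om : T1 -> T) (y z : T1 -> 'rV[R]_d)
  (k : nat).
Hypothesis mxi : forall i, (i < m.*2.+1 * n)%N ->
  measurable_fun setT (fun w => xi (sstm_batch k + i)%N (om w)).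
Hypothesis meta : forall j l, measurable_fun setT (fun w => eta k j (om w) 0 l).
Hypotheses (my : vector_measurable y) (mz : vector_measurable z).

Lemma vector_measurable_point (z' : T1 -> 'rV[R]_d) : vector_measurable z' ->
  vector_measurable (fun w => sstm_point L a k (y w) (z' w)).
Proof.
move=> mz'; apply: vector_measurableZ => //.
by apply: vector_measurableD; exact: vector_measurableZ.
Qed.

Lemma vector_measurable_next_z : vector_measurable (fun w => sstm_next_z k (y w) (z w) (om w)).
Proof.
apply: vector_measurableB => //; apply: vector_measurableZ => //.
apply: vector_measurable_clip; apply: vector_measurable_smom => //.
exact: vector_measurable_point.
Qed.

Lemma vector_measurable_next_y : vector_measurable (fun w => sstm_next_y k (y w) (z w) (om w)).
Proof. exact: vector_measurable_point vector_measurable_next_z. Qed.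

End measurable_step.

Lemma sstm_run_measurable k (D : set (nat + nat * 'I_(m.*2.+1) * 'I_d)) : history k `<=` D ->
  vector_measurable ((fun w => sstm_y (sstm_run w k)) : generated_type xi eta D -> 'rV[R]_d) /\
  vector_measurable ((fun w => sstm_z (sstm_run w k)) : generated_type xi eta D -> 'rV[R]_d).
Proof.
elim: k => [|k IH] hD; first by split; exact: vector_measurable_cst.
have [|my mz] := IH.
  move=> [t|[[k' j] l]] /= h; apply: hD => /=; last exact: ltnW.
  by apply: (leq_trans h); rewrite leq_mul2r leqnSn orbT.
have mxi i : (i < m.*2.+1 * n)%N ->
    measurable_fun setT ((fun w => xi (sstm_batch k + i)%N w) : generated_type xi eta D -> Xi).
  move=> hi; apply: measurable_seed; apply: hD => /=.
  by rewrite /sstm_batch mulSn addnC ltn_add2r.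
have meta j l : measurable_fun setT ((fun w => eta k j w 0 l) : generated_type xi eta D -> R).
  by apply: measurable_gauss; apply: hD => /=.
split.
  rewrite (_ : (fun w => _) = (fun w => sstm_next_y k (sstm_y (sstm_run w k)) (sstm_z (sstm_run w k)) w)).
    exact: (@vector_measurable_next_y _ (generated_type xi eta D) idfun).
  by apply/funext => w; have [] := sstm_runS w k.
rewrite (_ : (fun w => _) = (fun w => sstm_next_z k (sstm_y (sstm_run w k)) (sstm_z (sstm_run w k)) w)).
  exact: (@vector_measurable_next_z _ (generated_type xi eta D) idfun).
by apply/funext => w; have [] := sstm_runS w k.
Qed.

End run.

(** * The probability of leaving the confined region *)

Section exit_probability.
Context (R : realType) (d m : nat) (disp : measure_display)
  (T : measurableType disp) (disp' : measure_display) (Xi : measurableType disp')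
  (P : probability T R) (law : probability Xi R)
  (xi : nat -> T -> Xi) (eta : nat -> 'I_(m.*2.+1) -> T -> 'rV[R]_d)
  (oracle : Xi -> 'rV[R]_d -> 'rV[R]_d) (n : nat) (theta : R) (M B beta : 'I_d -> R).
Hypothesis fr : fresh_randomness P law xi eta.
Hypothesis mor : jointly_measurable oracle.
Hypotheses (m3 : (3 <= m)%N) (n0 : (0 < n)%N) (theta0 : 0 < theta).
Hypothesis Mn : forall j, M j <= n%:R * theta ^+ 2.
Variables (f : 'rV[R]_d -> R) (G : 'rV[R]_d -> 'rV[R]_d) (xs x0 : 'rV[R]_d).
Variables (r L a A : R).
Hypotheses (r0 : 0 < r) (L0 : 0 < L) (A1 : 1 <= A) (aA : (168 * A) ^+ 2 <= a).
Hypothesis fmin : forall x, f xs <= f x.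
Hypothesis Gxs : G xs = 0.
Hypothesis Glip : forall x y, eball xs (3 * r) x -> eball xs (3 * r) y ->
  enorm (G x - G y) <= L * enorm (x - y).
Hypothesis Gsqr : forall x, eball xs (3 * r) x ->
  enorm (G x) ^+ 2 <= 2 * L * (f x - f xs).
Hypothesis fconv : forall x y, eball xs (3 * r) x -> eball xs (3 * r) y ->
  f x + dotv (G x) (y - x) <= f y.
Hypothesis cf : continuous f.
Hypothesis sn : forall x, structured_noise law (oracle^~ x) (G x) M B beta.
Hypothesis x0r : enorm (x0 - xs) <= r.
Variable l0 : 'I_d.

Let lam k := 16^-1 * (r / (alpha a L k.+1 * A)).
Let run := sstm_run xi eta oracle n theta a L lam x0.
Let pot k w := potential f xs L a k (sstm_y (run w k)) (sstm_z (run w k)).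
Let s := 2 * A / r ^+ 2.
Let V := smom_variance m n theta B beta.
Let bias := smom_bias m n theta M B beta.

Let a0 : 0 < a.
Proof. by apply: lt_le_trans aA; rewrite exprn_gt0// mulr_gt0// (lt_le_trans ltr01). Qed.

Let A0 : 0 < A. Proof. exact: lt_le_trans ltr01 A1. Qed.

Let s0 : 0 < s. Proof. by rewrite divr_gt0 ?mulr_gt0// exprn_gt0. Qed.

(** The indicator of this event takes the place of a stopping time. *)
Definition sstm_alive (k : nat) : set T :=
  \big[setI/setT]_(i < k.+1) [set w | pot i w <= 3 / 2 * r ^+ 2].

Lemma sstm_aliveS k : sstm_alive k.+1 = sstm_alive k `&` [set w | pot k.+1 w <= 3 / 2 * r ^+ 2].
Proof. by rewrite /sstm_alive big_ord_recr. Qed.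

Let alive_pot k w : sstm_alive k w -> pot k w <= 3 / 2 * r ^+ 2.
Proof. by rewrite /sstm_alive big_ord_recr => -[]. Qed.

Lemma sstm_alive_confined k w : sstm_alive k w ->
  confined f xs r L a k (sstm_y (run w k)) (sstm_z (run w k)).
Proof.
elim: k => [|k IH]; first by move=> _; case: (confined_init f L a r0 x0r).
move=> h; have := h; rewrite sstm_aliveS => -[/IH c _].
have [zE yE] := sstm_runS xi eta oracle n theta a L lam x0 w k.
have := alive_pot h; rewrite /pot /run zE yE => p.
exact: (confined_step r0 L0 A1 aA fmin Glip fconv _ c).2.
Qed.

(** The first term is [s * alpha * 2 r * bias], the bias paired with [|z - xs| <= 2 r]; the second
    is the variance with the constant of [clipped_exp_le]. *)
Definition sstm_log_growth (k : nat) : R :=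
  4 * A * alpha a L k.+1 * bias / r + 424 * (alpha a L k.+1 * A / r) ^+ 2 * V.

Let next k y z w := potential f xs L a k.+1
  (sstm_next_y xi eta oracle n theta a L lam k y z w)
  (sstm_next_z xi eta oracle n theta a L lam k y z w).

Let pot_next k w : pot k.+1 w = next k (sstm_y (run w k)) (sstm_z (run w k)) w.
Proof.
by rewrite /pot /run; have [-> ->] := sstm_runS xi eta oracle n theta a L lam x0 w k.
Qed.

Let measurable_potential (d1 : measure_display) (T1 : measurableType d1) k
  (y z : T1 -> 'rV[R]_d) : vector_measurable y -> vector_measurable z ->
  measurable_fun setT (fun w => potential f xs L a k (y w) (z w)).
Proof.
move=> my mz; apply: measurable_funD; apply: measurable_funM => //.
  apply: measurable_funX; apply: measurable_enorm; apply: vector_measurableB => //.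
by apply: measurable_funB => //; exact: measurable_continuous_comp.
Qed.

Let measurable_pot k (D : set (nat + nat * 'I_(m.*2.+1) * 'I_d)) : history n k `<=` D ->
  measurable_fun setT (pot k : generated_type xi eta D -> R).
Proof.
move=> hD.
have [my mz] := @sstm_run_measurable _ _ _ _ _ _ _ xi eta oracle n theta a L lam x0 mor k D hD.
exact: measurable_potential.
Qed.

Let measurable_alive k (D : set (nat + nat * 'I_(m.*2.+1) * 'I_d)) : history n k `<=` D ->
  measurable (sstm_alive k : set (generated_type xi eta D)).
Proof.
move=> hD; apply: bigsetI_measurable => i _.
rewrite (_ : [set w | _] = pot i @^-1` `]-oo, (3 / 2 * r ^+ 2)]); last by rewrite preimage_itvNyc.
have hi : history n i `<=` D.
  have ik : (i <= k)%N by rewrite -ltnS.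
  move=> [t|[[k' j] l]] /= h; apply: hD => /=; last exact: leq_trans ik.
  by apply: (leq_trans h); rewrite leq_mul2r ik orbT.
have := measurable_pot hi measurableT (measurable_itv `]-oo, (3 / 2 * r ^+ 2)]).
by rewrite setTI.
Qed.

(** With the state frozen, the bound on the clipped exponential is linear in the error and in its
    square, so that the mean and the second moment suffice; [1 + c <= exp c] concludes. *)
Lemma step_expectation k y z : confined f xs r L a k y z ->
  (\int[P]_w (expR (s * next k y z w))%:E <=
   (expR (s * potential f xs L a k y z) * expR (sstm_log_growth k))%:E)%E.
Proof.
move=> c; have al0 := alpha_gt0 a0 L0 k; set al := alpha a L k.+1 in al0.
set x := sstm_point L a k y z.
pose g w := smom_answer xi eta oracle n theta k (sstm_batch m n k) x w.
have zr := confined_z r0 L0 A1 aA fmin c.1.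
have Gl := confined_grad r0 L0 A1 aA fmin Gxs Glip Gsqr c.
pose e := expR (s * potential f xs L a k y z).
pose h w := 1 - s * al * dotv (g w - G x) (z - xs) + 424 * (al * A / r) ^+ 2 * enorm (g w - G x) ^+ 2.
have mg : vector_measurable g.
  case: fr => m1 _ m2 _ _.
  by apply: (@vector_measurable_smom _ _ _ _ _ _ _ _ _ _ _ _ mor _ _ idfun) => //; exact: vector_measurable_cst.
have mgG : vector_measurable (fun w => g w - G x).
  by apply: vector_measurableB => //; exact: vector_measurable_cst.
have bound w : expR (s * next k y z w) <= e * h w.
  have := (confined_step r0 L0 A1 aA fmin Glip fconv (g w) c).1.
  rewrite -/x -/al => step.
  apply: (@le_trans _ _ (expR (s * potential f xs L a k y z + s * (- al * dotv (clip (g w) (lam k) - G x) (z - xs)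
       + al ^+ 2 * enorm (clip (g w) (lam k) - G x) ^+ 2)))).
    by rewrite ler_expR -mulrDr ler_pM2l.
  rewrite expRD ler_pM2l ?expR_gt0//.
  have := @clipped_exp_le R d r A al (lam k) (z - xs) (g w) (G x) r0 A1 al0 erefl zr Gl.
  by rewrite /h /s.
have mnext : measurable_fun setT (next k y z).
  case: fr => m1 _ m2 _ _.
  have hy := @vector_measurable_cst R d _ T y; have hz := @vector_measurable_cst R d _ T z.
  apply: measurable_potential.
    by apply: (@vector_measurable_next_y _ _ _ _ _ _ _ _ _ _ _ _ _ _ _ mor _ _ idfun (fun=> y) (fun=> z)) => //.
  by apply: (@vector_measurable_next_z _ _ _ _ _ _ _ _ _ _ _ _ _ _ _ mor _ _ idfun (fun=> y) (fun=> z)) => //.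
have md : measurable_fun setT (fun w => dotv (g w - G x) (z - xs)).
  by apply: measurable_dotv => //; exact: vector_measurable_cst.
have men : measurable_fun setT (fun w => enorm (g w - G x) ^+ 2).
  by apply: measurable_funX; exact: measurable_enorm.
have mh : measurable_fun setT h.
  apply: measurable_funD; last exact: measurable_funM.
  by apply: measurable_funB => //; exact: measurable_funM.
have sm := smom_second_moment mor fr m3 n0 theta0 Mn k (sstm_batch m n k) (sn x).
have sd := smom_dot_integrable mor fr m3 n0 theta0 Mn k (sstm_batch m n k) (sn x) (z - xs).
have sb := smom_mean mor fr m3 n0 theta0 Mn k (sstm_batch m n k) (sn x) (z - xs).
have ien : P.-integrable setT (fun w => (enorm (g w - G x) ^+ 2)%:E).
  apply/integrableP; split; first exact/measurable_EFinP.
  rewrite (eq_integral (fun w => (enorm (g w - G x) ^+ 2)%:E)); last first.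
    by move=> w _; rewrite gee0_abs// lee_fin sqr_ge0.
  by apply: le_lt_trans sm _; exact: ltry.
apply: (@le_trans _ _ (\int[P]_w (e%:E * (h w)%:E))%E).
  apply: ge0_le_integral => //.
  - by apply/measurable_EFinP; apply: measurableT_comp => //; exact: measurable_funM.
  - by apply: measurable_funeM; exact/measurable_EFinP.
  - by move=> w _; rewrite -EFinM lee_fin.
(* [h] dominates an exponential, so it is nonnegative although its linear term has no sign. *)
have h_ge0 w : 0 <= h w.
  by have := le_trans (expR_ge0 _) (bound w); rewrite pmulr_rge0// expR_gt0.
rewrite ge0_integralZl//; first last.
- by rewrite lee_fin expR_ge0.
- by move=> w _; rewrite lee_fin.
- exact/measurable_EFinP.
rewrite EFinM; apply: lee_pmul => //.
- by rewrite lee_fin expR_ge0.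
- by apply: integral_ge0 => w _; rewrite lee_fin.
have -> : (\int[P]_w (h w)%:E = 1 - (s * al)%:E * \int[P]_w (dotv (g w - G x) (z - xs))%:E
    + (424 * (al * A / r) ^+ 2)%:E * \int[P]_w (enorm (g w - G x) ^+ 2)%:E)%E.
  transitivity (\int[P]_w (1 - (s * al)%:E * (dotv (g w - G x) (z - xs))%:E
    + (424 * (al * A / r) ^+ 2)%:E * (enorm (g w - G x) ^+ 2)%:E))%E; first by [].
  have i1 : P.-integrable setT (fun w => (s * al)%:E * (dotv (g w - G x) (z - xs))%:E)%E.
    exact: integrableZl.
  have i2 : P.-integrable setT (fun w => (424 * (al * A / r) ^+ 2)%:E * (enorm (g w - G x) ^+ 2)%:E)%E.
    exact: integrableZl.
  have i3 : P.-integrable setT (fun=> 1%E : \bar R) by exact: finite_measure_integrable_cst.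
  rewrite integralD//; last exact: integrableB.
  by rewrite integralB// integral_cst//= probability_setT mule1 !integralZl.
have -> : (\int[P]_w (dotv (g w - G x) (z - xs))%:E = (\int[P]_w dotv (g w - G x) (z - xs))%:E)%E.
  by rewrite /Rintegral fineK//; exact: integrable_fin_num.
have c1 : 0 <= 424 * (al * A / r) ^+ 2 by apply: mulr_ge0; [exact: ler0n|exact: sqr_ge0].
apply: (@le_trans _ _ (1 + (s * al * (2 * r * bias))%:E + (424 * (al * A / r) ^+ 2 * V)%:E)%E).
  apply: leeD; last by rewrite [(_ * V)%:E]EFinM; apply: lee_wpmul2l => //; rewrite lee_fin.
  rewrite -EFinM -EFinB lee_fin lerD2l -mulrN ler_pM2l; last exact: mulr_gt0 s0 al0.
  apply: le_trans (ler_norm _) _; rewrite normrN; apply: le_trans sb _.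
  by rewrite ler_wpM2r// sqrtr_ge0.
rewrite -!EFinD lee_fin; apply: le_trans (expR_ge1Dx _).
rewrite -addrA lerD2l lerD2r /s -/al.
by rewrite le_eqVlt; apply/orP; left; apply/eqP; field; rewrite gt_eqF.
Qed.

Let u k := (\int[P]_w (\1_(sstm_alive k) w * expR (s * pot k w))%:E)%E.

Let step_bound k :
  (\int[P]_w (\1_(sstm_alive k) w * expR (s * pot k.+1 w))%:E <= (expR (sstm_log_growth k))%:E * u k)%E.
Proof.
(* The past enters through [w] and the new batch through [w']; for fixed [w] the bound at a frozen
   state applies. *)
pose F w w' := (\1_(sstm_alive k) w * expR (s * next k (sstm_y (run w k)) (sstm_z (run w k)) w'))%:E.
have -> : (\int[P]_w (\1_(sstm_alive k) w * expR (s * pot k.+1 w))%:E = \int[P]_w F w w)%E.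
  by apply: eq_integral => w _; rewrite /F pot_next.
have mA : measurable (sstm_alive k).
  have mT := measurable_alive (subsetT (history n k)).
  exact: (sub_sigma_measurable (events_of_measurable fr) mT).
have mp : measurable_fun setT (pot k).
  exact: (generated_measurable fr (measurable_pot (subsetT (history n k)))).
have mup : measurable_fun setT (fun w => (\1_(sstm_alive k) w * expR (s * pot k w))%:E).
  apply/measurable_EFinP; apply: measurable_funM; first exact: measurable_indic.
  by apply: measurableT_comp => //; exact: measurable_funM.
have -> : ((expR (sstm_log_growth k))%:E * u k = \int[P]_w ((expR (sstm_log_growth k))%:E *
    (\1_(sstm_alive k) w * expR (s * pot k w))%:E))%E.
  by rewrite ge0_integralZl.
have db := @decoupling_bound R d m.*2.+1 disp T disp' Xi P law xi eta fr _ _ F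
  (fun w => (expR (sstm_log_growth k))%:E * (\1_(sstm_alive k) w * expR (s * pot k w))%:E)%E (@history_step_disjoint _ _ n k).
apply: db.
- apply/measurable_EFinP; apply: measurable_funM.
    have mi : measurable_fun setT (\1_(sstm_alive k) : generated_type xi eta (history n k) -> R).
      apply: measurable_indic; exact: (measurable_alive (@subset_refl _ _)).
    exact: (measurableT_comp mi measurable_fst).
  apply: measurableT_comp => //; apply: measurable_funM => //.
  have [my mz] := @sstm_run_measurable _ _ _ _ _ _ _ xi eta oracle n theta a L lam x0 mor k
    (history n k) (@subset_refl _ _).
  pose T12 : measurableType _ := (generated_type xi eta (history n k) *
    generated_type xi eta (step_index n k))%type.
  have my1 : vector_measurable ((fun p => sstm_y (run p.1 k)) : T12 -> 'rV[R]_d).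
    by move=> l; exact: (measurableT_comp (my l) measurable_fst).
  have mz1 : vector_measurable ((fun p => sstm_z (run p.1 k)) : T12 -> 'rV[R]_d).
    by move=> l; exact: (measurableT_comp (mz l) measurable_fst).
  have mxi i : (i < m.*2.+1 * n)%N ->
      measurable_fun setT ((fun p => xi (sstm_batch m n k + i)%N p.2) : T12 -> Xi).
    move=> hi; have ms : measurable_fun setT (xi (sstm_batch m n k + i)%N : generated_type xi eta (step_index n k) -> Xi).
      by apply: measurable_seed => /=; exact: leq_addr.
    exact: (measurableT_comp ms measurable_snd).
  have meta j l : measurable_fun setT ((fun p => eta k j p.2 0 l) : T12 -> R).
    have ms : measurable_fun setT ((fun w => eta k j w 0 l) : generated_type xi eta (step_index n k) -> R).
      exact: measurable_gauss.
    exact: (measurableT_comp ms measurable_snd).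
  apply: (@measurable_potential _ T12).
    exact: (@vector_measurable_next_y _ _ _ _ _ _ _ _ _ _ _ _ _ _ _ mor _ T12 snd).
  exact: (@vector_measurable_next_z _ _ _ _ _ _ _ _ _ _ _ _ _ _ _ mor _ T12 snd).
- by move=> w w'; rewrite lee_fin mulr_ge0// expR_ge0.
- exact: measurable_funeM.
move=> w; rewrite /F; rewrite indicE; have [wA|wA] := boolP (w \in _); last first.
  by under eq_integral do rewrite mul0r; rewrite integral0 mul0r mule0.
under eq_integral do rewrite mul1r.
rewrite mul1r -EFinM mulrC; apply: step_expectation.
by apply: sstm_alive_confined; rewrite inE in wA.
Qed.

(** The start contributes [s * r^2 / 2 = A]; each step first forgets the newest indicator, then
    applies [step_bound]. *)
Let u_bound k : (u k <= (expR (A + \sum_(i < k) sstm_log_growth i))%:E)%E.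
Proof.
elim: k => [|k IH].
  rewrite big_ord0 addr0 /u; apply: (@le_trans _ _ (\int[P]_w (cst (expR A)%:E w))%E).
    apply: ge0_le_integral => //.
    - have mT := measurable_alive (subsetT (history n 0)).
      apply/measurable_EFinP; apply: measurable_funM.
        apply: measurable_indic; exact: (sub_sigma_measurable (events_of_measurable fr) mT).
      by have -> : (fun w => expR (s * pot 0 w)) = cst (expR (s * potential f xs L a 0 x0 x0)).
    - move=> w _; rewrite lee_fin indicE; case: (_ \in _); last by rewrite mul0r expR_ge0.
      rewrite mul1r ler_expR; have [_ h] := confined_init f L a r0 x0r.
      apply: (@le_trans _ _ (s * (r ^+ 2 / 2))); first by rewrite ler_pM2l.
      by rewrite le_eqVlt; apply/orP; left; apply/eqP; rewrite /s; field; rewrite gt_eqF.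
  by rewrite integral_cst//= probability_setT mule1.
apply: (@le_trans _ _ (\int[P]_w (\1_(sstm_alive k) w * expR (s * pot k.+1 w))%:E)%E).
  have mk i : measurable (sstm_alive i).
    have mT := measurable_alive (subsetT (history n i)).
    exact: (sub_sigma_measurable (events_of_measurable fr) mT).
  have mp : measurable_fun setT (pot k.+1).
    exact: (generated_measurable fr (measurable_pot (subsetT (history n k.+1)))).
  apply: ge0_le_integral => //.
  - apply/measurable_EFinP; apply: measurable_funM; first exact: measurable_indic.
    by apply: measurableT_comp => //; exact: measurable_funM.
  - apply/measurable_EFinP; apply: measurable_funM; first exact: measurable_indic.
    by apply: measurableT_comp => //; exact: measurable_funM.
  - move=> w _; rewrite lee_fin ler_wpM2r ?expR_ge0// !indicE sstm_aliveS in_setI.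
    by case: (w \in sstm_alive k); rewrite //= lern1 leq_b1.
apply: le_trans (step_bound k) _.
have -> : expR (A + \sum_(i < k.+1) sstm_log_growth i) =
    expR (sstm_log_growth k) * expR (A + \sum_(i < k) sstm_log_growth i).
  by rewrite -expRD big_ord_recr/=; congr expR; ring.
rewrite EFinM.
by apply: lee_wpmul2l => //; rewrite lee_fin expR_ge0.
Qed.

Lemma exit_probability K : \sum_(k < K) sstm_log_growth k <= A ->
  (forall k, 0 <= sstm_log_growth k) ->
  measurable (sstm_alive K) /\ (P (~` sstm_alive K) <= (K%:R * expR (- A))%:E)%E.
Proof.
move=> sumA g0.
have mk i : measurable (sstm_alive i).
  have mT := measurable_alive (subsetT (history n i)).
  exact: (sub_sigma_measurable (events_of_measurable fr) mT).
have mp i : measurable_fun setT (pot i).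
  exact: (generated_measurable fr (measurable_pot (subsetT (history n i)))).
split => //.
have {sumA} : forall k, (k <= K)%N -> \sum_(i < k) sstm_log_growth i <= A.
  move=> k kK; apply: le_trans sumA.
  by rewrite -(subnKC kK) big_split_ord/= lerDl sumr_ge0.
elim: K => [|K IH] sumA.
  rewrite mul0r (_ : ~` _ = set0) ?measure0//; apply/seteqP; split => // w; apply.
  rewrite /sstm_alive big_ord_recr big_ord0 /=; split => //.
  by have [[h _] _] := confined_init f L a r0 x0r; exact: h.
(* Exit is split by its first time, so that each piece starts from a confined state. *)
have sub : ~` sstm_alive K.+1 = ~` sstm_alive K `|` (sstm_alive K `&` [set w | 3 / 2 * r ^+ 2 < pot K.+1 w]).
  rewrite sstm_aliveS setCI; apply/seteqP; split => w /=.
    have [h|h] := pselect (sstm_alive K w); last by move=> _; left.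
    by move=> [//|/negP]; rewrite -ltNge => h'; right.
  by move=> [h|[_ h]]; [left|right; apply/negP; rewrite -ltNge].
have mE : measurable (sstm_alive K `&` [set w | 3 / 2 * r ^+ 2 < pot K.+1 w]).
  apply: measurableI => //; apply: measurable_gt_set; exact: mp.
rewrite sub; apply: (@le_trans _ _ (P (~` sstm_alive K) +
    P (sstm_alive K `&` [set w | (3 / 2 * r ^+ 2 < pot K.+1 w)%R]))%E).
  by apply: measureU2 => //; exact: measurableC.
have -> : K.+1%:R = K%:R + 1 :> R by rewrite natr1.
rewrite [(K%:R + 1) * _]mulrDl mul1r EFinD; apply: leeD; first by apply: IH => k kK; apply: sumA; exact: leqW.
have [e3 e3E] : exists e3 : R, e3 = expR (- (3 * A)) by eexists.
have e30 : 0 <= e3 by rewrite e3E expR_ge0.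
(* [e3] is the Markov factor at the exit level; [expR (A + A)] bounds the exponential moment, one
   [A] for the start and one for the total growth. *)
have -> : expR (- A) = e3 * expR (A + A) by rewrite e3E -expRD; congr expR; ring.
rewrite (@prob_integral_indic _ _ _ P _ mE).
apply: (@le_trans _ _ (\int[P]_w (e3%:E * (\1_(sstm_alive K) w * expR (s * pot K.+1 w))%:E))%E).
  apply: ge0_le_integral => //.
  - by apply/measurable_EFinP; exact: measurable_indic.
  - apply: measurable_funeM; apply/measurable_EFinP; apply: measurable_funM; first exact: measurable_indic.
    by apply: measurableT_comp => //; exact: measurable_funM.
  - move=> w _; rewrite -EFinM lee_fin !indicE in_setI.
    case: (w \in sstm_alive K); rewrite /= ?mul0r ?mulr0// mul1r.
    have [|_] := boolP (w \in _); last by rewrite mulr_ge0// expR_ge0.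
    rewrite inE /= => h; rewrite e3E -expRD -[leLHS]expR0 ler_expR.
    have : s * (3 / 2 * r ^+ 2) <= s * pot K.+1 w by rewrite ler_pM2l// ltW.
    have -> : s * (3 / 2 * r ^+ 2) = 3 * A by rewrite /s; field; rewrite gt_eqF.
    lra.
rewrite ge0_integralZl//; last first.
  apply/measurable_EFinP; apply: measurable_funM; first exact: measurable_indic.
  by apply: measurableT_comp => //; exact: measurable_funM.
rewrite EFinM; apply: lee_wpmul2l; first by rewrite lee_fin.
apply: le_trans (step_bound K) _.
apply: (@le_trans _ _ ((expR (sstm_log_growth K))%:E * (expR (A + \sum_(i < K) sstm_log_growth i))%:E)%E).
  by apply: lee_wpmul2l => //; rewrite lee_fin expR_ge0.
rewrite -EFinM lee_fin -expRD ler_expR addrCA lerD2l addrC.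
by have := sumA K.+1 (leqnn _); rewrite big_ord_recr.
Qed.

End exit_probability.

(** * Constants *)

Section constants_bounds.
Context (R : realType).

Lemma powR_scaled (beta x : R) : 0 < beta -> 0 <= x ->
  (2 `^ beta * x) `^ (2 / beta) = 4 * (x `^ (1 / beta)) ^+ 2.
Proof.
move=> b0 x0; rewrite powRM ?powR_ge0// -!powRrM mulrCA divff ?gt_eqF// mulr1.
have -> : 2 `^ 2 = 4 :> R by rewrite -[X in 2 `^ X]/(2%:R) powR_mulrn//; lra.
by rewrite -[in RHS]powR_mulrn ?powR_ge0// -powRrM; congr (_ * _ `^ _); rewrite mul1r mulrC.
Qed.

(** The factor [beta] inside [Dconst] costs only a constant, because [beta <= exp(beta)] bounds
    [beta^(1 / beta)] by [e]. *)
Lemma powR_inv_ge (beta x : R) : 1 <= beta -> 0 <= x ->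
  expR (-1) * x `^ (1 / beta) <= (x / beta) `^ (1 / beta).
Proof.
move=> b1 x0; have b0 : 0 < beta by exact: lt_le_trans b1.
rewrite powRM ?invr_ge0 ?(ltW b0)// mulrC ler_wpM2l ?powR_ge0//.
have -> : expR (-1) = expR (- beta) `^ (1 / beta) :> R.
  rewrite /powR gt_eqF ?expR_gt0// expRK; congr expR; field; rewrite gt_eqF//.
have b0' := ltW b0.
apply: ge0_ler_powR; rewrite ?nnegrE ?expR_ge0 ?invr_ge0//; first by rewrite divr_ge0.
rewrite expRN lef_pV2 ?posrE ?expR_gt0//.
by apply: le_trans (expR_ge1Dx beta); lra.
Qed.

Context (d m n : nat) (theta : R) (M B beta : 'I_d -> R).
Hypotheses (n0 : (0 < n)%N) (theta0 : 0 < theta).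
Hypotheses (M0 : forall j, 0 < M j) (B0 : forall j, 0 < B j) (beta1 : forall j, 1 <= beta j).

Let tau j := tail_scale (B j) (beta j) n.
Let q := m.*2.+1.
Let y j := B j / n%:R `^ (beta j - 1).

Let y0 j : 0 <= y j.
Proof. by rewrite divr_ge0 ?powR_ge0// ltW. Qed.

Let b0 j : 0 < beta j.
Proof. exact: lt_le_trans (beta1 j). Qed.

Let nr0 : 0 < n%:R :> R. Proof. by rewrite ltr0n. Qed.

(** The power [2 / beta] turns [2^beta] into 4 and the remaining quotient into the square of the
    tail scale. *)
Lemma CconstE : Cconst theta n M B beta =
  (1 + theta) / theta ^+ 2 * Num.sqrt (\sum_(j < d) M j ^+ 2)
  + 2 / theta ^+ 2 * Num.sqrt (\sum_(j < d) (M j * tau j) ^+ 2).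
Proof.
rewrite /Cconst; congr (_ + _).
have -> : \sum_(j < d) M j ^+ 2 * (2 `^ beta j * B j / n%:R `^ (beta j - 1)) `^ (2 / beta j) =
    2 ^+ 2 * \sum_(j < d) (M j * tau j) ^+ 2.
  rewrite mulr_sumr; apply: eq_bigr => j _; rewrite -[2 `^ _ * _ / _]mulrA (powR_scaled (b0 j) (y0 j)).
  by rewrite /tau /tail_scale -/(y j); ring.
by rewrite sqrtrM ?sqr_ge0// sqrtr_sqr ger0_norm//; ring.
Qed.

Lemma Cconst_ge0 : 0 <= Cconst theta n M B beta.
Proof.
by rewrite CconstE addr_ge0// mulr_ge0 ?sqrtr_ge0// divr_ge0 ?sqr_ge0// addr_ge0// ltW.
Qed.

(** The vector of coordinate biases is a multiple of [v + theta *: u], and the triangle inequality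
    yields the two terms of [Cconst]. The constant is [192 = 2 * 4 * 24]. *)
Lemma smom_bias_le : smom_bias m n theta M B beta <=
  192 * (q%:R * 2 ^+ q) * (Cconst theta n M B beta / n%:R).
Proof.
pose u : 'rV[R]_d := \row_j M j; pose v : 'rV[R]_d := \row_j (M j * tau j).
pose k := 192 * (q%:R * 2 ^+ q) / (n%:R * theta ^+ 2) : R.
have k0 : 0 <= k.
  apply: divr_ge0; first by apply: mulr_ge0; [exact: ler0n|apply: mulr_ge0 => //; exact: exprn_ge0].
  by apply: mulr_ge0 => //; exact: sqr_ge0.
have -> : smom_bias m n theta M B beta = enorm (k *: (v + theta *: u)).
  rewrite enorm_sqrt_sum /smom_bias; congr Num.sqrt; apply: eq_bigr => j _; congr (_ ^+ 2).
  rewrite !mxE /smom_coord_bias /smom_scale /k -/(tau j) -/q; field.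
  by rewrite !gt_eqF.
rewrite enormZ ger0_norm//; apply: (@le_trans _ _ (k * (enorm v + theta * enorm u))).
  by rewrite ler_wpM2l//; apply: le_trans (enormD _ _) _; rewrite enormZ ger0_norm// ltW.
have uE : enorm u = Num.sqrt (\sum_(j < d) M j ^+ 2).
  by rewrite enorm_sqrt_sum; congr Num.sqrt; apply: eq_bigr => j _; rewrite mxE.
have vE : enorm v = Num.sqrt (\sum_(j < d) (M j * tau j) ^+ 2).
  by rewrite enorm_sqrt_sum; congr Num.sqrt; apply: eq_bigr => j _; rewrite mxE.
rewrite CconstE -uE -vE.
have -> : 192 * (q%:R * 2 ^+ q) * (((1 + theta) / theta ^+ 2 * enorm u + 2 / theta ^+ 2 * enorm v) / n%:R)
  = k * ((1 + theta) * enorm u + 2 * enorm v) by rewrite /k; field; rewrite !gt_eqF.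
by rewrite ler_wpM2l//; have := enorm_ge0 u; have := enorm_ge0 v; lra.
Qed.

Let D1 := \sum_(j < d) (2 `^ beta j * B j / (beta j * n%:R `^ (beta j - 1))) `^ (2 / beta j).

Lemma sum_tail_scale_le : \sum_(j < d) tau j ^+ 2 <= expR 1 ^+ 2 * D1.
Proof.
rewrite /D1 mulr_sumr; apply: ler_sum => j _.
have -> : 2 `^ beta j * B j / (beta j * n%:R `^ (beta j - 1)) = 2 `^ beta j * (y j / beta j).
  by rewrite /y; field; rewrite !gt_eqF ?powR_gt0//.
have yb : 0 <= y j / beta j by apply: divr_ge0 (y0 j) (ltW (b0 j)).
rewrite powR_scaled//.
have h := powR_inv_ge (beta1 j) (y0 j).
have t0 : 0 <= tau j by rewrite /tau powR_ge0.
have h' : tau j <= expR 1 * (y j / beta j) `^ (1 / beta j).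
  rewrite mulrC -ler_pdivrMr ?expR_gt0// -expRN mulrC; exact: h.
have e0 := expR_ge0 (1 : R).
have : tau j ^+ 2 <= (expR 1 * (y j / beta j) `^ (1 / beta j)) ^+ 2.
  by rewrite ler_pXn2r ?nnegrE// mulr_ge0 ?powR_ge0.
rewrite exprMn => h2; apply: le_trans h2 _; rewrite ler_wpM2l ?sqr_ge0//.
by have := sqr_ge0 ((y j / beta j) `^ (1 / beta j)); lra.
Qed.

Lemma Dconst_ge : D1 <= Dconst theta n M B beta.
Proof.
rewrite /Dconst /D1; apply: (@le_trans _ _ (\sum_(j < d) ((M j / (theta * n%:R)) ^+ 2
    + (2 `^ beta j * B j / (beta j * n%:R `^ (beta j - 1))) `^ (2 / beta j)))).
  by apply: ler_sum => j _; rewrite lerDr sqr_ge0.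
by rewrite lerDl sumr_ge0// => j _; exact: powR_ge0.
Qed.

Lemma Dconst_ge0 : 0 <= Dconst theta n M B beta.
Proof. by apply: le_trans Dconst_ge; apply: sumr_ge0 => j _; exact: powR_ge0. Qed.

(** [(tau + theta)^2 <= 2 tau^2 + 2 theta^2] separates the two scales; [expR 1 ^+ 2] is the cost of
    the [beta] in [Dconst]. *)
Lemma smom_variance_le : smom_variance m n theta B beta <=
  2 * 2 ^+ q.+1 * (24 ^+ 2 * (2 * expR 1 ^+ 2)) * (d%:R * (1 + theta ^+ 2) + Dconst theta n M B beta).
Proof.
rewrite /smom_variance -/q -mulr_sumr -[leRHS]mulrA.
have k0 : 0 <= 2 * 2 ^+ q.+1 :> R by apply: mulr_ge0 => //; exact: exprn_ge0.
apply: ler_wpM2l => //.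
apply: (@le_trans _ _ (24 ^+ 2 * (2 * \sum_j tau j ^+ 2 + 2 * (d%:R * theta ^+ 2)))).
  have -> : d%:R * theta ^+ 2 = \sum_(j < d) theta ^+ 2 by rewrite sumr_const card_ord mulr_natl.
  rewrite !mulr_sumr -big_split/= mulr_sumr; apply: ler_sum => j _.
  rewrite /smom_scale -/(tau j) exprMn; apply: ler_wpM2l; first exact: sqr_ge0.
  by have := sqr_ge0 (tau j - theta); rewrite !expr2; lra.
rewrite -mulrA; apply: ler_wpM2l; first exact: sqr_ge0.
have h1 := sum_tail_scale_le; have h2 := Dconst_ge.
have e1 : 1 <= expR 1 ^+ 2 :> R.
  by rewrite exprn_ege1// ltW// expR_gt1.
have E0 : 0 <= d%:R * (1 + theta ^+ 2) :> R by rewrite mulr_ge0// addr_ge0// sqr_ge0.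
have d0 : 0 <= d%:R :> R by [].
have h3 : expR 1 ^+ 2 * D1 <= expR 1 ^+ 2 * Dconst theta n M B beta by rewrite ler_wpM2l// (le_trans ler01).
have h4 : d%:R * (1 + theta ^+ 2) <= expR 1 ^+ 2 * (d%:R * (1 + theta ^+ 2)) by rewrite ler_peMl.
move: h1 h3 h4; move: (Dconst _ _ _ _ _) D1 (expR 1 ^+ 2) (\sum_j tau j ^+ 2) => D D' e S h1 h3 h4.
have -> : 2 * e * (d%:R * (1 + theta ^+ 2) + D) = 2 * (e * (d%:R * (1 + theta ^+ 2))) + 2 * (e * D) by ring.
have : d%:R * theta ^+ 2 <= d%:R * (1 + theta ^+ 2) by rewrite ler_wpM2l// lerDr.
by lra.
Qed.

End constants_bounds.

(** * What the choice of the step parameter guarantees *)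

Section step_parameter.
Context (R : realType).
Variables (L rad b sigma A ca : R) (K : nat).
Hypotheses (L0 : 0 < L) (r0 : 0 < rad) (b0 : 0 <= b) (sigma0 : 0 <= sigma) (A1 : 1 <= A).
Hypotheses (K0 : (0 < K)%N) (ca0 : 168 ^+ 2 <= ca).

Let A0 : 0 < A. Proof. exact: lt_le_trans ltr01 A1. Qed.
Let Lr0 : 0 < L * rad. Proof. exact: mulr_gt0. Qed.
Let c0 : 0 < ca. Proof. by apply: lt_le_trans ca0; rewrite exprn_gt0. Qed.
Let a := ca * step_param L rad b sigma A K.
Let p : R := K.+1%:R `^ (3 / 2).

Let p0 : 0 <= p. Proof. exact: powR_ge0. Qed.

Let p_sqr : p ^+ 2 = K.+1%:R ^+ 3.
Proof.
rewrite /p -powR_mulrn ?powR_ge0// -powRrM -powR_mulrn//; congr (_ `^ _).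
by field.
Qed.

Lemma step_param_sqr : (168 * A) ^+ 2 <= a.
Proof.
rewrite exprMn; apply: ler_pM => //; try exact: sqr_ge0.
by rewrite /step_param !le_max lexx.
Qed.

Let a0 : 0 < a.
Proof. by apply: lt_le_trans step_param_sqr; rewrite exprn_gt0// mulr_gt0. Qed.

Lemma step_param_noise : ca * (sigma * p * Num.sqrt A) <= a * (L * rad).
Proof.
rewrite /a -[leRHS]mulrA; apply: ler_wpM2l; first exact: ltW.
rewrite -ler_pdivrMr//.
by rewrite /step_param !le_max lexx orbT.
Qed.

Lemma step_param_bias : ca * (b * K.+2%:R ^+ 2) <= a * (L * rad).
Proof.
rewrite /a -[leRHS]mulrA; apply: ler_wpM2l; first exact: ltW.
rewrite -ler_pdivrMr//.
by rewrite /step_param !le_max lexx !orbT.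
Qed.

(** The bias is paid for by the sum of the step sizes, of order [K^2 / (a L)], and the variance by
    the sum of their squares, of order [K^3 / (a L)^2]; these are the last two terms in the maximum
    defining [a]. Here [106 = 424 / 4], and [ca >= 168^2] leaves each sum below [A / 2]. *)
Lemma log_growth_le (V bias : R) : 0 <= bias <= b -> 0 <= V <= sigma ^+ 2 ->
  \sum_(k < K) (4 * A * alpha a L k.+1 * bias / rad + 424 * (alpha a L k.+1 * A / rad) ^+ 2 * V) <= A.
Proof.
move=> /andP[bi0 bib] /andP[V0 Vs]; rewrite big_split/=.
have s1 := sum_alpha_le a0 L0 K; have s2 := sum_alpha_sqr_le a0 L0 K.
have h1 : \sum_(k < K) 4 * A * alpha a L k.+1 * bias / rad <= A / ca.
  have -> : \sum_(k < K) 4 * A * alpha a L k.+1 * bias / rad =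
      4 * A * bias / rad * \sum_(k < K) alpha a L k.+1.
    by rewrite mulr_sumr; apply: eq_bigr => k _; ring.
  have k0 : 0 <= 4 * A * bias / rad by rewrite divr_ge0 ?(ltW r0)// mulr_ge0// mulr_ge0// ltW.
  apply: le_trans (ler_wpM2l k0 s1) _.
  have -> : 4 * A * bias / rad * (K.+2%:R ^+ 2 / (4 * a * L)) = A * (bias * K.+2%:R ^+ 2 / (a * (L * rad))).
    by field; rewrite !gt_eqF.
  rewrite ler_pM2l// ler_pdivrMr ?(mulr_gt0 a0 Lr0)// ler_pdivlMl//.
  apply: le_trans step_param_bias; rewrite ler_pM2l// ler_wpM2r//; exact: sqr_ge0.
have h2 : \sum_(k < K) 424 * (alpha a L k.+1 * A / rad) ^+ 2 * V <= 106 * (A / ca ^+ 2).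
  have -> : \sum_(k < K) 424 * (alpha a L k.+1 * A / rad) ^+ 2 * V =
      424 * (A / rad) ^+ 2 * V * \sum_(k < K) alpha a L k.+1 ^+ 2.
    by rewrite mulr_sumr; apply: eq_bigr => k _; ring.
  have k0 : 0 <= 424 * (A / rad) ^+ 2 * V.
    by apply: mulr_ge0 V0; apply: mulr_ge0 (ler0n _ _) (sqr_ge0 _).
  apply: le_trans (ler_wpM2l k0 s2) _; rewrite -p_sqr.
  have -> : 424 * (A / rad) ^+ 2 * V * (p ^+ 2 / (4 * (a * L) ^+ 2)) =
      106 * (A * (A * (V * p ^+ 2) / (a * (L * rad)) ^+ 2)) by field; rewrite !gt_eqF.
  apply: ler_wpM2l; first exact: ler0n.
  apply: ler_wpM2l; first exact: ltW.
  have aL0 : 0 < (a * (L * rad)) ^+ 2 by rewrite exprn_gt0//; exact: mulr_gt0 a0 Lr0.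
  have ca20 : 0 < ca ^+ 2 by rewrite exprn_gt0.
  rewrite ler_pdivrMr// ler_pdivlMl//.
  apply: (@le_trans _ _ ((ca * (sigma * p * Num.sqrt A)) ^+ 2)); last first.
    rewrite ler_pXn2r ?nnegrE ?step_param_noise//; last exact: ltW (mulr_gt0 a0 Lr0).
    by rewrite mulr_ge0 ?(ltW c0)// !mulr_ge0// sqrtr_ge0.
  rewrite [leRHS]exprMn ler_wpM2l ?sqr_ge0// !exprMn sqr_sqrtr ?(ltW A0)// mulrC ler_wpM2r ?(ltW A0)//.
  by rewrite ler_wpM2r ?sqr_ge0.
have c1 : 168 * 168 <= ca by move: ca0; rewrite expr2.
have i1 : A / ca <= A * (1 / 2).
  by apply: ler_wpM2l; [exact: ltW|rewrite -[ca^-1]mul1r ler_pdivrMr//; lra].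
have i2 : 106 * (A / ca ^+ 2) <= A * (1 / 2).
  have ca20 : 0 < ca ^+ 2 by rewrite exprn_gt0.
  rewrite mulrCA; apply: ler_wpM2l; first exact: ltW.
  rewrite ler_pdivrMr//.
  have : ca * 1 <= ca * ca by rewrite ler_pM2l//; lra.
  by rewrite expr2; lra.
by move: h1 h2 i1 i2; lra.
Qed.

End step_parameter.

(** * From the step parameter to the convergence rate *)

Section rate.
Context (R : realType).

(** Each branch of the maximum in [step_param] is matched with the corresponding branch of
    [final_rate]; [A^2] dominates both 1 and [sqrt A], so one power of the logarithm serves all
    three. *)
Lemma step_param_rate (d n K : nat) (L rad theta theta1 C D A cb cs : R) :
  0 < L -> 0 < rad -> 0 < theta -> theta <= theta1 -> 0 <= C -> 0 <= D -> 1 <= A -> 0 < cb -> 0 < cs ->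
  (0 < n)%N -> (0 < K)%N ->
  step_param L rad (cb * (C / n%:R)) (Num.sqrt (cs * (d%:R * (1 + theta ^+ 2) + D))) A K
    * (L * rad ^+ 2 / K%:R ^+ 2) <=
  (1 + 3 * Num.sqrt cs + 9 * (cb * theta1 ^+ 2)) * A ^+ 2 * final_rate d L rad theta C D n K.
Proof.
move=> L0 r0 t0 t1 C0 D0 A1 cb0 cs0 n0 K0.
have A0 : 0 < A by exact: lt_le_trans A1.
have A20 : 0 <= A ^+ 2 by exact: sqr_ge0.
have Kr0 : 0 < K%:R :> R by rewrite ltr0n.
have nr0 : 0 < n%:R :> R by rewrite ltr0n.
have K1 : 1 <= K%:R :> R by rewrite ler1n.
have K20 : 0 < K%:R ^+ 2 :> R by rewrite exprn_gt0.
have th20 : 0 < theta ^+ 2 by rewrite exprn_gt0.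
set rate := final_rate _ _ _ _ _ _ _ _.
set E := (1 + theta ^+ 2) * d%:R + D.
have E0 : 0 <= E by rewrite addr_ge0// mulr_ge0// addr_ge0// ltW.
have r1 : L * rad ^+ 2 / K%:R ^+ 2 <= rate by rewrite /rate /final_rate !le_max lexx.
have r2 : Num.sqrt E * rad / Num.sqrt K%:R <= rate by rewrite /rate /final_rate !le_max lexx orbT.
have r3 : (1 + theta) * C * rad / (theta ^+ 2 * n%:R) <= rate by rewrite /rate /final_rate !le_max lexx !orbT.
have Lr : 0 <= L * rad ^+ 2 / K%:R ^+ 2.
  by rewrite divr_ge0 ?(ltW K20)// mulr_ge0 ?(ltW L0)// sqr_ge0.
have rate0 : 0 <= rate by exact: le_trans r1.
have AA : A <= A ^+ 2 by rewrite expr2 ler_peMl// ltW.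
have A2 : 1 <= A ^+ 2 by exact: le_trans AA.
have sA : Num.sqrt A <= A ^+ 2.
  apply: (@le_trans _ _ A) => //.
  have s1 : 1 <= Num.sqrt A by rewrite -[leLHS]sqrtr1 ler_sqrt// ltW.
  rewrite -[leRHS](sqr_sqrtr (ltW A0)) expr2 ler_peMl// sqrtr_ge0.
have cs1 : 0 <= 3 * Num.sqrt cs by rewrite mulr_ge0// sqrtr_ge0.
have cb1 : 0 <= 9 * (cb * theta1 ^+ 2).
  by apply: mulr_ge0 => //; apply: mulr_ge0 (ltW cb0) (sqr_ge0 _).
have AR : 0 <= A ^+ 2 * rate by exact: mulr_ge0.
have fin c x : 0 <= c -> c <= 1 + 3 * Num.sqrt cs + 9 * (cb * theta1 ^+ 2) -> x <= c * (A ^+ 2 * rate) ->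
    x <= (1 + 3 * Num.sqrt cs + 9 * (cb * theta1 ^+ 2)) * A ^+ 2 * rate.
  by move=> c0 cc xc; rewrite -mulrA; apply: le_trans xc _; rewrite ler_wpM2r.
have t1r : A ^+ 2 * (L * rad ^+ 2 / K%:R ^+ 2) <=
    (1 + 3 * Num.sqrt cs + 9 * (cb * theta1 ^+ 2)) * A ^+ 2 * rate.
  apply: (fin 1) => //; first by lra.
  by rewrite mul1r ler_wpM2l.
have t2r : Num.sqrt (cs * (d%:R * (1 + theta ^+ 2) + D)) * K.+1%:R `^ (3 / 2) * Num.sqrt A / (L * rad)
    * (L * rad ^+ 2 / K%:R ^+ 2) <=
    (1 + 3 * Num.sqrt cs + 9 * (cb * theta1 ^+ 2)) * A ^+ 2 * rate.
  apply: (fin (3 * Num.sqrt cs)) => //; first by lra.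
  have -> : d%:R * (1 + theta ^+ 2) + D = E by rewrite /E mulrC.
  rewrite sqrtrM ?(ltW cs0)//; set p := _ `^ _.
  have p0 : 0 <= p by exact: powR_ge0.
  have p2 : p ^+ 2 = K.+1%:R ^+ 3.
    rewrite /p -powR_mulrn ?powR_ge0// -powRrM -powR_mulrn//; congr (_ `^ _); by field.
  set w := Num.sqrt K%:R in r2.
  have w0 : 0 < w by rewrite sqrtr_gt0.
  have w2 : w ^+ 2 = K%:R by rewrite sqr_sqrtr// ltW.
  (* After squaring: [(K + 1)^3 K <= 8 K^4 <= 9 K^4]. *)
  have pw : p * w <= 3 * K%:R ^+ 2.
    rewrite -(@ler_pXn2r _ 2)// ?nnegrE ?mulr_ge0 ?(ltW w0) ?(ltW K20)//.
    rewrite exprMn p2 w2 -natr1; move: (K%:R : R) K1 => k k1.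
    have k3 : (k + 1) ^+ 3 <= (2 * k) ^+ 3 by apply: lerXn2r; rewrite ?nnegrE/=; lra.
    have k0 : 0 <= k by lra.
    apply: le_trans (ler_wpM2r k0 k3) _.
    have : 0 <= k ^+ 4 by rewrite exprn_ge0.
    have -> : (2 * k) ^+ 3 * k = 8 * k ^+ 4 by ring.
    have -> : (3 * k ^+ 2) ^+ 2 = 9 * k ^+ 4 by ring.
    lra.
  have pK : p / K%:R ^+ 2 <= 3 / w.
    by rewrite ler_pdivrMr// mulrAC ler_pdivlMr.
  have -> : Num.sqrt cs * Num.sqrt E * p * Num.sqrt A / (L * rad) * (L * rad ^+ 2 / K%:R ^+ 2) =
      (Num.sqrt cs * (Num.sqrt A * (Num.sqrt E * rad))) * (p / K%:R ^+ 2).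
    by field; rewrite !gt_eqF.
  have z0 : 0 <= Num.sqrt cs * (Num.sqrt A * (Num.sqrt E * rad)) by rewrite !mulr_ge0 ?sqrtr_ge0// ltW.
  apply: le_trans (ler_wpM2l z0 pK) _.
  have -> : Num.sqrt cs * (Num.sqrt A * (Num.sqrt E * rad)) * (3 / w) =
    3 * Num.sqrt cs * (Num.sqrt A * (Num.sqrt E * rad / w)) by field; rewrite gt_eqF.
  rewrite ler_wpM2l// ler_pM ?sqrtr_ge0//.
  by rewrite divr_ge0 ?(ltW w0)// mulr_ge0 ?sqrtr_ge0// ltW.
have t3r : cb * (C / n%:R) * K.+2%:R ^+ 2 / (L * rad) * (L * rad ^+ 2 / K%:R ^+ 2) <=
    (1 + 3 * Num.sqrt cs + 9 * (cb * theta1 ^+ 2)) * A ^+ 2 * rate.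
  apply: (fin (9 * (cb * theta1 ^+ 2))) => //; first by lra.
  have q0 : 0 <= C / n%:R * rad by rewrite mulr_ge0 ?(ltW r0)// divr_ge0// ltW.
  have -> : cb * (C / n%:R) * K.+2%:R ^+ 2 / (L * rad) * (L * rad ^+ 2 / K%:R ^+ 2) =
     cb * (C / n%:R * rad) * (K.+2%:R / K%:R) ^+ 2.
    by field; rewrite !gt_eqF.
  have k3 : (K.+2%:R / K%:R) ^+ 2 <= 9 :> R.
    have -> : 9 = 3 ^+ 2 :> R by ring.
    rewrite ler_pXn2r ?nnegrE ?divr_ge0// ler_pdivrMr// -natr1 -(natr1 K); lra.
  have v0 : 0 <= cb * (C / n%:R * rad) by rewrite mulr_ge0// ltW.
  apply: le_trans (ler_wpM2l v0 k3) _.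
  have -> : 9 * (cb * theta1 ^+ 2) * (A ^+ 2 * rate) = cb * (theta1 ^+ 2 * (A ^+ 2 * rate)) * 9 by ring.
  rewrite ler_wpM2r// ler_wpM2l ?(ltW cb0)//.
  (* The last branch of the rate carries [(1 + theta) / theta^2] on top of [C rad / n]. This factor
     may be small when [theta] is large, which is why the constant depends on the bound [theta1]. *)
  have e3 : C / n%:R * rad <= theta ^+ 2 * rate.
    apply: le_trans (ler_wpM2l (ltW th20) r3).
    have -> : theta ^+ 2 * ((1 + theta) * C * rad / (theta ^+ 2 * n%:R)) = (1 + theta) * (C / n%:R * rad).
      by field; rewrite !gt_eqF.
    by rewrite ler_peMl// lerDl ltW.
  apply: le_trans e3 _; apply: ler_pM => //; first exact: ltW.
    by rewrite ler_pXn2r ?nnegrE ?(ltW t0)//; lra.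
  by rewrite ler_peMl.
have mx (x y t : R) : x * t <= y -> forall x', x' * t <= y -> Num.max x x' * t <= y.
  by move=> hx x' hx'; case: (leP x x').
by rewrite /step_param; apply: (mx) t3r; exact: (mx) t2r.
Qed.

End rate.

Section minimizer.
Context (R : realType) (d : nat) (f : 'rV[R]_d -> R) (xs : 'rV[R]_d) (rad : R).
Hypotheses (fmin : forall x, f xs <= f x) (r0 : 0 < rad).

Lemma inf_minimizer : inf (f @` eball xs (3 * rad)) = f xs.
Proof.
have Qxs : eball xs (3 * rad) xs by rewrite /eball/= subrr enorm0 mulr_ge0// ltW.
apply/eqP; rewrite eq_le; apply/andP; split.
  by apply: ge_inf; [exists (f xs) => _ [x _ <-]|exists xs].
by apply: lb_le_inf; [exists (f xs), xs|move=> _ [x _ <-]].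
Qed.

End minimizer.

Lemma log_term_ge1 (R : realType) (K : nat) (delta : R) : 0 < delta <= 1 ->
  1 <= log_term K delta /\ K%:R * expR (- log_term K delta) <= delta.
Proof.
move=> /andP[d0 d1].
have q0 : 0 < 4 * K.+1%:R / delta by rewrite divr_gt0// mulr_gt0.
(* The factor 4 in the logarithm ensures [A >= 1], as [e <= 4]. *)
have e4 : expR 1 <= 4 :> R by apply: le_trans (expR_le_quad (lexx 1)) _; lra.
split.
  rewrite -ler_expR lnK ?posrE//; apply: le_trans e4 _.
  rewrite ler_pdivlMr//; have : 1 <= K.+1%:R :> R by rewrite ler1n.
  by nra.
rewrite expRN lnK ?posrE// invf_div mulrA ler_pdivrMr ?mulr_gt0// mulrC ler_wpM2l ?(ltW d0)//.
by have := ler0n R K; rewrite -(natr1 K); lra.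
Qed.

(* cn, cb, cs, ca, cl are the universal constants in Omega, O, Theta for n, b,
   sigma^2, a, lambda_k; cq the one in the number of oracle calls; c and p the
   constant and the power of the logarithm hidden in the final bound. *)
Theorem corollary5p8 (R : realType) (m : nat) :
  exists (cn cb cs ca cl : R) (cq p : nat),
  [/\ 0 < cn, 0 < cb, 0 < cs, 0 < ca & 0 < cl] /\
  forall theta0 : R, 0 < theta0 ->
  exists c : R,
  forall (d : nat) (f : 'rV[R]_d -> R) (xstar x0 : 'rV[R]_d) (rad L : R)
    (dispX : measure_display) (Xi : measurableType dispX)
    (law : probability Xi R) (oracle : Xi -> 'rV[R]_d -> 'rV[R]_d)
    (M B beta : 'I_d -> R) (K n : nat) (delta theta : R)
    (dispT : measure_display) (T : measurableType dispT)
    (P : probability T R) (xi : nat -> T -> Xi)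
    (eta : nat -> 'I_(m.*2.+1) -> T -> 'rV[R]_d),
  (0 < d)%N ->
  (forall x, differentiable f x) ->
  (forall x, f xstar <= f x) ->
  0 < rad -> enorm (x0 - xstar) <= rad ->
  let Q := eball xstar (3 * rad) in
  0 < L ->
  (forall x y, Q x -> Q y ->
    [/\ enorm (gradient f x - gradient f y) <= L * enorm (x - y),
        enorm (gradient f x) ^+ 2 <= 2 * L * (f x - inf (f @` Q)) &
        f x + dotv (gradient f x) (y - x) <= f y]) ->
  jointly_measurable oracle ->
  (forall x, structured_noise law (oracle^~ x) (gradient f x) M B beta) ->
  (forall j, 2 + 3 / beta j < m%:R) ->
  (0 < K)%N -> 0 < delta <= 1 -> 0 < theta <= theta0 ->
  cn * (\big[Num.max/0]_(j < d) M j / theta ^+ 2) <= n%:R ->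
  fresh_randomness P law xi eta ->
  let C := Cconst theta n M B beta in
  let D := Dconst theta n M B beta in
  let b := cb * (C / n%:R) in
  let sigma := Num.sqrt (cs * (d%:R * (1 + theta ^+ 2) + D)) in
  let A := log_term K delta in
  let a := ca * step_param L rad b sigma A K in
  let lam k := cl * (rad / (alpha a L k.+1 * A)) in
  let run w := clipped_sstm a L lam
    (smom_estimator n theta (fun t => oracle (xi t w)) (fun k j => eta k j w))
    x0 K in
  ((1 - delta)%:E <=
     P [set w | (f (sstm_y (run w)) - f xstar <=
                 c * A ^+ p * final_rate d L rad theta C D n K)%R])%E /\
  (forall w, (sstm_calls (run w) <= cq * (n * K))%N).
Proof.
pose q := m.*2.+1.
pose cb : R := 192 * (q%:R * 2 ^+ q).
pose cs : R := 2 * 2 ^+ q.+1 * (24 ^+ 2 * (2 * expR 1 ^+ 2)).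
have p2 k : 0 < 2 ^+ k :> R by rewrite exprn_gt0.
have cb0 : 0 < cb by rewrite /cb; apply: mulr_gt0; [exact: ltr0Sn|apply: mulr_gt0 (p2 _); exact: ltr0Sn].
have cs0 : 0 < cs.
  apply: mulr_gt0; first exact: mulr_gt0.
  by apply: mulr_gt0; [rewrite exprn_gt0|apply: mulr_gt0 => //; rewrite exprn_gt0// expR_gt0].
(* [ca A^2 <= a] keeps [|grad f| <= lam / 2] at every point reached before exit. *)
pose ca : R := 168 ^+ 2.
have ca0 : 0 < ca by rewrite exprn_gt0.
(* [cn = 1] yields [M j <= n theta^2], as the block tail bound requires; [16^-1] is the clipping
   constant of [clipped_exp_le]; one iteration makes [q * n] calls; the power 2 is that of [A] in
   the step parameter. *)
exists 1, cb, cs, ca, 16^-1, q, 2%N; split; first by split => //; rewrite invr_gt0.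
move=> theta1 theta10.
(* [6] comes from the gap at the exit level, [ca] from [a], and each summand from one branch of the
   maximum in [step_param]. *)
exists (6 * ca * (1 + 3 * Num.sqrt cs + 9 * (cb * theta1 ^+ 2))).
move=> d f xs x0 rad L dispX Xi law oracle M B beta K n delta theta dispT T P xi eta.
move=> d0 df fmin rad0 x0r Q L0 smooth mor sn mb K0 delta01 /andP[th0 th1] nM fr C D b sigma A a lam run.
pose l0 := Ordinal d0.
have pos j : [/\ 0 < M j, 0 < B j & 1 <= beta j].
  by have [_ /(_ j)[p [_ [? _ _] [? ? _]]]] := sn xs.
have M0 j : 0 < M j by case: (pos j).
have B0 j : 0 < B j by case: (pos j).
have b1 j : 1 <= beta j by case: (pos j).
have th20 : 0 < theta ^+ 2 by rewrite exprn_gt0.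
have Mn j : M j <= n%:R * theta ^+ 2.
  rewrite -ler_pdivrMr//; apply: le_trans nM; rewrite mul1r ler_pM2r ?invr_gt0//.
  exact: le_bigmax.
have n0 : (0 < n)%N.
  rewrite -(ltr0n R); have := lt_le_trans (M0 l0) (Mn l0).
  by rewrite pmulr_lgt0.
(* Since [3 / beta] is nonnegative, [m > 2]: the exponents [m + 1 >= 4] and [m >= 2] in the two
   moments of the median follow. *)
have m3 : (3 <= m)%N.
  rewrite -(ltr_nat R); apply: le_lt_trans (mb l0).
  by rewrite lerDl divr_ge0// (le_trans ler01).
have Qxs : eball xs (3 * rad) xs by rewrite /eball/= subrr enorm0 mulr_ge0// ltW.
have infE : inf (f @` Q) = f xs by exact: inf_minimizer.
(* The bound of the squared gradient by the gap is read at the minimizer, where the gap to the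
   infimum over [Q] is zero. *)
have Gxs : gradient f xs = 0.
  apply: enorm_eq0; have [_ + _] := smooth _ _ Qxs Qxs.
  by rewrite infE subrr mulr0 exprn_even_le0//= => /eqP.
have [A1 KA] := log_term_ge1 K delta01; rewrite -/A in A1 KA.
have C0 : 0 <= C by exact: Cconst_ge0.
have D0 : 0 <= D by exact: Dconst_ge0.
have nr0 : 0 < n%:R :> R by rewrite ltr0n.
have b0 : 0 <= b by rewrite mulr_ge0 ?(ltW cb0)// divr_ge0// ltW.
have sg0 : 0 <= sigma by exact: sqrtr_ge0.
have E0 : 0 <= d%:R * (1 + theta ^+ 2) + D.
  by rewrite addr_ge0// mulr_ge0// addr_ge0// ltW.
have aA := @step_param_sqr R L rad b sigma A ca K (lexx _).
have V0 : 0 <= smom_variance m n theta B beta.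
  by apply: sumr_ge0 => j _; rewrite mulr_ge0 ?sqr_ge0//; apply: mulr_ge0 => //; exact: ltW.
have bi0 : 0 <= smom_bias m n theta M B beta by exact: sqrtr_ge0.
have Vs : smom_variance m n theta B beta <= sigma ^+ 2.
  rewrite sqr_sqrtr; last exact: mulr_ge0 (ltW cs0) E0.
  by apply: smom_variance_le.
have bb : smom_bias m n theta M B beta <= b by exact: smom_bias_le.
have a0 : 0 < a by apply: lt_le_trans aA; rewrite exprn_gt0// mulr_gt0// (lt_le_trans ltr01).
have growth : \sum_(k < K) sstm_log_growth m n theta M B beta rad L a A k <= A.
  have bb' : 0 <= smom_bias m n theta M B beta <= b by rewrite bi0.
  have VV' : 0 <= smom_variance m n theta B beta <= sigma ^+ 2 by rewrite V0.
  have := @log_growth_le R L rad b sigma A ca K; apply => //; exact: ltW.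
have growth0 k : 0 <= sstm_log_growth m n theta M B beta rad L a A k.
  have al0 := alpha_gt0 a0 L0 k.
  apply: addr_ge0.
    apply: divr_ge0 (ltW rad0); apply: mulr_ge0 => //; apply: mulr_ge0 (ltW al0).
    by apply: mulr_ge0 => //; exact: le_trans A1.
  by apply: mulr_ge0 V0; apply: mulr_ge0 (ler0n _ _) (sqr_ge0 _).
have cf : continuous f by move=> x; exact: differentiable_continuous.
have Glip x y : eball xs (3 * rad) x -> eball xs (3 * rad) y ->
    enorm (gradient f x - gradient f y) <= L * enorm (x - y).
  by move=> hx hy; have [] := smooth x y hx hy.
have Gsqr x : eball xs (3 * rad) x -> enorm (gradient f x) ^+ 2 <= 2 * L * (f x - f xs).
  by move=> hx; have [_ + _] := smooth x x hx hx; rewrite infE.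
have fconv x y : eball xs (3 * rad) x -> eball xs (3 * rad) y ->
    f x + dotv (gradient f x) (y - x) <= f y.
  by move=> hx hy; have [] := smooth x y hx hy.
have [mA PA] := exit_probability fr mor m3 n0 th0 Mn rad0 L0 A1 aA fmin Gxs Glip Gsqr fconv cf sn
  x0r l0 growth growth0.
split; last first.
  move=> w; rewrite -[run w]/(sstm_run xi eta oracle n theta a L lam x0 w K) sstm_run_calls.
  by rewrite /sstm_batch mulnCA [(K * n)%N]mulnC.
set E := [set w | _].
set Al := sstm_alive _ _ _ _ _ _ _ _ _ _ _ _ K in mA PA.
have my : vector_measurable (fun w => sstm_y (run w)).
  have [my _] := @sstm_run_measurable _ _ _ _ _ _ _ xi eta oracle n theta a L lam x0 mor K _ (@subsetT _ _).
  by move=> l; exact: (generated_measurable fr (my l)).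
have mE : measurable E.
  rewrite /E -preimage_itvNyc -[_ @^-1` _]setTI.
  by apply: measurable_funB => //; exact: measurable_continuous_comp.
have sub : Al `<=` E.
  move=> w hw; rewrite /E /=.
  have := hw; rewrite /Al /sstm_alive big_ord_recr => -[_ /= pw].
  have := confined_gap L0 A1 aA fmin K0 pw.
  rewrite -[sstm_y _]/(sstm_y (run w)) => h; apply: le_trans h _.
  have := step_param_rate d L0 rad0 th0 th1 C0 D0 A1 cb0 cs0 n0 K0.
  rewrite -/b -/sigma => h.
  have -> : 6 * (a * L * rad ^+ 2 / K%:R ^+ 2) =
    6 * ca * (step_param L rad b sigma A K * (L * rad ^+ 2 / K%:R ^+ 2)) by rewrite /a; ring.
  have c6 : 0 <= 6 * ca by rewrite mulr_ge0// ltW.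
  apply: le_trans (ler_wpM2l c6 h) _.
  by rewrite !mulrA.
apply: (@le_trans _ _ (P Al)); last by apply: le_measure; rewrite ?inE.
have PE : P Al = (1 - P (~` Al))%E.
  by rewrite -[in LHS](setCK Al) (probability_setC P)//; exact: measurableC.
rewrite PE EFinB leeB//; apply: le_trans PA _; by rewrite lee_fin.
Qed.
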